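(* There exists an absolute constant $b_{\mathrm Z}>0$ such that the following holds. Let $(\Omega,\mathcal U)$ be an admissible pair in the Zygmund setting, let $w\colon\mathbb N^2\to[0,\infty)$ be a nonzero admissible weight (nonincreasing in each variable with $\|w\|_{\mathrm{ft}}<\infty$), and put $\kappa_w:=\frac1{160\|w\|_{\mathrm{ft}}}$. Then there is a $1/8$-sparse subfamily $\mathcal G_0\subset\mathcal U$ such that $$\int_{\mathbb R^{d_1+d_2+d_3}}\Bigl[\cosh\bigl(b_{\mathrm Z}\sqrt{\kappa_wH_w(x)}\bigr)-1\Bigr]dx\le\int_{\mathbb R^{d_1+d_2+d_3}}\Bigl[\cosh\bigl(b_{\mathrm Z}\sqrt{h_{\mathcal G_0}(x)}\bigr)-1\Bigr]dx\le\frac14|\operatorname{sh}(\mathcal G_0)|.$$ Consequently, $$\int_\Omega\exp\bigl(b_{\mathrm Z}\sqrt{\kappa_wH_w(x)}\bigr)dx\le\frac52|\Omega|.$$ The same sparse family satisfies, for every $1\le q<\infty$, $$\|H_w\|_{L^q(\Omega)}\le\frac{2q^2}{b_{\mathrm Z}^2\kappa_w}|\operatorname{sh}(\mathcal G_0)|^{1/q}.$$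
   Context: $\mathbb N=\{0,1,2,\dots\}$; $|\cdot|$ is Lebesgue measure. Fix dyadic grids $\mathcal D^i$ of cubes in $\mathbb R^{d_i}$, $i=1,2,3$ (side lengths $2^k$, $k\in\mathbb Z$). $\ell(Q)$ is the side length of $Q$, and $Q^{(k)}$ is its $k$th dyadic ancestor (the cube of the same grid containing $Q$ with side length $2^k\ell(Q)$). The dimensions $d_1,d_2,d_3$ are fixed throughout. Zygmund setting: the dyadic Zygmund rectangles are $I=I^1\times I^2\times I^3$, $I^i\in\mathcal D^i$, with $\ell(I^3)=\ell(I^1)\ell(I^2)$; $\mathcal D_{\mathrm{sZ}}$ consists of all $I^1\times I^2\times I^3$, $I^i\in\mathcal D^i$, with $\ell(I^3)\le\ell(I^1)\ell(I^2)$. For $\Omega\subset\mathbb R^{d_1+d_2+d_3}$ measurable of finite measure, $\widetilde\Omega:=\{M1_\Omega>1/2\}$ where $Mf(x):=\sup_{R\in\mathcal D_{\mathrm{sZ}},\,x\in R}\frac1{|R|}\int_R|f|$. For a Zygmund rectangle $I\subset\Omega$ and $i=1,2$, $I_i^{(k)}$ is obtained from $I$ by replacing only $I^i$ by $(I^i)^{(k)}$, and $e_i(I;\Omega):=\max\{k\ge0:I_i^{(k)}\subset\widetilde\Omega\}$. $(\Omega,\mathcal U)$ is an admissible pair if $\Omega$ is measurable with finite measure and $\mathcal U$ is a family of dyadic Zygmund rectangles, all contained in $\Omega$, which is incomparable: no member is contained in a different member. $W_w(I;\Omega):=w(e_1(I;\Omega),e_2(I;\Omega))$, $H_w(x):=\sum_{I\in\mathcal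 U}W_w(I;\Omega)1_I(x)$, and $\|w\|_{\mathrm{ft}}:=\sup_{N\ge0}\sum_{a=0}^Nw(a,N-a)$. $\operatorname{sh}(\mathcal G):=\bigcup_{I\in\mathcal G}I$ and $h_{\mathcal G}:=\sum_{I\in\mathcal G}1_I$. For $0<\eta\le1$, a family $\mathcal G$ is $\eta$-sparse if there are pairwise disjoint measurable sets $E_I\subset I$, $I\in\mathcal G$, with $|E_I|\ge\eta|I|$. *)

(* Defs.v *)
From HB Require Import structures.
From mathcomp Require Import all_boot all_order all_algebra.
From mathcomp Require Import all_classical all_reals all_analysis.

Set Implicit Arguments.
Unset Strict Implicit.
Unset Printing Implicit Defensive.
Import Order.TTheory GRing.Theory Num.Theory.
Import numFieldNormedType.Exports.

Local Open Scope classical_set_scope.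
Local Open Scope ring_scope.
Local Open Scope ereal_scope.

(* n-dimensional Lebesgue measure on the Borel sets of n.-tuple R, as an
   iterated integral over the coordinates *)
Fixpoint lebesgue_tuple (R : realType) (n : nat) :
    set (n.-tuple (measurableTypeR R)) -> \bar R :=
  match n with
  | 0 => fun A => \d_([tuple] : 0.-tuple (measurableTypeR R)) A
  | n'.+1 => fun A => \int[lebesgue_measure]_x
      lebesgue_tuple [set t : n'.-tuple (measurableTypeR R) |
                        A [tuple of x :: t]]
  end.

Section lebesgue_tuple_measure.
Context (R : realType).
Local Notation T n := (n.-tuple (measurableTypeR R)).

Let cns n (p : measurableTypeR R * T n) : T n.+1 := [tuple of p.1 :: p.2].

Let measurable_cns n : measurable_fun setT (@cns n).
Proof. exact: measurable_cons. Qed.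

Let uncns n (t : T n.+1) : measurableTypeR R * T n :=
  (thead t, [tuple of behead t]).

Let measurable_uncns n : measurable_fun setT (@uncns n).
Proof.
apply: measurable_fun_pair; first exact: measurable_tnth.
exact: measurable_behead.
Qed.

Let cnsK n : cancel (@cns n) (@uncns n).
Proof. by move=> [x t]; rewrite /uncns /cns /= theadE; congr pair; exact: val_inj. Qed.

Let uncnsK n : cancel (@uncns n) (@cns n).
Proof. by move=> t; rewrite /uncns /cns /= [RHS]tuple_eta; exact: val_inj. Qed.

Let sigma_finite_measureP n (f : set (T n) -> \bar R) :=
  exists m : {sigma_finite_measure set (T n) -> \bar R}, f = m :> (set _ -> _).

Let product_sigma_finite n (m : {sigma_finite_measure set (T n) -> \bar R}) :
  sigma_finite setT (@lebesgue_measure R \x m).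
Proof.
have /sigma_finiteP[F [TF ndF Foo]] := sigma_finiteT (@lebesgue_measure R).
have /sigma_finiteP[G [TG ndG Goo]] := sigma_finiteT m.
exists (fun n => F n `*` G n).
  rewrite -setXTT TF TG predeqE => -[x y]; split.
    move=> [/= [j _ Fjx] [k _ Gky]]; exists (maxn j k) => //; split.
    - by move: x Fjx; exact/subsetPset/ndF/leq_maxl.
    - by move: y Gky; exact/subsetPset/ndG/leq_maxr.
  by move=> [j _ []/= ? ?]; split; exists j.
move=> k; have [? ?] := Foo k; have [? ?] := Goo k.
split; first exact: measurableX.
by rewrite product_measure1E// lte_mul_pinfty// ge0_fin_numE.
Qed.

Let pushforward_cns n (P : {measure set (measurableTypeR R * T n) -> \bar R})
    (mu : set (T n.+1) -> \bar R) :
  sigma_finite setT P -> mu = pushforward P (@cns n) -> sigma_finite_measureP mu.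
Proof.
move=> [F FT mF] muE.
have mu0 : mu set0 = 0 by rewrite muE /pushforward preimage_set0 measure0.
have mu_ge0 A : 0 <= mu A by rewrite muE /pushforward measure_ge0.
have mu_sigma : semi_sigma_additive mu.
  rewrite muE; exact: (@measure_semi_sigma_additive _ _ _
    (measure_function_pushforward__canonical__measure_function_Measure P
      (@measurable_cns n))).
pose Hm := isMeasure.Build _ _ _ mu mu0 mu_ge0 mu_sigma.
pose m0 : {measure set (T n.+1) -> \bar R} := HB.pack mu Hm.
have mu_fin : sigma_finite setT m0.
  exists (fun k => @uncns n @^-1` F k).
    by rewrite -preimage_bigcup -FT preimage_setT.
  move=> k; have [mFk Fk] := mF k; split.
    by rewrite -[X in measurable X]setTI; exact: measurable_uncns.
  rewrite /= muE /pushforward -comp_preimage.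
  rewrite (_ : _ @^-1` F k = F k)//.
  by apply/seteqP; split=> t /=; rewrite cnsK.
pose Hs := @Measure_isSigmaFinite.Build _ _ _ (m0 : set _ -> _) mu_fin.
pose m1 : {sigma_finite_measure set (T n.+1) -> \bar R} :=
  HB.pack (m0 : set _ -> _) m0 Hs.
by exists m1.
Qed.

Let lebesgue_tupleP n : sigma_finite_measureP (@lebesgue_tuple R n).
Proof.
elim: n => [|n [m IH]].
  by exists (\d_([tuple] : T 0)).
apply: (@pushforward_cns _ (@lebesgue_measure R \x m)).
  exact: product_sigma_finite.
apply/funext => A; rewrite /= /pushforward /product_measure1.
apply: eq_integral => x _ /=; rewrite IH; congr (m _).
by apply/seteqP; split=> t; rewrite /xsection /= inE.
Qed.

Let lebesgue_tuple0 n : @lebesgue_tuple R n set0 = 0.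
Proof. by have [m ->] := lebesgue_tupleP n. Qed.

Let lebesgue_tuple_ge0 n A : 0 <= @lebesgue_tuple R n A.
Proof. by have [m ->] := lebesgue_tupleP n. Qed.

Let lebesgue_tuple_semi_sigma_additive n :
  semi_sigma_additive (@lebesgue_tuple R n).
Proof.
by have [m ->] := lebesgue_tupleP n; exact: measure_semi_sigma_additive.
Qed.

HB.instance Definition _ n := isMeasure.Build _ _ _ (@lebesgue_tuple R n)
  (@lebesgue_tuple0 n) (@lebesgue_tuple_ge0 n)
  (@lebesgue_tuple_semi_sigma_additive n).

Let lebesgue_tuple_sigma_finite n : sigma_finite setT (@lebesgue_tuple R n).
Proof. by have [m ->] := lebesgue_tupleP n; exact: sigma_finiteT. Qed.

HB.instance Definition _ n := @Measure_isSigmaFinite.Build _ _ _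
  (@lebesgue_tuple R n) (@lebesgue_tuple_sigma_finite n).

End lebesgue_tuple_measure.

Lemma lebesgue_tuple_box (R : realType) n (a : n.-tuple R) (l : R) :
  (0 <= l)%R ->
  lebesgue_tuple [set x : n.-tuple (measurableTypeR R) |
    forall j, (tnth a j <= (tnth x j : R) < tnth a j + l)%R] = (l ^+ n)%:E.
Proof.
move=> l0; elim: n a => [a|n IH a].
  rewrite /= diracE mem_set ?expr0//= => -[]//.
rewrite /=.
transitivity (\int[lebesgue_measure]_x (l ^+ n *
    \1_(`[thead a, thead a + l[%classic : set (measurableTypeR R)) x)%:E).
  apply: eq_integral => x _.
  rewrite indicE; case: (boolP (x \in _)) => hx.
    rewrite mulr1 -(IH [tuple of behead a]); congr lebesgue_tuple.
    apply/seteqP; split=> t /= h j.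
      by have := h (lift ord0 j); rewrite [a in tnth a _]tuple_eta !tnthS.
    case: (unliftP ord0 j) => [i|] ->.
      by rewrite [a]tuple_eta !tnthS; exact: h.
    by move: hx; rewrite inE /= in_itv.
  rewrite mulr0 (_ : [set _ | _] = set0) ?measure0//.
  apply/seteqP; split=> t //= h; move/negP: hx; apply.
  by rewrite inE /= in_itv /=; have := h ord0.
under eq_integral do rewrite EFinM.
rewrite ge0_integralZl//=; last 2 first.
- by apply/measurable_realfun.measurable_EFinP.
- by rewrite lee_fin exprn_ge0.
rewrite integral_indic ?setIT//= lebesgue_measure_itv/= lte_fin.
rewrite exprSr EFinM; congr (_ * _).
case: ifPn => [_|]; first by rewrite -EFinB addrC addKr.
by rewrite ltrDl -leNgt => l0'; congr EFin; apply/eqP; rewrite eq_le l0 l0'.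
Qed.

Section space.
Context (R : realType) (d1 d2 d3 : nat).
Local Notation T n := (n.-tuple (measurableTypeR R)).

Definition borel_lebesgue : set (T d1 * T d2 * T d3) -> \bar R :=
  (@lebesgue_tuple R d1 \x @lebesgue_tuple R d2) \x @lebesgue_tuple R d3.

HB.instance Definition _ := Measure.on borel_lebesgue.

(* R^(d1+d2+d3), seen as R^d1 * R^d2 * R^d3, with the Lebesgue measurable sets *)
Definition zspace := caratheodory_type (mu_ext borel_lebesgue).

Definition zlebesgue : set zspace -> \bar R :=
  @completed_measure_extension _ _ R borel_lebesgue.

HB.instance Definition _ := Measure.on zlebesgue.
End space.

(* A cube is given by its level k and its lower corner a; it is the half-open
   cube with corner a and side length 2 ^ k *)
Section cubes.
Context (R : realType) (d : nat).
Local Open Scope ring_scope.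

Definition cube : Type := (int * d.-tuple R)%type.

Definition side (Q : cube) : R := (2 : R) ^ Q.1.

Definition cube_set (Q : cube) : set (d.-tuple (measurableTypeR R)) :=
  [set x | forall j : 'I_d,
     tnth Q.2 j <= (tnth x j : R) < tnth Q.2 j + side Q].

Definition dyadic_grid (D : set cube) : Prop :=
  (forall (k : int) (x : d.-tuple (measurableTypeR R)),
     exists Q, [/\ D Q, Q.1 = k & cube_set Q x]) /\
  (forall P Q, D P -> D Q -> P.1 <= Q.1 ->
     cube_set P `<=` cube_set Q \/ cube_set P `&` cube_set Q = set0).

(* In a dyadic grid the ancestor exists and is unique, so the default value Q
   of xget is never used *)
Definition ancestor (D : set cube) (k : nat) (Q : cube) : cube :=
  xget Q [set P | [/\ D P, cube_set Q `<=` cube_set P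
                    & side P = 2 ^+ k * side Q]].

End cubes.

Section weights.
Context (R : realType).

Definition ft_norm (w : nat -> nat -> R) : \bar R :=
  ereal_sup [set (\sum_(a < N.+1) w a (N - a)%N)%:E | N in [set: nat]].

Definition admissible_weight (w : nat -> nat -> R) : Prop :=
  [/\ forall m n, (0 <= w m n)%R,
      forall m m' n, (m <= m')%N -> (w m' n <= w m n)%R,
      forall m n n', (n <= n')%N -> (w m n' <= w m n)%R
    & ft_norm w < +oo].

Definition kappa (w : nat -> nat -> R) : R := ((160 * fine (ft_norm w))^-1)%R.

Definition coshe (x : \bar R) : \bar R :=
  (2^-1)%:E * (expeR x + expeR (- x)).

End weights.

Section zygmund.
Context (R : realType) (d1 d2 d3 : nat).
Local Notation zspace := (zspace R d1 d2 d3).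
Local Notation mu := (@zlebesgue R d1 d2 d3).

Definition zrect : Type := (cube R d1 * cube R d2 * cube R d3)%type.

Definition rect_set (I : zrect) : set zspace :=
  cube_set I.1.1 `*` cube_set I.1.2 `*` cube_set I.2.

Context (D1 : set (cube R d1)) (D2 : set (cube R d2)) (D3 : set (cube R d3)).

Definition zygmund_rects : set zrect :=
  [set I | [/\ D1 I.1.1, D2 I.1.2, D3 I.2
             & (side I.2 = side I.1.1 * side I.1.2)%R]].

Definition sub_zygmund_rects : set zrect :=
  [set I | [/\ D1 I.1.1, D2 I.1.2, D3 I.2
             & (side I.2 <= side I.1.1 * side I.1.2)%R]].

Definition maximal_fun (f : zspace -> R) (x : zspace) : \bar R :=
  ereal_sup [set (mu (rect_set P))^-1 *
                   \int[mu]_(y in rect_set P) `|(f y)%:E|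
            | P in [set P | sub_zygmund_rects P /\ rect_set P x]].

Definition enlargement (Om : set zspace) : set zspace :=
  [set x | (2^-1)%:E < maximal_fun \1_Om x].

Definition expand1 (k : nat) (I : zrect) : zrect :=
  (ancestor D1 k I.1.1, I.1.2, I.2).

Definition expand2 (k : nat) (I : zrect) : zrect :=
  (I.1.1, ancestor D2 k I.1.2, I.2).

(* The maximum of a set of natural numbers; the default value 0 is only used
   when there is no maximum, which does not happen for the embeddedness of a
   Zygmund rectangle contained in a set of finite measure *)
Definition max_nat (K : set nat) : nat :=
  xget 0%N [set k | K k /\ forall j, K j -> (j <= k)%N].

Definition embed1 (I : zrect) (Om : set zspace) : nat :=
  max_nat [set k | rect_set (expand1 k I) `<=` enlargement Om].

Definition embed2 (I : zrect) (Om : set zspace) : nat :=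
  max_nat [set k | rect_set (expand2 k I) `<=` enlargement Om].

Definition admissible_pair (Om : set zspace) (U : set zrect) : Prop :=
  [/\ measurable Om, mu Om < +oo, U `<=` zygmund_rects,
      forall I, U I -> rect_set I `<=` Om
    & forall I J, U I -> U J -> rect_set I `<=` rect_set J -> I = J].

Definition embed_weight (w : nat -> nat -> R) (I : zrect) (Om : set zspace) : R :=
  w (embed1 I Om) (embed2 I Om).

Definition weighted_height (Om : set zspace) (U : set zrect) (w : nat -> nat -> R)
    (x : zspace) : \bar R :=
  \esum_(I in U) (embed_weight w I Om * \1_(rect_set I) x)%:E.

Definition shadow (G : set zrect) : set zspace := \bigcup_(I in G) rect_set I.

Definition height (G : set zrect) (x : zspace) : \bar R :=
  \esum_(I in G) (\1_(rect_set I) x)%:E.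

Definition sparse (eta : R) (G : set zrect) : Prop :=
  exists E : zrect -> set zspace,
    [/\ forall I, G I -> [/\ measurable (E I), E I `<=` rect_set I
                           & eta%:E * mu (rect_set I) <= mu (E I)]
      & trivIset G E].

End zygmund.

(* Main.v *)
Require Import Defs.
From mathcomp Require Import all_boot all_order all_algebra.
From mathcomp Require Import ring lra zify.

Set Implicit Arguments.
Unset Strict Implicit.
Unset Printing Implicit Defensive.
Import Order.TTheory GRing.Theory Num.Theory.

Local Open Scope ring_scope.

(** Only finitely many rectangles matter at a time, and these live in the finite
    product of the "signatures" which their sides cut out in each factor. Two
    members through a common point are ordered in opposite ways by their first two
    sides, so the members with larger third side cut a given rectangle in strips
    that are full in the first or in the second direction, and one-parameter
    covering arguments apply. This yields
    - a Carleson embedding: the sum of W_w(I)|I| over a finite subfamily is at most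
      20 ||w||_ft times the measure of its shadow, by a Journe-type argument in which
      the relevant members through a point form blocks, each summing to at most
      one antidiagonal of w, and few blocks on average;
    - exponential integrability of sqrt f, for f the sum of a_I 1_I with (a_I)
      Carleson, by a Cordoba-type greedy selection on each level of the averages;
    - a greedy 1/8-sparse subfamily whose shadow has 5/21 of the whole measure.
    For b small, the first two make the integral of cosh (b sqrt f) - 1 close to
    that of b^2 f / 2, which with the factor 1/160 in kappa_w is at most
    (b^2 / 12) |sh U|; the convexity bound cosh y - 1 >= y^2 / 2 makes the one for
    G0 at least (b^2 / 2) |sh G0|, and G0, taken in a finite subfamily with 7/10
    of the shadow, has |sh U| <= 6 |sh G0|. *)

(** * Laminar families of finite sets *)

(** The obstacle in the Carleson embedding is the shared third factor. By the choice of the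
    expansions, the shadow fills at most half of the rectangle expanded in either direction, so the
    points of a rectangle lifted in the first direction make up at most half of it, and likewise for
    the second. But the first condition reads (x2, x3) and the second (x1, x3): one may hold over
    one half of the third side and the other over the rest, and discarding both could leave nothing.
    So only the points lifted in the second direction are discarded outright, which bounds how far
    the second sides of the members through a point can grow. Points lifted in the first direction
    are kept unless bad or crowded, and the price is a chain of blocks instead of a single block. A
    link of the chain is lifted, so its whole expanded line lies in the shadow; as links are not
    crowded by smaller ones, the lines covered at successive stages halve, and the total length is
    at most the measure of the shadow. *)

Lemma laminar_sum_ge0 (R : realFieldType) (X I : finType) (g : X -> R)
    (P : I -> {set X}) (s : {set I}) :
  (forall i j, i \in s -> j \in s ->
     [|| P i \subset P j, P j \subset P i | [disjoint P i & P j]]) ->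
  (forall i, i \in s ->
     (forall j, j \in s -> P i \subset P j -> P j \subset P i) ->
     0 <= \sum_(x in P i) g x) ->
  0 <= \sum_(x in \bigcup_(i in s) P i) g x.
Proof.
move=> lam Pge0.
(* Maximality is up to equality of sets; taking the image [D] merges the indices that carry the same
   set. *)
pose mx i := [forall j in s, (P i \subset P j) ==> (P j \subset P i)].
pose D := P @: [set i in s | mx i].
have tD : trivIset D.
  apply/trivIsetP => _ _ /imsetP[i + ->] /imsetP[j + ->] ne; rewrite !inE => /andP[si mi] /andP[sj mj].
  have /or3P[ij|ji|//] := lam i j si sj.
    case/eqP: ne; apply/eqP; rewrite eqEsubset ij.
    by have /forall_inP/(_ j sj)/implyP/(_ ij) := mi.
  case/eqP: ne; apply/eqP; rewrite eqEsubset ji andbT.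
  by have /forall_inP/(_ i si)/implyP/(_ ji) := mj.
have -> : \bigcup_(i in s) P i = cover D.
  apply/eqP; rewrite eqEsubset; apply/andP; split; last first.
    apply/bigcupsP => _ /imsetP[i + ->]; rewrite inE => /andP[si _].
    exact: (bigcup_sup i).
  apply/bigcupsP => i si.
  have si' : (i \in s) && (P i \subset P i) by rewrite si subxx.
  case: (@arg_maxnP _ i (fun j => (j \in s) && (P i \subset P j))
    (fun j => #|P j|) si') => k /andP[sk ik] kmax.
  apply: (subset_trans ik); apply: (bigcup_sup (P k)) => //.
  apply/imsetP; exists k => //; rewrite inE sk; apply/forall_inP => j sj.
  apply/implyP => kj.
  have /subset_leqif_cards[_] := kj.
  have := kmax j; rewrite sj (subset_trans ik kj) => /(_ isT) jk.
  rewrite eqn_leq (subset_leq_card kj) /=.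
  by move: jk => /= -> /esym/eqP ->; rewrite subxx.
rewrite big_trivIset //= sumr_ge0 // => _ /imsetP[i + ->]; rewrite inE => /andP[si mi].
apply: Pge0 => // j sj ij.
by have /forall_inP/(_ j sj)/implyP/(_ ij) := mi.
Qed.

(** One-parameter weak type inequality: the maximal sets partition the union, and f has average at
    least 1 on each of them. *)
Lemma laminar_cover (R : realFieldType) (X I : finType) (p f : X -> R)
    (P : I -> {set X}) (s : {set I}) :
  (forall x, 0 <= p x) -> (forall x, 0 <= f x) ->
  (forall i j, i \in s -> j \in s ->
     [|| P i \subset P j, P j \subset P i | [disjoint P i & P j]]) ->
  (forall i, i \in s -> \sum_(x in P i) p x <= \sum_(x in P i) p x * f x) ->
  \sum_(x in \bigcup_(i in s) P i) p x <= \sum_x p x * f x.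
Proof.
move=> p0 f0 lam h.
apply: (@le_trans _ _ (\sum_(x in \bigcup_(i in s) P i) p x * f x)).
  rewrite -subr_ge0 -sumrB; apply: laminar_sum_ge0 => // i si _.
  by rewrite sumrB subr_ge0; exact: h.
rewrite [leRHS](bigID (mem (\bigcup_(i in s) P i))) /= lerDl.
by apply: sumr_ge0 => x _; rewrite mulr_ge0.
Qed.

(** Greedy choice in order of decreasing [t], stated as a fixed point so that the recursion stays
    hidden: [rk] is the position in that order, and [sel] sees the indices kept so far. *)
Lemma greedy_selection (I : finType) (t : I -> int) (sel : {set I} -> I -> bool) :
  exists (g : {set I}) (rk : I -> nat),
    [/\ injective rk, forall i j, (rk j < rk i)%N -> t i <= t j
      & forall i, (i \in g) = sel [set j in g | (rk j < rk i)%N] i].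
Proof.
pose l := sort (fun i j => t j <= t i) (enum I).
have lE i : i \in l by rewrite mem_sort mem_enum.
pose rk i := index i l.
have rkI : injective rk.
  by move=> i j /(congr1 (nth i l)); rewrite !nth_index.
have rkt i j : (rk j < rk i)%N -> t i <= t j.
  move=> ji.
  have tot : total (fun i j => t j <= t i) by move=> u v; exact: le_total.
  have tr : transitive (fun i j => t j <= t i) by move=> u v w /[swap]; exact: le_trans.
  have := sorted_ltn_nth tr i (sort_sorted tot (enum I)).
  move=> /(_ (rk j) (rk i)); rewrite !inE !index_mem !lE => /(_ isT isT ji).
  by rewrite !nth_index.
pose G := fix G n := if n is n'.+1 then
  G n' :|: [set i | (rk i == n') && sel (G n') i] else set0.
have rG k i : i \in G k -> (rk i < k)%N.
  elim: k => [|k IH] /=; first by rewrite inE.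
  by rewrite !inE => /orP[/IH/ltnW //|/andP[/eqP -> _]].
have GE k i : (rk i < k)%N -> (i \in G k) = sel (G (rk i)) i.
  elim: k => // k IH; rewrite ltnS leq_eqVlt => /orP[/eqP e|lt] /=.
    rewrite !inE -e eqxx /=; case: (boolP (i \in G (rk i))) => // /rG.
    by rewrite ltnn.
  by rewrite !inE IH // ltn_eqF // orbF.
have rkl i : (rk i < size l)%N by rewrite index_mem.
exists (G (size l)), rk; split=> // i.
rewrite GE //; congr sel; apply/setP => j; rewrite !inE.
case: (ltnP (rk j) (rk i)) => [ji|ij]; first by rewrite andbT !GE.
by rewrite andbF; apply/negbTE/negP => /rG; rewrite ltnNge ij.
Qed.

(** * Weighted products of three finite sets *)

Section rectangles.
Context (R : realFieldType) (X1 X2 X3 I : finType).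
Context (p1 : X1 -> R) (p2 : X2 -> R) (p3 : X3 -> R).
Context (p1_ge0 : forall x, 0 <= p1 x) (p2_ge0 : forall x, 0 <= p2 x)
  (p3_ge0 : forall x, 0 <= p3 x).
Context (A : I -> {set X1}) (B : I -> {set X2}) (T : I -> {set X3}).
Local Notation X := (X1 * X2 * X3)%type.

Definition product_mass (x : X) : R := p1 x.1.1 * p2 x.1.2 * p3 x.2.

Definition product_rect (i : I) : {set X} :=
  [set x | [&& x.1.1 \in A i, x.1.2 \in B i & x.2 \in T i]].

Definition volume (S : {set X}) : R := \sum_(x in S) product_mass x.

Definition rect_union (s : {set I}) : {set X} := \bigcup_(i in s) product_rect i.

Definition overlap (s : {set I}) (x : X) : nat := #|[set i in s | x \in product_rect i]|.

Lemma mass_ge0 x : 0 <= product_mass x.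
Proof. by rewrite !mulr_ge0. Qed.

Lemma volume_ge0 S : 0 <= volume S.
Proof. by apply: sumr_ge0 => x _; exact: mass_ge0. Qed.

Lemma sum_triple (F : X -> R) :
  \sum_x F x = \sum_x1 \sum_x2 \sum_x3 F (x1, x2, x3).
Proof.
rewrite pair_big pair_big /=; apply: eq_bigr => -[[x1 x2] x3] _ //=.
Qed.

Lemma sum_triple1 (F : X -> R) :
  \sum_x F x = \sum_x2 \sum_x3 \sum_x1 F (x1, x2, x3).
Proof.
rewrite sum_triple exchange_big; apply: eq_bigr => x2 _.
by rewrite exchange_big.
Qed.

Lemma sum_triple2 (F : X -> R) :
  \sum_x F x = \sum_x1 \sum_x3 \sum_x2 F (x1, x2, x3).
Proof. by rewrite sum_triple; apply: eq_bigr => x1 _; rewrite exchange_big. Qed.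

Lemma volumeE S : volume S = \sum_x product_mass x * (x \in S)%:R.
Proof.
rewrite /volume big_mkcond; apply: eq_bigr => x _.
by case: ifP; rewrite ?mulr1 ?mulr0.
Qed.

Lemma volumeS (S S' : {set X}) : S \subset S' -> volume S <= volume S'.
Proof.
move=> SS'; rewrite /volume [leRHS](big_setID S) /= (setIidPr SS') lerDl.
exact: volume_ge0.
Qed.

Lemma volumeU_le S S' : volume (S :|: S') <= volume S + volume S'.
Proof.
rewrite !volumeE -big_split /= ler_sum // => x _.
rewrite -mulrDr ler_wpM2l ?mass_ge0 // inE.
by case: (_ \in S); case: (_ \in S'); rewrite //= ?lerDl ?addr0 ?add0r.
Qed.

Lemma volume_union_le s : volume (rect_union s) <= \sum_(i in s) volume (product_rect i).
Proof.
rewrite /rect_union; elim/big_rec2: _ => [|i r S si le].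
  by rewrite /volume big_set0.
by apply: (le_trans (volumeU_le _ _)); rewrite lerD2l.
Qed.

Lemma sum_rect i (u : X1 -> R) (v : X2 -> R) :
  \sum_(x in product_rect i) product_mass x * (u x.1.1 * v x.1.2) =
  (\sum_(x in A i) p1 x * u x) * (\sum_(x in B i) p2 x * v x) *
  (\sum_(x in T i) p3 x).
Proof.
rewrite [LHS]big_mkcond sum_triple.
rewrite [\sum_(x in A i) _]big_mkcond [\sum_(x in B i) _]big_mkcond.
rewrite [\sum_(x in T i) _]big_mkcond -mulrA mulr_suml /=.
apply: eq_bigr => x1 _; rewrite mulr_suml mulr_sumr /=.
apply: eq_bigr => x2 _; rewrite mulrA mulr_sumr /=.
apply: eq_bigr => x3 _; rewrite /product_mass inE /=.
case: (x1 \in A i); rewrite ?mul0r //=; case: (x2 \in B i); rewrite ?mul0r ?mulr0 ?mul0r //=.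
by case: (x3 \in T i); rewrite ?mulr0 //; ring.
Qed.

Lemma volume_rect i : volume (product_rect i) =
  (\sum_(x in A i) p1 x) * (\sum_(x in B i) p2 x) * (\sum_(x in T i) p3 x).
Proof.
rewrite /volume; have := sum_rect i (fun=> 1) (fun=> 1).
under eq_bigr do rewrite !mulr1.
by under [\sum_(x in A i) _]eq_bigr do rewrite mulr1; under [\sum_(x in B i) _]eq_bigr do rewrite mulr1.
Qed.

Lemma overlap_eq0 s x : (overlap s x == 0%N) = (x \notin rect_union s).
Proof.
rewrite cards_eq0; apply/eqP/idP => [s0|].
  apply/negP => /bigcupP[i si xi]; have : i \in set0 by rewrite -s0 inE si.
  by rewrite inE.
move=> xs; apply/setP => i; rewrite !inE; apply/negbTE/negP => /andP[si xi].
by case/negP: xs; apply/bigcupP; exists i => //; rewrite inE.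
Qed.

Lemma overlapS (s s' : {set I}) x : s \subset s' -> (overlap s x <= overlap s' x)%N.
Proof.
move=> /subsetP ss'; apply: subset_leq_card; apply/subsetP => i; rewrite !inE.
by move=> /andP[/ss' -> ->].
Qed.

Lemma overlapU1 (s : {set I}) i x : i \notin s ->
  overlap (i |: s) x = ((x \in product_rect i) + overlap s x)%N.
Proof.
move=> si; rewrite /overlap; case: (boolP (x \in product_rect i)) => xi.
  rewrite (_ : [set _ in _ | _] = i |: [set j in s | x \in product_rect j]).
    by rewrite cardsU1 inE (negbTE si).
  apply/setP => j; rewrite !inE andb_orl; congr orb.
  case: eqP => [->|] //=; move: xi; by rewrite inE.
congr #|pred_of_set _|; apply/setP => j; rewrite !inE andb_orl.
case: eqP => [->|] //=; move: xi; rewrite inE => /negbTE ->.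
by rewrite andbF.
Qed.

Lemma sum_overlap s (f : X -> R) :
  \sum_x product_mass x * (overlap s x)%:R * f x =
  \sum_(i in s) \sum_(x in product_rect i) product_mass x * f x.
Proof.
transitivity (\sum_x \sum_(i in s) (if x \in product_rect i then product_mass x * f x else 0)).
  apply: eq_bigr => x _; rewrite -big_mkcondr /= sumr_const /overlap.
  rewrite -mulrA [_%:R * _]mulr_natl mulrnAr; congr (_ *+ _).
  by apply: eq_card => i; rewrite inE unfold_in.
rewrite exchange_big; apply: eq_bigr => i _.
by rewrite [RHS]big_mkcond.
Qed.

Section covers.
Context (f : X -> R) (f_ge0 : forall x, 0 <= f x) (s : {set I}).

(** Fubini: every slice of the union in the first direction is a union of sets [A i], to which
    [laminar_cover] applies. *)
Lemma line_cover1 :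
  (forall i j, i \in s -> j \in s ->
     [|| A i \subset A j, A j \subset A i | [disjoint A i & A j]]) ->
  (forall i x2 x3, i \in s -> x2 \in B i -> x3 \in T i ->
     \sum_(x in A i) p1 x <= \sum_(x in A i) p1 x * f (x, x2, x3)) ->
  volume (rect_union s) <= \sum_x product_mass x * f x.
Proof.
move=> lam h; rewrite volumeE !sum_triple1.
apply: ler_sum => x2 _; apply: ler_sum => x3 _.
have c : 0 <= p2 x2 * p3 x3 by rewrite mulr_ge0.
pose s' := [set i in s | (x2 \in B i) && (x3 \in T i)].
have := @laminar_cover _ X1 I p1 (fun x => f (x, x2, x3)) A s' p1_ge0
  (fun x => f_ge0 _).
have lam' i j : i \in s' -> j \in s' ->
    [|| A i \subset A j, A j \subset A i | [disjoint A i & A j]].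
  by rewrite !inE => /andP[? _] /andP[? _]; exact: lam.
move=> /(_ lam'); have h' i : i \in s' ->
    \sum_(x in A i) p1 x <= \sum_(x in A i) p1 x * f (x, x2, x3).
  by rewrite inE => /and3P[]; exact: h.
move=> /(_ h') /(ler_wpM2l c).
rewrite !big_distrr /= big_mkcond /= => le; apply: (le_trans _ (le_trans le _)).
  apply: ler_sum => x1 _.
  rewrite (_ : (_ \in rect_union s) = (x1 \in \bigcup_(i in s') A i)).
    by case: ifP => _; rewrite ?mulr0 // mulr1 /product_mass /=; rewrite le_eqVlt; apply/orP; left; apply/eqP; ring.
  apply/bigcupP/bigcupP => -[i]; rewrite !inE /=.
    by move=> si /and3P[xA xB xT]; exists i; rewrite ?inE ?si ?xA ?xB ?xT.
  by move=> /and3P[si xY xT] xZ; exists i => //; rewrite inE /= xY xT xZ.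
by apply: ler_sum => x1 _; rewrite /product_mass /=; rewrite le_eqVlt; apply/orP; left; apply/eqP; ring.
Qed.

Lemma line_cover2 :
  (forall i j, i \in s -> j \in s ->
     [|| B i \subset B j, B j \subset B i | [disjoint B i & B j]]) ->
  (forall i x1 x3, i \in s -> x1 \in A i -> x3 \in T i ->
     \sum_(x in B i) p2 x <= \sum_(x in B i) p2 x * f (x1, x, x3)) ->
  volume (rect_union s) <= \sum_x product_mass x * f x.
Proof.
move=> lam h; rewrite volumeE !sum_triple2.
apply: ler_sum => x1 _; apply: ler_sum => x3 _.
have c : 0 <= p1 x1 * p3 x3 by rewrite mulr_ge0.
pose s' := [set i in s | (x1 \in A i) && (x3 \in T i)].
have := @laminar_cover _ X2 I p2 (fun x => f (x1, x, x3)) B s' p2_ge0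
  (fun x => f_ge0 _).
have lam' i j : i \in s' -> j \in s' ->
    [|| B i \subset B j, B j \subset B i | [disjoint B i & B j]].
  by rewrite !inE => /andP[? _] /andP[? _]; exact: lam.
move=> /(_ lam'); have h' i : i \in s' ->
    \sum_(x in B i) p2 x <= \sum_(x in B i) p2 x * f (x1, x, x3).
  by rewrite inE => /and3P[]; exact: h.
move=> /(_ h') /(ler_wpM2l c).
rewrite !big_distrr /= big_mkcond /= => le; apply: (le_trans _ (le_trans le _)).
  apply: ler_sum => x2 _.
  rewrite (_ : (_ \in rect_union s) = (x2 \in \bigcup_(i in s') B i)).
    by case: ifP => _; rewrite ?mulr0 // mulr1 /product_mass /=; rewrite le_eqVlt; apply/orP; left; apply/eqP; ring.
  apply/bigcupP/bigcupP => -[i]; rewrite !inE /=.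
    by move=> si /and3P[xA xB xT]; exists i; rewrite ?inE ?si ?xA ?xB ?xT.
  by move=> /and3P[si xY xT] xZ; exists i => //; rewrite inE /= xY xT xZ.
by apply: ler_sum => x2 _; rewrite /product_mass /=; rewrite le_eqVlt; apply/orP; left; apply/eqP; ring.
Qed.

End covers.
End rectangles.

(** * Greedy selections *)

Section selection.
Context (R : realFieldType) (X1 X2 X3 I : finType).
Context (p1 : X1 -> R) (p2 : X2 -> R) (p3 : X3 -> R).
Context (p1_ge0 : forall x, 0 <= p1 x) (p2_ge0 : forall x, 0 <= p2 x)
  (p3_ge0 : forall x, 0 <= p3 x).
Context (A : I -> {set X1}) (B : I -> {set X2}) (T : I -> {set X3}).
Context (m n : I -> int).
Context (lamA : forall i j, m i <= m j ->
  (A i \subset A j) || [disjoint A i & A j]).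
Context (lamB : forall i j, n i <= n j ->
  (B i \subset B j) || [disjoint B i & B j]).
Context (lamT : forall i j, m i + n i <= m j + n j ->
  (T i \subset T j) || [disjoint T i & T j]).
Local Notation X := (X1 * X2 * X3)%type.
Local Notation mass := (product_mass p1 p2 p3).
Local Notation vol := (volume p1 p2 p3).
Local Notation rect := (product_rect A B T).
Local Notation union := (rect_union A B T).
Local Notation ht := (overlap A B T).
Context (incomp : forall i j x, i != j -> x \in rect i -> x \in rect j ->
  ~~ ((m i <= m j) && (n i <= n j))).

Lemma laminar_tri (Y : finType) (P : I -> {set Y}) (l : I -> int) :
  (forall i j, l i <= l j -> (P i \subset P j) || [disjoint P i & P j]) ->
  forall i j, [|| P i \subset P j, P j \subset P i | [disjoint P i & P j]].
Proof.
move=> lam i j; case: (leP (l i) (l j)) => [/lam/orP[->|->]|/ltW/lam/orP[->|]] //;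
  rewrite ?orbT // disjoint_sym => ->; by rewrite !orbT.
Qed.

(* By incomparability, a member of larger third side meeting [rect i] cuts it in
   a full strip in one of the first two directions; so the height splits. *)
Lemma overlap_split (g : {set I}) i : i \notin g ->
  (forall j, j \in g -> m i + n i <= m j + n j) ->
  exists (f1 : X1 -> nat) (f2 : X2 -> nat),
    forall x, x \in rect i -> ht g x = (f1 x.1.1 + f2 x.1.2)%N.
Proof.
move=> gi tg.
pose c1 j := [&& n i <= n j, ~~ [disjoint B i & B j] & ~~ [disjoint T i & T j]].
(* The clause [~~ (n i <= n j)] makes the two classes disjoint, so that no member is counted
   twice. *)
pose c2 j := [&& m i <= m j, ~~ [disjoint A i & A j], ~~ [disjoint T i & T j]
               & ~~ (n i <= n j)].
exists (fun x1 => #|[set j in g | c1 j && (x1 \in A j)]|).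
exists (fun x2 => #|[set j in g | c2 j && (x2 \in B j)]|).
move=> x xi; have := xi; rewrite inE => /and3P[xA xB xT].
set S1 := [set j in g | c1 j && _]; set S2 := [set j in g | c2 j && _].
have dS : [disjoint S1 & S2].
  apply/pred0P => j /=; rewrite !inE /c1 /c2; apply/negbTE/negP.
  by move=> /andP[/and3P[_ /and3P[-> _ _]] _] /and3P[_ /and4P[]].
rewrite -cardsUI (_ : S1 :&: S2 = set0) ?cards0 ?addn0; last first.
  by apply/eqP; rewrite setI_eq0.
apply: eq_card => j; rewrite !inE.
case: (boolP (j \in g)) => //= gj.
have ij : i != j by apply: contraNneq gi => ->.
have Ti : (T i \subset T j) || [disjoint T i & T j] by exact/lamT/tg.
have notd (Y : finType) (P Q : {set Y}) y : y \in P -> y \in Q -> ~~ [disjoint P & Q].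
  by move=> yP yQ; apply/pred0Pn; exists y; rewrite /= yP.
apply/idP/idP.
  move=> /and3P[jA jB jT]; rewrite /c1 /c2.
  have xj : x \in rect j by rewrite inE jA jB.
  have := incomp ij xi xj; rewrite negb_and -!ltNge.
  have := incomp (contra_neq esym ij) xj xi.
  rewrite !(notd _ _ _ _ xA jA) !(notd _ _ _ _ xB jB) !(notd _ _ _ _ xT jT) jA jB.
  case: (leP (n i) (n j)) => [//|/ltW ->] /=.
  by rewrite andbT -ltNge => /ltW ->.
move=> /orP[/andP[/and3P[nij Bij Tij] jA]|/andP[/and4P[mij Aij Tij _] jB]].
  have := lamB nij; rewrite (negbTE Bij) orbF => /subsetP/(_ _ xB) ->.
  by move: Ti; rewrite (negbTE Tij) orbF => /subsetP/(_ _ xT) ->; rewrite jA.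
have := lamA mij; rewrite (negbTE Aij) orbF => /subsetP/(_ _ xA) ->.
by move: Ti; rewrite (negbTE Tij) orbF => /subsetP/(_ _ xT) ->; rewrite jB.
Qed.

Lemma sum_ge0 (Y : finType) (S : {set Y}) (p f : Y -> R) :
  (forall y, 0 <= p y) -> (forall y, 0 <= f y) -> 0 <= \sum_(y in S) p y * f y.
Proof. by move=> p0 f0; apply: sumr_ge0 => y _; rewrite mulr_ge0. Qed.

(** As the height splits into f1 + f2, the average of 2 ^ height over the rectangle is the product
    of the averages of 2 ^ f1 and 2 ^ f2; if it exceeds c ^ 2, one of them is at least c. The other
    exponential is at least 1, so the bound holds on every line of that direction. *)
Lemma heavy_strip (g : {set I}) i (c : R) : 0 <= c -> i \notin g ->
  (forall j, j \in g -> m i + n i <= m j + n j) ->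
  c ^+ 2 * vol (rect i) < \sum_(x in rect i) mass x * 2 ^+ ht g x ->
  (forall x2 x3, x2 \in B i -> x3 \in T i ->
    c * \sum_(x in A i) p1 x <= \sum_(x in A i) p1 x * 2 ^+ ht g (x, x2, x3)) \/
  (forall x1 x3, x1 \in A i -> x3 \in T i ->
    c * \sum_(x in B i) p2 x <= \sum_(x in B i) p2 x * 2 ^+ ht g (x1, x, x3)).
Proof.
move=> c0 gi tg; have [f1 [f2 f12]] := overlap_split gi tg.
have -> : \sum_(x in rect i) mass x * 2 ^+ ht g x =
    (\sum_(x in A i) p1 x * 2 ^+ f1 x) * (\sum_(x in B i) p2 x * 2 ^+ f2 x) *
    (\sum_(x in T i) p3 x).
  by rewrite -sum_rect; apply: eq_bigr => x xi; rewrite f12 // exprD.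
rewrite volume_rect // => lt.
case: (lerP (c * \sum_(x in A i) p1 x) (\sum_(x in A i) p1 x * 2 ^+ f1 x)) => leA.
  left => x2 x3 x2B x3T; apply: (le_trans leA); apply: ler_sum => x1 x1A.
  rewrite ler_wpM2l // f12 ?inE /= ?x1A ?x2B ?x3T // exprD ler_peMr ?exprn_ge0 //.
  by rewrite exprn_ege1 // ler1n.
case: (lerP (c * \sum_(x in B i) p2 x) (\sum_(x in B i) p2 x * 2 ^+ f2 x)) => leB.
  right => x1 x3 x1A x3T; apply: (le_trans leB); apply: ler_sum => x2 x2B.
  rewrite ler_wpM2l // f12 ?inE /= ?x1A ?x2B ?x3T // exprD ler_peMl ?exprn_ge0 //.
  by rewrite exprn_ege1 // ler1n.
exfalso; move: lt; rewrite ltNge => /negP; apply.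
rewrite expr2 mulrA ler_wpM2r ?sumr_ge0 //.
rewrite [leRHS](_ : _ = (c * \sum_(x in A i) p1 x) * (c * \sum_(x in B i) p2 x));
  last by ring.
by apply: ler_pM; rewrite ?(ltW leA) ?(ltW leB) //; apply: sum_ge0 => // y;
  rewrite exprn_ge0.
Qed.

(** The same factorisation for 0 ^ height, the indicator of the points that [g] leaves uncovered;
    here the other factor is at most 1. *)
Lemma light_strip (g : {set I}) i (c : R) : i \notin g ->
  (forall j, j \in g -> m i + n i <= m j + n j) ->
  0 <= c ->
  \sum_(x in rect i) mass x * 0 ^+ ht g x < c ^+ 2 * vol (rect i) ->
  (forall x2 x3, x2 \in B i -> x3 \in T i ->
    \sum_(x in A i) p1 x * 0 ^+ ht g (x, x2, x3) <= c * \sum_(x in A i) p1 x) \/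
  (forall x1 x3, x1 \in A i -> x3 \in T i ->
    \sum_(x in B i) p2 x * 0 ^+ ht g (x1, x, x3) <= c * \sum_(x in B i) p2 x).
Proof.
move=> gi tg c0; have [f1 [f2 f12]] := overlap_split gi tg.
have e0 k : 0 <= (0 : R) ^+ k by rewrite exprn_ge0.
have e1 k : (0 : R) ^+ k <= 1 by rewrite exprn_ile1.
have -> : \sum_(x in rect i) mass x * 0 ^+ ht g x =
    (\sum_(x in A i) p1 x * 0 ^+ f1 x) * (\sum_(x in B i) p2 x * 0 ^+ f2 x) *
    (\sum_(x in T i) p3 x).
  by rewrite -sum_rect; apply: eq_bigr => x xi; rewrite f12 // exprD.
rewrite volume_rect // => lt.
case: (lerP (\sum_(x in A i) p1 x * 0 ^+ f1 x) (c * \sum_(x in A i) p1 x)) => leA.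
  left => x2 x3 x2B x3T; apply: (le_trans _ leA); apply: ler_sum => x1 x1A.
  by rewrite ler_wpM2l // f12 ?inE /= ?x1A ?x2B ?x3T // exprD ler_piMr.
case: (lerP (\sum_(x in B i) p2 x * 0 ^+ f2 x) (c * \sum_(x in B i) p2 x)) => leB.
  right => x1 x3 x1A x3T; apply: (le_trans _ leB); apply: ler_sum => x2 x2B.
  by rewrite ler_wpM2l // f12 ?inE /= ?x1A ?x2B ?x3T // exprD ler_piMl.
exfalso; move: lt; rewrite ltNge => /negP; apply.
rewrite expr2 mulrA ler_wpM2r ?sumr_ge0 //.
rewrite [leLHS](_ : _ = (c * \sum_(x in A i) p1 x) * (c * \sum_(x in B i) p2 x));
  last by ring.
by apply: ler_pM; rewrite ?(ltW leA) ?(ltW leB) // mulr_ge0 // sumr_ge0.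
Qed.

(** A member is kept when 2 ^ height of the earlier choices averages at most 4 over it. Adding it
    raises the integral of 2 ^ height by exactly its integral over the member, whence the first
    bound. A rejected member has average above 4 = 2 ^ 2, so by [heavy_strip] all its lines in one
    direction carry an average of 2 ^ height - 1 of at least 1, and the line covers bound each of
    the two rejected classes by four times the selected volume: 9 = 1 + 4 + 4. *)
Lemma exp_selection (s : {set I}) : exists2 g : {set I}, g \subset s &
  \sum_x mass x * (2 ^+ ht g x - 1) <= 4 * \sum_(i in g) vol (rect i) /\
  vol (union s) <= 9 * \sum_(i in g) vol (rect i).
Proof.
have m0 := mass_ge0 p1_ge0 p2_ge0 p3_ge0.
pose sel g i := (i \in s) &&
  (\sum_(x in rect i) mass x * 2 ^+ ht g x <= 4 * vol (rect i)).
have [g [rk [rkI rkt gE]]] := greedy_selection (fun i => m i + n i) sel.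
have gs : g \subset s by apply/subsetP => i; rewrite gE => /andP[].
exists g => //; set S := \sum_(i in g) _.
have first : \sum_x mass x * (2 ^+ ht g x - 1) <= 4 * S.
  pose gk k := [set j in g | (rk j < k)%N].
  have step k : \sum_x mass x * (2 ^+ ht (gk k) x - 1) <=
      4 * \sum_(i in gk k) vol (rect i).
    elim: k => [|k IH].
      rewrite (_ : gk 0%N = set0); last by apply/setP => j; rewrite !inE andbF.
      rewrite big_set0 mulr0 big1 // => x _; rewrite /overlap.
      rewrite (_ : [set _ in _ | _] = set0) ?cards0 ?subrr ?mulr0 //.
      by apply/setP => j; rewrite !inE.
    case: (pickP (fun i => (i \in g) && (rk i == k))) => [i /andP[gi /eqP rki]|none].
      have ik : i \notin gk k by rewrite inE rki ltnn andbF.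
      have -> : gk k.+1 = i |: gk k.
        apply/setP => j; rewrite !inE ltnS leq_eqVlt -rki (inj_eq rkI).
        by case: eqP => [->|] //=; rewrite gi.
      rewrite big_setU1 //= mulrDr addrC.
      have := gE i; rewrite gi rki => /esym/andP[_ sel_i].
      apply: le_trans (lerD IH sel_i).
      rewrite [\sum_(x in rect i) _]big_mkcond -big_split /=.
      apply: ler_sum => x _; rewrite overlapU1 //.
      case: (x \in rect i); rewrite ?add0n ?addr0 //= add1n exprS.
      by rewrite le_eqVlt; apply/orP; left; apply/eqP; ring.
    rewrite (_ : gk k.+1 = gk k) //; apply/setP => j; rewrite !inE ltnS leq_eqVlt.
    by have := none j; case: (j \in g) => //= ->.
  have := step (\max_i (rk i)).+1; rewrite (_ : gk _ = g) //.
  by apply/setP => j; rewrite inE ltnS leq_bigmax andbT.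
split=> //.
pose sA := [set i in s | [forall x2 in B i, forall x3 in T i,
  2 * \sum_(x in A i) p1 x <= \sum_(x in A i) p1 x * 2 ^+ ht g (x, x2, x3)]].
pose sB := [set i in s | [forall x1 in A i, forall x3 in T i,
  2 * \sum_(x in B i) p2 x <= \sum_(x in B i) p2 x * 2 ^+ ht g (x1, x, x3)]].
have cov : union s \subset union g :|: (union sA :|: union sB).
  apply/bigcupsP => i si; case: (boolP (i \in g)) => gi.
    by apply: subsetU; rewrite (bigcup_sup i).
  pose pg := [set j in g | (rk j < rk i)%N].
  have pgi : i \notin pg by rewrite inE ltnn andbF.
  have tg j : j \in pg -> m i + n i <= m j + n j by rewrite inE => /andP[_ /rkt].
  have hpg x : (ht pg x <= ht g x)%N.
    by apply: overlapS; apply/subsetP => j; rewrite inE => /andP[].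
  have epg x : 2 ^+ ht pg x <= 2 ^+ ht g x :> R by rewrite ler_weXn2l ?ler1n.
  have := gE i; rewrite (negbTE gi) /sel si /= => /esym/negbT; rewrite -ltNge => lt.
  have lt' : 2 ^+ 2 * vol (rect i) < \sum_(x in rect i) mass x * 2 ^+ ht pg x.
    by apply: le_lt_trans lt; rewrite -natrX.
  apply/subsetU; apply/orP; right.
  case: (heavy_strip (ler0n _ 2) pgi tg lt') => h.
    apply/subsetU; rewrite (bigcup_sup i) // inE si /=; apply/forall_inP => x2 x2B.
    apply/forall_inP => x3 x3T; apply: (le_trans (h _ _ x2B x3T)).
    by apply: ler_sum => x _; rewrite ler_wpM2l.
  apply/subsetU; rewrite [X in _ || X](bigcup_sup i) ?orbT // inE si /=.
  apply/forall_inP => x1 x1A.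
  apply/forall_inP => x3 x3T; apply: (le_trans (h _ _ x1A x3T)).
  by apply: ler_sum => x _; rewrite ler_wpM2l.
have f0 x : 0 <= (2 : R) ^+ ht g x - 1 by rewrite subr_ge0 exprn_ege1 // ler1n.
have vA : vol (union sA) <= 4 * S.
  apply: le_trans first; apply: line_cover1 => //.
    by move=> i j _ _; exact: (laminar_tri lamA).
  move=> i x2 x3; rewrite inE => /andP[_ /forall_inP h] x2B x3T.
  have /forall_inP/(_ _ x3T) := h _ x2B.
  under [X in _ -> _ <= X]eq_bigr do rewrite mulrBr mulr1.
  by rewrite sumrB; lra.
have vB : vol (union sB) <= 4 * S.
  apply: le_trans first; apply: line_cover2 => //.
    by move=> i j _ _; exact: (laminar_tri lamB).
  move=> i x1 x3; rewrite inE => /andP[_ /forall_inP h] x1A x3T.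
  have /forall_inP/(_ _ x3T) := h _ x1A.
  under [X in _ -> _ <= X]eq_bigr do rewrite mulrBr mulr1.
  by rewrite sumrB; lra.
have vg : vol (union g) <= S by exact: volume_union_le.
have := volumeS p1_ge0 p2_ge0 p3_ge0 cov.
have := volumeU_le p1_ge0 p2_ge0 p3_ge0 (union g) (union sA :|: union sB).
have := volumeU_le p1_ge0 p2_ge0 p3_ge0 (union sA) (union sB).
lra.
Qed.

(** A member is kept when at least an eighth of it is not covered by the earlier choices; this part
    becomes its [E i]. A rejected member has uncovered share below 1/8 < (3/8) ^ 2, so all its lines
    in one direction are covered to at least 5/8. Each direction thus costs 8/5 of the covered
    volume, and 1 + 8/5 + 8/5 = 21/5. *)
Lemma sparse_selection : exists (g : {set I}) (E : I -> {set X}),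
  [/\ forall i, i \in g -> E i \subset rect i /\ vol (rect i) <= 8 * vol (E i),
      forall i j, i \in g -> j \in g -> i != j -> [disjoint E i & E j]
    & 5 * vol (union setT) <= 21 * vol (union g)].
Proof.
have m0 := mass_ge0 p1_ge0 p2_ge0 p3_ge0.
pose sel g i := vol (rect i) <= 8 * \sum_(x in rect i) mass x * 0 ^+ ht g x.
have [g [rk [rkI rkt gE]]] := greedy_selection (fun i => m i + n i) sel.
pose pg i := [set j in g | (rk j < rk i)%N].
have pow0 g' x : 0 ^+ ht g' x = (x \notin union g')%:R :> R.
  by rewrite expr0n overlap_eq0.
exists g, (fun i => rect i :\: union (pg i)); split.
- move=> i gi; split; first exact: subsetDl.
  suff -> : vol (rect i :\: union (pg i)) = \sum_(x in rect i) mass x * 0 ^+ ht (pg i) x.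
    by have := gE i; rewrite gi => /esym.
  rewrite /volume big_mkcond [RHS]big_mkcond; apply: eq_bigr => x _.
  rewrite pow0 in_setD andbC.
  by case: (x \in rect i) => //=; case: (x \in union _) => /=; rewrite ?mulr1 ?mulr0.
- suff dis i j : i \in g -> (rk i < rk j)%N ->
      [disjoint rect i :\: union (pg i) & rect j :\: union (pg j)].
    move=> i j gi gj ij; case: (ltngtP (rk i) (rk j)) => [|ji|/rkI e].
    + exact: dis.
    + by rewrite disjoint_sym; exact: dis.
    + by rewrite e eqxx in ij.
  move=> gi ij; apply/pred0P => x; rewrite /= !inE.
  apply/negbTE/negP => /andP[/andP[_ xi] /andP[/negP xj _]]; apply: xj.
  by apply/bigcupP; exists i; rewrite inE ?gi.
pose c : R := 3 / 8.
pose sA := [set i | [forall x2 in B i, forall x3 in T i,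
  \sum_(x in A i) p1 x * 0 ^+ ht g (x, x2, x3) <= c * \sum_(x in A i) p1 x]].
pose sB := [set i | [forall x1 in A i, forall x3 in T i,
  \sum_(x in B i) p2 x * 0 ^+ ht g (x1, x, x3) <= c * \sum_(x in B i) p2 x]].
have cov : union setT \subset union g :|: (union sA :|: union sB).
  apply/bigcupsP => i _; case: (boolP (i \in g)) => gi.
    by apply: subsetU; rewrite (bigcup_sup i).
  have pgi : i \notin pg i by rewrite inE ltnn andbF.
  have tg j : j \in pg i -> m i + n i <= m j + n j by rewrite inE => /andP[_ /rkt].
  have epg x : 0 ^+ ht g x <= 0 ^+ ht (pg i) x :> R.
    rewrite !pow0 ler_nat; case: (boolP (x \in union (pg i))) => [/bigcupP[j]|]; last first.
      by case: (x \in union g).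
    rewrite inE => /andP[gj _] xj; rewrite (_ : x \in union g) //.
    by apply/bigcupP; exists j.
  have := gE i; rewrite (negbTE gi) /sel => /esym/negbT; rewrite -ltNge => lt.
  have lt' : \sum_(x in rect i) mass x * 0 ^+ ht (pg i) x < c ^+ 2 * vol (rect i).
    by have := volume_ge0 p1_ge0 p2_ge0 p3_ge0 (rect i); rewrite /c; lra.
  apply/subsetU; apply/orP; right.
  have c0 : 0 <= c by rewrite /c; lra.
  case: (light_strip pgi tg c0 lt') => h.
    apply/subsetU; rewrite (bigcup_sup i) // inE /=; apply/forall_inP => x2 x2B.
    apply/forall_inP => x3 x3T; apply: (le_trans _ (h _ _ x2B x3T)).
    by apply: ler_sum => x _; rewrite ler_wpM2l.
  apply/subsetU; rewrite [X in _ || X](bigcup_sup i) ?orbT // inE /=.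
  apply/forall_inP => x1 x1A.
  apply/forall_inP => x3 x3T; apply: (le_trans _ (h _ _ x1A x3T)).
  by apply: ler_sum => x _; rewrite ler_wpM2l.
pose f x : R := 8 / 5 * (1 - 0 ^+ ht g x).
have f0 x : 0 <= f x.
  by rewrite /f pow0; case: (_ \notin _); rewrite /= ?subrr ?mulr0 // subr0; lra.
have vf : \sum_x mass x * f x = 8 / 5 * vol (union g).
  rewrite volumeE mulr_sumr; apply: eq_bigr => x _; rewrite /f pow0.
  by case: (x \in union g) => /=; ring.
have vA : vol (union sA) <= 8 / 5 * vol (union g).
  rewrite -vf; apply: line_cover1 => //.
    by move=> i j _ _; exact: (laminar_tri lamA).
  move=> i x2 x3; rewrite inE => /forall_inP h x2B x3T.
  have /forall_inP/(_ _ x3T) := h _ x2B.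
  under [X in _ -> _ <= X]eq_bigr do rewrite /f mulrCA mulrBr mulr1.
  by rewrite -mulr_sumr sumrB /c; lra.
have vB : vol (union sB) <= 8 / 5 * vol (union g).
  rewrite -vf; apply: line_cover2 => //.
    by move=> i j _ _; exact: (laminar_tri lamB).
  move=> i x1 x3; rewrite inE => /forall_inP h x1A x3T.
  have /forall_inP/(_ _ x3T) := h _ x1A.
  under [X in _ -> _ <= X]eq_bigr do rewrite /f mulrCA mulrBr mulr1.
  by rewrite -mulr_sumr sumrB /c; lra.
have := volumeS p1_ge0 p2_ge0 p3_ge0 cov.
have := volumeU_le p1_ge0 p2_ge0 p3_ge0 (union g) (union sA :|: union sB).
have := volumeU_le p1_ge0 p2_ge0 p3_ge0 (union sA) (union sB).
lra.
Qed.

End selection.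

(** * The Carleson embedding of Journe type *)

Section chains.
Context (R : realFieldType) (X I : finType) (p : X -> R) (A Q : I -> {set X}).
Context (p_ge0 : forall x, 0 <= p x) (AQ : forall i, A i \subset Q i).
Context (lamQ : forall i j,
  [|| Q i \subset Q j, Q j \subset Q i | [disjoint Q i & Q j]]).

Definition uncrowded (s : {set I}) (i : I) :=
  2 * \sum_(x in Q i | [exists j in s, (Q j \subset Q i) && (x \in A j)]) p x
    <= \sum_(x in Q i) p x.

(** Only the maximal [Q i] matter. By laminarity, a point of such a set that lies in some [A j] has
    [Q j] inside [Q i], so [uncrowded s i] counts it. *)
Lemma uncrowded_union (s : {set I}) : (forall i, i \in s -> uncrowded s i) ->
  2 * \sum_(x in \bigcup_(i in s) A i) p x <= \sum_(x in \bigcup_(i in s) Q i) p x.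
Proof.
move=> un.
have subQ : \bigcup_(i in s) A i \subset \bigcup_(i in s) Q i.
  apply/bigcupsP => i si; apply: (subset_trans (AQ i)); exact: (bigcup_sup i).
pose g x := p x - 2 * (if x \in \bigcup_(i in s) A i then p x else 0).
have eg (P : {set X}) : \sum_(x in P) g x = \sum_(x in P) p x
    - 2 * \sum_(x in P | x \in \bigcup_(i in s) A i) p x.
  by rewrite sumrB -mulr_sumr -big_mkcondr.
have : 0 <= \sum_(x in \bigcup_(i in s) Q i) g x.
  apply: laminar_sum_ge0 => [i j _ _|i si mx]; first exact: lamQ.
  rewrite eg subr_ge0; apply: le_trans (un i si).
  rewrite ler_wpM2l //.
  rewrite [leLHS]big_mkcond [leRHS]big_mkcond; apply: ler_sum => x _.
  case: (boolP (x \in Q i)) => //= xi; case: ifP => [/bigcupP[j sj xj]|_]; last first.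
    by case: ifP.
  suff -> : [exists k in s, (Q k \subset Q i) && (x \in A k)] by [].
  apply/exists_inP; exists j => //; rewrite xj andbT.
  have xQj := subsetP (AQ j) _ xj.
  have /or3P[//|ij|/pred0P/(_ x)] := lamQ j i; first exact: mx.
  by rewrite /= xQj xi.
rewrite eg subr_ge0; congr (_ * _ <= _).
apply: eq_bigl => x; case: (boolP (x \in \bigcup_(i in s) A i)) => [xA|]; last by rewrite andbF.
by rewrite (subsetP subQ _ xA).
Qed.

Definition init (c : seq I) := if c is i :: c' then belast i c' else [::].

(** Remove the last link of every chain. The last links cost at most the measure of the union of the
    [A i], half that of the union of the [Q i]. Every other link has its [Q i] inside some [A j], so
    by induction these cost at most the union of their [Q i], which again lies in the union of the
    [A i]. [N] serves only to run the induction on the length. *)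
Lemma sum_chain (s : {set I}) (ch : X -> seq I) N :
  (forall i, i \in s -> uncrowded s i) ->
  (forall x, size (ch x) <= N)%N ->
  (forall x, {subset ch x <= s}) ->
  (forall x i, i \in ch x -> x \in A i) ->
  (forall x, sorted (fun i j => Q i \subset A j) (ch x)) ->
  \sum_x p x * (size (ch x))%:R <= \sum_(x in \bigcup_(i in s) Q i) p x.
Proof.
elim: N s ch => [|N IH] s ch un szN sub mem srt.
  rewrite big1 ?sumr_ge0 // => x _.
  by have := szN x; rewrite leqn0 => /eqP ->; rewrite mulr0.
pose s' := [set i in s | [exists j in s, Q i \subset A j]].
have s's : s' \subset s by apply/subsetP => i; rewrite inE => /andP[].
have init_sub (c : seq I) : {subset init c <= c}.
  by case: c => //= i c j; exact: mem_belast.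
have init_succ (c : seq I) e : sorted e c ->
    forall i, i \in init c -> exists2 j, j \in c & e i j.
  case: c => //= i c; elim: c i => //= k c IHc i /andP[eik pc] l.
  rewrite inE => /orP[/eqP ->|/(IHc _ pc)[j jc elj]].
    by exists k => //; rewrite !inE eqxx orbT.
  by exists j => //; rewrite inE jc orbT.
have init_srt e (c : seq I) : sorted e c -> sorted e (init c).
  case: c => //= i c; elim: c i => //= k c IHc i /andP[eik /IHc].
  by case: c {IHc} => //= l c ->; rewrite andbT.
have un' i : i \in s' -> uncrowded s' i.
  move=> /(subsetP s's)/un; apply: le_trans; rewrite ler_wpM2l //.
  rewrite [leLHS]big_mkcond [leRHS]big_mkcond; apply: ler_sum => x _.
  case: (x \in Q i) => //=; case: ifP => [/exists_inP[j /(subsetP s's) sj h]|_].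
    by rewrite ifT //; apply/exists_inP; exists j.
  by case: ifP.
have sz c : size (init c) = (size c).-1 by case: c => //= i c; rewrite size_belast.
have -> : \sum_x p x * (size (ch x))%:R = \sum_x p x * (size ((init \o ch) x))%:R
    + \sum_(x | ch x != [::]) p x.
  rewrite [X in _ + X]big_mkcond -big_split; apply: eq_bigr => x _ /=; rewrite sz.
  by case: (ch x) => [|i c] /=; [rewrite addr0|rewrite -natr1 mulrDr mulr1].
have tail : \sum_(x | ch x != [::]) p x <= \sum_(x in \bigcup_(i in s) A i) p x.
  rewrite big_mkcond [leRHS]big_mkcond; apply: ler_sum => x _.
  have := mem x; have := sub x; case: (ch x) => [|i c] /= subx memx; first by case: ifP.
  rewrite ifT //; apply/bigcupP; exists i; first exact/subx/mem_head.
  exact/memx/mem_head.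
have next : \sum_(x in \bigcup_(i in s') Q i) p x <= \sum_(x in \bigcup_(i in s) A i) p x.
  rewrite big_mkcond [leRHS]big_mkcond; apply: ler_sum => x _.
  case: ifP => [/bigcupP[i]|_]; last by case: ifP.
  rewrite inE => /andP[_ /exists_inP[j sj ij]] xi.
  by rewrite ifT //; apply/bigcupP; exists j => //; exact: (subsetP ij).
have half := uncrowded_union un.
suff : \sum_x p x * (size ((init \o ch) x))%:R <= \sum_(x in \bigcup_(i in s') Q i) p x.
  by lra.
apply: (IH s' (init \o ch) un') => x /=.
- by rewrite sz; have := szN x; lia.
- move=> i ic; have si := sub x _ (init_sub _ _ ic); rewrite inE si /=.
  have [j jc ij] := init_succ _ _ (srt x) _ ic.
  by apply/exists_inP; exists j => //; exact: (sub x).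
- by move=> i /init_sub; exact: mem.
- exact: init_srt.
Qed.

End chains.

Section antichain.
Context (R : realFieldType) (I : finType) (m n : I -> int) (a c : I -> nat).
Context (w : nat -> nat -> R) (W : R).
Context (w_ge0 : forall k l, 0 <= w k l).
Context (w_noninc1 : forall k k' l, (k <= k')%N -> w k' l <= w k l).
Context (w_noninc2 : forall k l l', (l <= l')%N -> w k l' <= w k l).
Context (wW : forall N, \sum_(k < N.+1) w k (N - k)%N <= W).

Lemma card_int_window (s : {set I}) (l : I -> int) (b : int) (k : nat) :
  {in s &, injective l} -> (forall j, j \in s -> b < l j <= b + k%:Z) -> (#|s| <= k)%N.
Proof.
move=> linj lb.
have h : {subset [seq absz (l j - b) | j in s] <= iota 1 k}.
  move=> _ /imageP[j /lb /andP[bl lk] ->]; rewrite mem_iota.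
  by move: bl lk; clear; lia.
rewrite -(size_iota 1 k) -(size_image (fun j => absz (l j - b)) (mem s)).
apply: uniq_leq_size h; rewrite map_inj_in_uniq ?enum_uniq // => i j.
rewrite !mem_enum => si sj; have := lb i si; have := lb j sj; move=> bj bi e.
by apply: linj => //; move: bi bj e; clear; lia.
Qed.

(* With [up i] and [dn i] the numbers of members above and below i, the pairs
   (up i, dn i) run over an antidiagonal, and up i <= a i, dn i <= c i. *)
Lemma sum_block (s : {set I}) :
  (forall i j, i \in s -> j \in s -> i != j -> m i <= m j -> n j < n i) ->
  (forall i j, i \in s -> j \in s -> m j <= m i + (a i)%:Z) ->
  (forall i j, i \in s -> j \in s -> n j <= n i + (c i)%:Z) ->
  \sum_(i in s) w (a i) (c i) <= W.
Proof.
move=> anti ha hc.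
have minj : {in s &, injective m}.
  move=> i j si sj e; case: (eqVneq i j) => // ij.
  have := anti i j si sj ij; rewrite e lexx => /(_ isT) ji.
  have := anti j i sj si (contra_neq esym ij); rewrite e lexx => /(_ isT) ij'.
  by have := lt_trans ji ij'; rewrite ltxx.
have ninj : {in s &, injective n}.
  move=> i j si sj e; case: (eqVneq i j) => // ij.
  case: (leP (m i) (m j)) => [/(anti i j si sj ij)|/ltW/(anti j i sj si (contra_neq esym ij))];
    by rewrite e ltxx.
have [->|/set0Pn[i0 si0]] := eqVneq s set0.
  rewrite big_set0; apply: le_trans (wW 0); exact: sumr_ge0.
pose up i := #|[set j in s | m i < m j]|.
pose dn i := #|[set j in s | m j < m i]|.
have updn i : i \in s -> (up i + dn i = #|s|.-1)%N.
  move=> si; rewrite (cardsD1 i s) si /= /up /dn -cardsUI.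
  rewrite [X in (_ + X)%N]eq_card0 ?addn0; last first.
    by move=> j; rewrite !inE; case: (ltgtP (m i) (m j)); rewrite ?andbF.
  apply: eq_card => j; rewrite !inE.
  case: (boolP (j \in s)) => sj; rewrite ?andbF //= andbT.
  by rewrite -neq_lt (inj_in_eq minj) // eq_sym.
have aup i : i \in s -> (up i <= a i)%N.
  move=> si; apply: (@card_int_window _ m (m i)).
    by move=> j k; rewrite !inE => /andP[sj _] /andP[sk _]; exact: minj.
  by move=> j; rewrite inE => /andP[sj ->]; exact: ha.
have cdn i : i \in s -> (dn i <= c i)%N.
  move=> si; apply: (@card_int_window _ n (n i)).
    by move=> j k; rewrite !inE => /andP[sj _] /andP[sk _]; exact: ninj.
  move=> j; rewrite inE => /andP[sj ji]; rewrite hc // andbT.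
  by apply: anti (ltW ji) => //; apply: contraTneq ji => ->; rewrite ltxx.
pose N := #|s|.-1.
have upN i : i \in s -> (up i < N.+1)%N by move=> /updn e; rewrite ltnS /N -e leq_addr.
apply: (le_trans _ (wW N)).
apply: (@le_trans _ _ (\sum_(i in s) w (up i) (N - up i)%N)).
  apply: ler_sum => i si; rewrite -[N](updn i si) addKn.
  exact: le_trans (w_noninc1 _ (aup _ si)) (w_noninc2 _ (cdn _ si)).
pose f i : 'I_N.+1 := inord (up i).
have fE i : i \in s -> f i = up i :> nat by move=> si; rewrite inordK ?upN.
rewrite (eq_bigr (fun i => w (f i) (N - f i)%N)); last by move=> i /fE ->.
have finj : {in s &, injective f}.
  move=> i j si sj /(congr1 val) /=; rewrite !fE // => e; apply: minj => //.
  have key k l : k \in s -> l \in s -> m k < m l -> (up l < up k)%N.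
    move=> sk sl kl; apply: proper_card; apply/properP; split.
      by apply/subsetP => z; rewrite !inE => /andP[-> /(lt_trans kl)].
    by exists l; rewrite !inE sl ?kl // ltxx.
  case: (ltgtP (m i) (m j)) => // /key; [move=> /(_ si sj)|move=> /(_ sj si)];
    by rewrite e ltnn.
rewrite -(big_imset (fun k : 'I_N.+1 => w k (N - k)%N) finj) /=.
by rewrite [leRHS](bigID (mem [set f i | i in s])) /= lerDl sumr_ge0.
Qed.

(* Greedy blocks: the next block starts beyond the smallest m + a of the current
   one, which becomes the next link of the chain [ch]. *)
Lemma sum_antichain (s : {set I}) :
  (forall i j, i \in s -> j \in s -> i != j -> m i <= m j -> n j < n i) ->
  (forall i j, i \in s -> j \in s -> n j <= n i + (c i)%:Z) ->
  exists ch : seq I, [/\ {subset ch <= s},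
    forall i, i \in ch -> exists2 j, j \in s & m i + (a i)%:Z < m j,
    sorted (fun i j => m i + (a i)%:Z < m j) ch, (size ch <= #|s|)%N
    & \sum_(i in s) w (a i) (c i) <= W * (1 + (size ch)%:R)].
Proof.
have [k] := ubnP #|s|; elim: k s => // k IH s; rewrite ltnS => sk anti hc.
have [->|/set0Pn[i1 si1]] := eqVneq s set0.
  exists [::]; split=> //; rewrite big_set0 addr0 mulr1.
  by apply: le_trans (wW 0); exact: sumr_ge0.
pose lvl i := m i + (a i)%:Z.
pose i0 := [arg min_(i < i1 in s) lvl i]%O.
have [si0 mini0] : i0 \in s /\ forall j, j \in s -> lvl i0 <= lvl j.
  by rewrite /i0; case: arg_minP.
pose b := [set i in s | m i <= lvl i0].
have bs : b \subset s by apply/subsetP => i; rewrite inE => /andP[].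
have sumb : \sum_(i in b) w (a i) (c i) <= W.
  apply: sum_block.
  - by move=> i j /(subsetP bs) si /(subsetP bs) sj; exact: anti.
  - move=> i j; rewrite !inE => /andP[si _] /andP[_ jl]; apply: (le_trans jl).
    exact: mini0.
  - by move=> i j /(subsetP bs) si /(subsetP bs) sj; exact: hc.
have i0b : i0 \in b by rewrite inE si0 lerDl.
rewrite (big_setID b) /= (setIidPr bs).
(* The links count the blocks after the first, so a single block needs the empty chain. *)
have [e|/set0Pn[j0 sj0]] := eqVneq (s :\: b) set0.
  by exists [::]; split=> //; rewrite e big_set0 !addr0 mulr1.
have [|||ch [chs act srt sz le]] := IH (s :\: b).
- apply: leq_trans sk; apply: proper_card; apply/properP; split; first exact: subsetDl.
  by exists i0 => //; rewrite inE i0b.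
- by move=> i j /setDP[si _] /setDP[sj _]; exact: anti.
- by move=> i j /setDP[si _] /setDP[sj _]; exact: hc.
have above j : j \in s :\: b -> lvl i0 < m j.
  by rewrite !inE negb_and -ltNge => /andP[/orP[/negbTE -> //|]].
exists (i0 :: ch); split.
- by move=> i; rewrite inE => /orP[/eqP -> //|/chs/setDP[]].
- move=> i; rewrite inE => /orP[/eqP ->|/act[j /setDP[sj _]]]; last by exists j.
  by exists j0; [case/setDP: sj0|exact: above].
- case: ch chs srt {act sz le} => //= j ch chs ->; rewrite andbT.
  exact/above/chs/mem_head.
- rewrite /= (leq_ltn_trans sz) //; apply: proper_card; apply/properP; split.
    exact: subsetDl.
  by exists i0 => //; rewrite inE i0b.
rewrite /= -natr1; lra.
Qed.

End antichain.

Section expansion.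
Context (R : realFieldType) (X1 X2 X3 : finType).
Context (P1 : X1 -> R) (P2 : X2 -> R) (P3 : X3 -> R).
Context (P1_ge0 : forall x, 0 <= P1 x) (P2_ge0 : forall x, 0 <= P2 x)
  (P3_ge0 : forall x, 0 <= P3 x).
Context (st : X2 -> X3 -> bool) (st' : X1 -> X3 -> bool).
Context (good : X2 -> bool) (crowd : X2 -> X3 -> bool).

(** Bookkeeping for [exceptional_volume], with weights restricted to the three sides of one
    rectangle; [st] and [st'] stand for lifted lines in the first and second direction. Two lower
    bounds for the remaining mass are combined: [lb1] keeps only good x2, [lb2] only unlifted (x2,
    x3). *)
Lemma sum_expansion_ge :
  (forall x2, ~~ good x2 ->
     2 * \sum_x3 P3 x3 <= 3 * \sum_x3 P3 x3 * (st x2 x3)%:R) ->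
  \sum_x2 P2 x2 * \sum_x3 P3 x3 * [&& st x2 x3, good x2 & crowd x2 x3]%:R
    + 4 * \sum_x2 P2 x2 * \sum_x3 P3 x3 * (st x2 x3)%:R
    <= 2 * ((\sum_x2 P2 x2) * \sum_x3 P3 x3) ->
  2 * \sum_x3 P3 x3 * \sum_x1 P1 x1 * (st' x1 x3)%:R
    <= (\sum_x1 P1 x1) * \sum_x3 P3 x3 ->
  (\sum_x1 P1 x1) * (\sum_x2 P2 x2) * (\sum_x3 P3 x3) <=
  10 * \sum_x2 P2 x2 * \sum_x3 P3 x3 * \sum_x1 P1 x1 *
    (~~ st' x1 x3 && (st x2 x3 ==> good x2 && ~~ crowd x2 x3))%:R.
Proof.
set alpha := \sum_x1 P1 x1; set beta := \sum_x2 P2 x2; set tau := \sum_x3 P3 x3.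
set cc := \sum_x2 P2 x2 * \sum_x3 P3 x3 * [&& _, _ & _]%:R.
set ss := \sum_x2 P2 x2 * \sum_x3 P3 x3 * (st x2 x3)%:R.
set s' := \sum_x3 P3 x3 * \sum_x1 _; set J := (X in _ -> _ -> _ -> _ <= 10 * X).
move=> bad hcs hs'.
pose r x3 := \sum_x1 P1 x1 * (st' x1 x3)%:R.
pose g := \sum_x2 P2 x2 * (good x2)%:R.
have a0 : 0 <= alpha by apply: sumr_ge0.
have b0 : 0 <= beta by apply: sumr_ge0.
have t0 : 0 <= tau by apply: sumr_ge0.
have g0 : 0 <= g by apply: sumr_ge0 => x _; rewrite mulr_ge0.
have gb : g <= beta.
  by apply: ler_sum => x _; rewrite ler_piMr // lern1 leq_b1.
have r0 x3 : 0 <= r x3 by apply: sumr_ge0 => x _; rewrite mulr_ge0.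
have ra x3 : r x3 <= alpha.
  by apply: ler_sum => x _; rewrite ler_piMr // lern1 leq_b1.
have nr x3 : \sum_x1 P1 x1 * (~~ st' x1 x3)%:R = alpha - r x3.
  rewrite -sumrB; apply: eq_bigr => x _.
  by case: (st' x x3); rewrite ?mulr0 ?mulr1 ?subrr ?subr0.
have lb1 : g * (alpha * tau - s') - alpha * cc <= J.
  rewrite [g * _]mulr_suml [alpha * cc]mulr_sumr -sumrB; apply: ler_sum => x2 _.
  rewrite [leLHS](_ : _ = P2 x2 * ((good x2)%:R * (alpha * tau - s') - alpha *
    \sum_x3 P3 x3 * [&& st x2 x3, good x2 & crowd x2 x3]%:R)); last by ring.
  rewrite ler_wpM2l //.
  rewrite [alpha * tau]mulr_sumr -sumrB !mulr_sumr -sumrB; apply: ler_sum => x3 _.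
  rewrite -/(r x3).
  rewrite [leLHS](_ : _ = P3 x3 * ((good x2)%:R * (alpha - r x3)
     - alpha * [&& st x2 x3, good x2 & crowd x2 x3]%:R)); last by ring.
  rewrite ler_wpM2l // -nr mulr_sumr mulr_suml -sumrB; apply: ler_sum => x1 _.
  case: (st' x1 x3); case: (st x2 x3); case: (good x2); case: (crowd x2 x3);
    by rewrite /= ?mulr0 ?mulr1 ?mul0r ?mul1r ?subr0 ?subrr ?sub0r ?oppr_le0 ?lexx.
(* Over bad x2 at most a third of the mass is unlifted, which caps what [st'] can remove there; over
   good x2 it removes at most [s']. *)
have lb2 : alpha * (beta * tau - ss) - (g * s' + alpha * (beta - g) * (tau / 3)) <= J.
  have low : \sum_x2 P2 x2 * \sum_x3 P3 x3 * ((~~ st x2 x3)%:R * (alpha - r x3)) <= J.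
    apply: ler_sum => x2 _; rewrite ler_wpM2l //; apply: ler_sum => x3 _.
    rewrite ler_wpM2l // -nr mulr_sumr; apply: ler_sum => x1 _.
    case: (st' x1 x3); case: (st x2 x3); case: (good x2); case: (crowd x2 x3);
      by rewrite /= ?mulr0 ?mulr1 ?mul0r ?mul1r ?subr0 ?subrr ?sub0r ?oppr_le0 ?lexx.
  apply: le_trans low.
  rewrite [alpha * (beta - g)]mulrC.
  rewrite (_ : beta - g = \sum_x2 P2 x2 * (~~ good x2)%:R); last first.
    rewrite -sumrB; apply: eq_bigr => x _.
    by case: (good x); rewrite ?mulr0 ?mulr1 ?subrr ?subr0.
  rewrite [beta * tau]mulr_suml -sumrB mulr_sumr [g * s']mulr_suml -mulrA.
  rewrite [_ * (alpha * _)]mulr_suml -big_split -sumrB /=.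
  apply: ler_sum => x2 _.
  rewrite [leLHS](_ : _ = P2 x2 * (alpha * (tau - \sum_x3 P3 x3 * (st x2 x3)%:R)
      - ((good x2)%:R * s' + (~~ good x2)%:R * (alpha * (tau / 3))))); last by ring.
  rewrite ler_wpM2l //.
  have ns : \sum_x3 P3 x3 * (~~ st x2 x3)%:R = tau - \sum_x3 P3 x3 * (st x2 x3)%:R.
    rewrite -sumrB; apply: eq_bigr => x _.
    by case: (st x2 x); rewrite ?mulr0 ?mulr1 ?subrr ?subr0.
  have -> : \sum_x3 P3 x3 * ((~~ st x2 x3)%:R * (alpha - r x3)) =
      alpha * (tau - \sum_x3 P3 x3 * (st x2 x3)%:R)
      - \sum_x3 P3 x3 * ((~~ st x2 x3)%:R * r x3).
    by rewrite -ns mulr_sumr -sumrB; apply: eq_bigr => x _; ring.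
  rewrite lerD2l lerN2.
  case: (boolP (good x2)) => [_|/bad bx2]; rewrite ?mul1r ?mul0r ?addr0 ?add0r.
    apply: ler_sum => x _; rewrite ler_wpM2l // ler_piMl // lern1 leq_b1 //.
  apply: (@le_trans _ _ (alpha * \sum_x3 P3 x3 * (~~ st x2 x3)%:R)).
    rewrite mulr_sumr; apply: ler_sum => x _; rewrite [leRHS]mulrCA ler_wpM2l //.
    by rewrite [leLHS]mulrC ler_wpM2r.
  by rewrite ler_wpM2l // ns; lra.
(* Twice [lb1] plus eight times [lb2]: in units where the three totals are 1, the hypotheses turn
   this into 10 J >= 4/3 - g/3, which is at least 1. *)
have h1 : 0 <= alpha * (2 * (beta * tau) - (cc + 4 * ss)) by rewrite mulr_ge0 // subr_ge0.
have h2 : 0 <= g * (alpha * tau - 2 * s') by rewrite mulr_ge0 // subr_ge0.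
have h3 : 0 <= alpha * (beta - g) * tau by rewrite !mulr_ge0 // subr_ge0.
lra.
Qed.

End expansion.

Section journe.
Context (R : realFieldType) (X1 X2 X3 I : finType).
Context (p1 : X1 -> R) (p2 : X2 -> R) (p3 : X3 -> R).
Context (p1_ge0 : forall x, 0 <= p1 x) (p2_ge0 : forall x, 0 <= p2 x)
  (p3_ge0 : forall x, 0 <= p3 x).
Context (A QA : I -> {set X1}) (B QB : I -> {set X2}) (T : I -> {set X3}).
Context (m n : I -> int) (a c : I -> nat).
Context (lamT : forall i j, m i + n i <= m j + n j ->
  (T i \subset T j) || [disjoint T i & T j]).
Context (AQ : forall i, A i \subset QA i) (BQ : forall i, B i \subset QB i).
Context (lamQ : forall i j,
  [|| QA i \subset QA j, QA j \subset QA i | [disjoint QA i & QA j]]).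
Local Notation X := (X1 * X2 * X3)%type.
Local Notation mass := (product_mass p1 p2 p3).
Local Notation vol := (volume p1 p2 p3).
Local Notation rect := (product_rect A B T).
Local Notation Om := (rect_union A B T setT).
Context (incomp : forall i j x, i != j -> x \in rect i -> x \in rect j ->
  ~~ ((m i <= m j) && (n i <= n j))).
Context (stepA : forall i j x, x \in A i -> x \in A j ->
  m i + (a i)%:Z < m j -> QA i \subset A j).
Context (stepB : forall i j x, x \in B i -> x \in B j ->
  n i + (c i)%:Z < n j -> QB i \subset B j).
Context (sparseA : forall i, 2 * vol (Om :&: product_rect QA B T i) <= vol (product_rect QA B T i)).
Context (sparseB : forall i, 2 * vol (Om :&: product_rect A QB T i) <= vol (product_rect A QB T i)).

(* The line over (x2, x3) is lifted at i when Om contains it over all of QA i.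
   [exceptional i] keeps a tenth of [rect i] (exceptional_volume), while the blocks
   of sum_antichain at x, for the members i with x in [exceptional i], number at
   most 2 on average over the points x of Om (sum_exceptional). *)
Definition lifted1 i x2 x3 :=
  [exists j, [&& QA i \subset A j, x2 \in B j & x3 \in T j]].
Definition lifted2 i x1 x3 :=
  [exists j, [&& QB i \subset B j, x1 \in A j & x3 \in T j]].
(** The threshold 2/3 works on both sides: where it holds, the lifted part of [T i] has at most
    twice the mass of the unlifted part; where it fails, at most a third of [T i] is unlifted. *)
Definition good i x2 :=
  3 * \sum_(x3 in T i) p3 x3 * (lifted1 i x2 x3)%:R <= 2 * \sum_(x3 in T i) p3 x3.
(** Every link of a chain is good, so this union contains all rectangles that can crowd i in the
    sense of [uncrowded]. *)
Definition present i (x : X) :=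
  [exists k, [&& QA k \subset QA i, x \in rect k & good k x.1.2]].
Definition crowded i x2 x3 :=
  \sum_(x in QA i) p1 x < 2 * \sum_(x in QA i) p1 x * (present i (x, x2, x3))%:R.
Definition exceptional i : {set X} := [set x in rect i | ~~ lifted2 i x.1.1 x.2 &&
  (lifted1 i x.1.2 x.2 ==> good i x.1.2 && ~~ crowded i x.1.2 x.2)].

Lemma sum_in (Y : finType) (S : {set Y}) (f : Y -> R) :
  \sum_(y in S) f y = \sum_y f y * (y \in S)%:R.
Proof. by rewrite big_mkcond; apply: eq_bigr => y _; case: ifP; rewrite ?mulr1 ?mulr0. Qed.

(** For fixed (x1, x2) the present x3 in [T i] form a union of laminar sets [T k :&: T i], and at
    most two thirds of each is lifted at i. If [T k] is inside [T i], this is goodness of k, since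
    [QA k] inside [QA i] makes a line lifted at i also lifted at k; if [T i] is inside [T k], it is
    goodness of i. Present points lie in [Om], whence the unlifted part on the right. *)
Lemma present_line i x1 x2 : good i x2 ->
  \sum_(x3 in T i) p3 x3 * ((lifted1 i x2 x3) && present i (x1, x2, x3))%:R
  <= 2 * \sum_(x3 in T i) p3 x3 * (~~ lifted1 i x2 x3 && ((x1, x2, x3) \in Om))%:R.
Proof.
move=> gi; pose s := [set k | [&& QA k \subset QA i, x1 \in A k, x2 \in B k & good k x2]].
pose g x3 := p3 x3 * (2 - 3 * (lifted1 i x2 x3)%:R).
have gge0 (S : {set X3}) : 3 * \sum_(x3 in S) p3 x3 * (lifted1 i x2 x3)%:R <= 2 * \sum_(x3 in S) p3 x3 ->
    0 <= \sum_(x3 in S) g x3.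
  rewrite -subr_ge0 !mulr_sumr -sumrB; congr (_ <= _); apply: eq_bigr => x _.
  by rewrite /g; ring.
have lamTT k l : [|| T k \subset T l, T l \subset T k | [disjoint T k & T l]].
  exact: (laminar_tri lamT).
have : 0 <= \sum_(x3 in \bigcup_(k in s) (T k :&: T i)) g x3.
  apply: laminar_sum_ge0 => [k l _ _|k].
    have /or3P[h|h|h] := lamTT k l.
    - by rewrite setSI.
    - by rewrite (setSI _ h) orbT.
    - apply/or3P/Or33; apply: disjointWl (subsetIl _ _) _.
      by apply: disjointWr (subsetIl _ _) _.
  rewrite inE => /and4P[Qki _ _ gk] _.
  have /or3P[h|h|h] := lamTT k i.
  - rewrite (setIidPl h); apply: gge0; apply: le_trans gk.
    rewrite ler_wpM2l //; apply: ler_sum => x3 xT; rewrite ler_wpM2l // ler_nat.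
    case: (boolP (lifted1 i x2 x3)) => // /existsP[j /and3P[Qij xB xTj]].
    by rewrite lt0b; apply/existsP; exists j; rewrite (subset_trans Qki Qij) xB.
  - by rewrite (setIidPr h); apply: gge0.
  - by rewrite (disjoint_setI0 h) big_set0.
rewrite !sum_in => h.
apply: (@le_trans _ _ (2 * \sum_x3 p3 x3 *
  (~~ lifted1 i x2 x3 && (x3 \in \bigcup_(k in s) (T k :&: T i)))%:R)); last first.
  rewrite ler_wpM2l //; apply: ler_sum => x3 _.
  rewrite -mulrA ler_wpM2l // -natrM mulnb ler_nat.
  case: (boolP (x3 \in \bigcup_(k in s) (T k :&: T i))) => [/bigcupP[k]|]; last by rewrite andbF.
  rewrite !inE => /and4P[Qki x1A x2B gk] /andP[xTk ->]; rewrite !andbT.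
  rewrite (_ : _ \in Om) ?andbT //; apply/bigcupP; exists k => //.
  by rewrite inE /= x1A x2B.
rewrite -subr_ge0 mulr_sumr -sumrB; apply: (le_trans h); apply: ler_sum => x3 _.
rewrite /g.
have -> : (x3 \in \bigcup_(k in s) (T k :&: T i)) = (x3 \in T i) && present i (x1, x2, x3).
  apply/bigcupP/andP => [[k]|[xTi /existsP[k /and3P[Qki]]]].
    rewrite !inE => /and4P[Qki x1A x2B gk] /andP[xTk ->]; split=> //.
    by apply/existsP; exists k; rewrite Qki inE /= x1A x2B xTk.
  rewrite inE /= => /and3P[x1A x2B xTk] gk; exists k; last by rewrite inE xTk.
  by rewrite inE Qki x1A x2B.
case: (x3 \in T i); case: (lifted1 i x2 x3); case: (present _ _) => /=;
  rewrite ?mulr0 ?mulr1 ?subr0 ?subrr ?lexx //; have := p3_ge0 x3; lra.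
Qed.

Lemma sum_restrict (Y : finType) (S : {set Y}) (p f : Y -> R) :
  \sum_(y in S) p y * f y = \sum_y p y * (y \in S)%:R * f y.
Proof. by rewrite sum_in; apply: eq_bigr => y _; ring. Qed.

(** A lifted line lies in [Om] over its whole expanded side, so the density bounds on the two
    expanded rectangles supply the hypotheses of [sum_expansion_ge]. *)
Lemma exceptional_volume i : vol (rect i) <= 10 * vol (exceptional i).
Proof.
pose P1 x := p1 x * (x \in A i)%:R; pose Pq x := p1 x * (x \in QA i)%:R.
pose P2 x := p2 x * (x \in B i)%:R; pose Pr x := p2 x * (x \in QB i)%:R.
pose P3 x := p3 x * (x \in T i)%:R.
have P10 x : 0 <= P1 x by rewrite mulr_ge0.
have Pq0 x : 0 <= Pq x by rewrite mulr_ge0.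
have P20 x : 0 <= P2 x by rewrite mulr_ge0.
have Pr0 x : 0 <= Pr x by rewrite mulr_ge0.
have P30 x : 0 <= P3 x by rewrite mulr_ge0.
have P1E : \sum_(x in A i) p1 x = \sum_x P1 x by exact: sum_in.
have P2E : \sum_(x in B i) p2 x = \sum_x P2 x by exact: sum_in.
have P3E : \sum_(x in T i) p3 x = \sum_x P3 x by exact: sum_in.
have PqE : \sum_(x in QA i) p1 x = \sum_x Pq x by exact: sum_in.
have PrE : \sum_(x in QB i) p2 x = \sum_x Pr x by exact: sum_in.
have exE : vol (exceptional i) = \sum_x2 P2 x2 * \sum_x3 P3 x3 * \sum_x1 P1 x1 *
    (~~ lifted2 i x1 x3 && (lifted1 i x2 x3 ==> good i x2 && ~~ crowded i x2 x3))%:R.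
  rewrite volumeE sum_triple1; apply: eq_bigr => x2 _; rewrite mulr_sumr.
  apply: eq_bigr => x3 _; rewrite !mulr_sumr; apply: eq_bigr => x1 _.
  rewrite /P1 /P2 /P3 !inE /mass /=.
  by case: (x1 \in A i); case: (x2 \in B i); case: (x3 \in T i);
    rewrite ?andbF ?andbT ?mulr0 ?mul0r ?mulr0 ?mulr1 //=; ring.
rewrite volume_rect P1E P2E P3E exE.
(* Null sides are split off because the estimates below get divided by the masses of [QA i] and
   [QB i]. *)
have [a0|ne0] := eqVneq (\sum_x P1 x) 0.
  rewrite a0 !mul0r mulr_ge0 // sumr_ge0 // => x2 _; rewrite mulr_ge0 // sumr_ge0 // => x3 _.
  by rewrite mulr_ge0 // sumr_ge0 // => x1 _; rewrite mulr_ge0.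
have [b0|ne0'] := eqVneq (\sum_x P2 x) 0.
  rewrite b0 mulr0 !mul0r mulr_ge0 // sumr_ge0 // => x2 _; rewrite mulr_ge0 // sumr_ge0 // => x3 _.
  by rewrite mulr_ge0 // sumr_ge0 // => x1 _; rewrite mulr_ge0.
have q0 : 0 < \sum_x Pq x.
  apply: (@lt_le_trans _ _ (\sum_x P1 x)); first by rewrite lt0r ne0 sumr_ge0.
  apply: ler_sum => x _; rewrite ler_wpM2l // ler_nat.
  by case: (boolP (x \in A i)) => // /(subsetP (AQ i)) ->.
have r0 : 0 < \sum_x Pr x.
  apply: (@lt_le_trans _ _ (\sum_x P2 x)); first by rewrite lt0r ne0' sumr_ge0.
  apply: ler_sum => x _; rewrite ler_wpM2l // ler_nat.
  by case: (boolP (x \in B i)) => // /(subsetP (BQ i)) ->.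
apply: sum_expansion_ge => //.
- move=> x2; rewrite /good -ltNge sum_restrict P3E => /ltW; exact.
- set cc := \sum_x2 _; set ss := \sum_x2 P2 x2 * _.
  pose o := \sum_x2 P2 x2 * \sum_x1 Pq x1 * \sum_x3 P3 x3 *
    (~~ lifted1 i x2 x3 && ((x1, x2, x3) \in Om))%:R.
  (* One factor 2 comes from the definition of [crowded], the other from [present_line]. *)
  have co : (\sum_x Pq x) * cc <= 4 * o.
    rewrite !mulr_sumr; apply: ler_sum => x2 _.
    rewrite mulrCA [leRHS]mulrCA ler_wpM2l //.
    have o0 : 0 <= 4 * \sum_x1 Pq x1 * \sum_x3 P3 x3 *
        (~~ lifted1 i x2 x3 && ((x1, x2, x3) \in Om))%:R.
      rewrite mulr_ge0 // sumr_ge0 // => x _.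
      by rewrite mulr_ge0 // sumr_ge0 // => y _; rewrite mulr_ge0.
    case: (boolP (good i x2)) => [gi|_]; last first.
      by rewrite [X in _ * X <= _]big1 ?mulr0 // => x _; rewrite /= andbF mulr0.
    apply: (@le_trans _ _ (2 * \sum_x3 P3 x3 * \sum_x1 Pq x1 *
        (lifted1 i x2 x3 && present i (x1, x2, x3))%:R)).
      rewrite !mulr_sumr; apply: ler_sum => x3 _.
      rewrite mulrCA [leRHS]mulrCA ler_wpM2l //.
      case: (boolP (lifted1 i x2 x3)) => _ /=; last first.
        by rewrite mulr0 mulr_ge0 // sumr_ge0 // => x _; rewrite mulr_ge0.
      case: (boolP (crowded i x2 x3)) => [/ltW|_]; last first.
        by rewrite mulr0 mulr_ge0 // sumr_ge0 // => x _; rewrite mulr_ge0.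
      by rewrite mulr1 PqE sum_restrict.
    have -> : \sum_x3 P3 x3 * (\sum_x1 Pq x1 * (lifted1 i x2 x3 && present i (x1, x2, x3))%:R)
        = \sum_x1 Pq x1 * \sum_x3 P3 x3 * (lifted1 i x2 x3 && present i (x1, x2, x3))%:R.
      under eq_bigr do rewrite mulr_sumr.
      rewrite exchange_big; apply: eq_bigr => x1 _; rewrite mulr_sumr.
      by apply: eq_bigr => x3 _; ring.
    rewrite (_ : 4 = 2 * 2 :> R); last by ring.
    rewrite -mulrA ler_wpM2l // mulr_sumr; apply: ler_sum => x1 _.
    rewrite [leRHS]mulrCA ler_wpM2l //.
    by have := present_line x1 gi; rewrite !sum_restrict.
  (* In the expanded rectangle, the lifted lines and the unlifted points of [Om] counted by [o] are
     disjoint parts of [Om]. *)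
  have dens : 2 * ((\sum_x Pq x) * ss + o) <= (\sum_x Pq x) * ((\sum_x2 P2 x2) * \sum_x3 P3 x3).
    have := sparseA i; rewrite volume_rect PqE P2E P3E -mulrA; apply: le_trans.
    rewrite ler_wpM2l // mulr_sumr -big_split /= volumeE sum_triple exchange_big /=.
    apply: ler_sum => x2 _; rewrite mulrCA -mulrDr !mulr_suml -big_split /= mulr_sumr.
    apply: ler_sum => x1 _; rewrite -mulrDr -big_split !mulr_sumr /=.
    apply: ler_sum => x3 _; rewrite -mulrDr /P2 /Pq /P3 /mass in_setI [in leRHS]inE /=.
    case: (boolP (x1 \in QA i)) => x1A; last by rewrite !(mulr0, mul0r, andbF).
    case: (boolP (x2 \in B i)) => x2B; last by rewrite !(mulr0, mul0r, andbF).
    case: (boolP (x3 \in T i)) => x3T; last by rewrite !(mulr0, mul0r, andbF).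
    rewrite !mulr1 !andbT mulrCA !mulrA ler_wpM2l ?mulr_ge0 //.
    case: (boolP (lifted1 i x2 x3)) => [/existsP[j /and3P[Qij x2j x3j]]|_].
      rewrite addr0 ler_nat lt0b; apply/bigcupP; exists j => //.
      by rewrite inE /= (subsetP Qij) ?x2j.
    by rewrite add0r.
  have : (\sum_x Pq x) * (cc + 4 * ss) <=
      (\sum_x Pq x) * (2 * ((\sum_x2 P2 x2) * \sum_x3 P3 x3)) by lra.
  by rewrite ler_pM2l.
- set s' := \sum_x3 _.
  have : (\sum_x Pr x) * (2 * s') <= (\sum_x Pr x) * ((\sum_x P1 x) * \sum_x P3 x); last first.
    by rewrite ler_pM2l.
  have := sparseB i; rewrite volume_rect P1E PrE P3E => /(le_trans _) h.
  rewrite [leRHS](_ : _ = (\sum_x P1 x) * (\sum_x Pr x) * (\sum_x P3 x)); last by ring.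
  apply: h; rewrite mulrCA ler_wpM2l // mulr_suml volumeE sum_triple1.
  apply: ler_sum => x2 _; rewrite mulr_sumr.
  apply: ler_sum => x3 _; rewrite !mulr_sumr.
  apply: ler_sum => x1 _; rewrite /P1 /Pr /P3 /mass in_setI [in leRHS]inE /=.
  case: (boolP (x1 \in A i)) => x1A; last by rewrite !(mulr0, mul0r, andbF).
  case: (boolP (x2 \in QB i)) => x2B; last by rewrite !(mulr0, mul0r, andbF).
  case: (boolP (x3 \in T i)) => x3T; last by rewrite !(mulr0, mul0r, andbF).
  rewrite !mulr1 !andbT [leLHS](_ : _ = p1 x1 * p2 x2 * p3 x3 * (lifted2 i x1 x3)%:R);
    last by ring.
  rewrite ler_wpM2l ?mulr_ge0 // ler_nat.
  case: (boolP (lifted2 i x1 x3)) => [/existsP[j /and3P[Qij x1j x3j]]|//].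
  rewrite lt0b; apply/bigcupP; exists j => //.
  by rewrite inE /= (subsetP Qij) ?x1j ?x3j.
Qed.

Context (w : nat -> nat -> R) (W : R).
Context (w_ge0 : forall k l, 0 <= w k l).
Context (w_noninc1 : forall k k' l, (k <= k')%N -> w k' l <= w k l).
Context (w_noninc2 : forall k l l', (l <= l')%N -> w k l' <= w k l).
Context (wW : forall N, \sum_(k < N.+1) w k (N - k)%N <= W).

Lemma sum_exceptional :
  \sum_i w (a i) (c i) * vol (exceptional i) <= 2 * W * vol Om.
Proof.
have W0 : 0 <= W by apply: le_trans (wW 0); exact: sumr_ge0.
have exrect i x : x \in exceptional i -> x \in rect i by rewrite inE => /andP[].
have /fin_all_exists[ch chP] : forall x : X, exists ch : seq I,
    [/\ {subset ch <= [set i | x \in exceptional i]},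
    forall i, i \in ch -> exists2 j, x \in exceptional j & m i + (a i)%:Z < m j,
    sorted (fun i j => m i + (a i)%:Z < m j) ch, (size ch <= #|I|)%N &
    \sum_(i | x \in exceptional i) w (a i) (c i) <= W * ((x \in Om)%:R + (size ch)%:R)].
  move=> x; pose s := [set i | x \in exceptional i].
  have sE : \sum_(i | x \in exceptional i) w (a i) (c i) = \sum_(i in s) w (a i) (c i).
    by apply: eq_bigl => i; rewrite [RHS]inE.
  case: (boolP (x \in Om)) => [_|xOm]; last first.
    exists [::]; split=> //; rewrite big_pred0 ?mulr_ge0 ?addr_ge0 //.
    move=> i; apply/negbTE; apply: contra xOm => /exrect xi.
    by apply/bigcupP; exists i.
  have [||ch [chs act srt sz le]] := @sum_antichain R I m n a c w W w_ge0 w_noninc1 w_noninc2 wW s.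
  - move=> i j; rewrite !inE => /andP[xi _] /andP[xj _] ij mij; rewrite ltNge.
    have := incomp ij _ _; move=> /(_ x); rewrite !inE xi xj mij /= => /(_ isT isT).
    exact.
  (* A larger jump of the second side would put [QB i] inside [B j], so the line would be lifted in
     the second direction, which [exceptional] excludes. *)
  - move=> i j; rewrite !inE => /andP[/and3P[xA xB xT] /andP[nl _]] /andP[/and3P[yA yB yT] _].
    rewrite leNgt; apply: contra nl => /(stepB xB yB) Qij.
    by apply/existsP; exists j; rewrite Qij yA.
  exists ch; split=> //.
  - by move=> i /act[j]; rewrite inE; exists j.
  - by apply: (leq_trans sz); exact: max_card.
  - by rewrite sE; apply: le_trans le _; rewrite le_eqVlt eqxx.
have step i j x : x \in exceptional i -> x \in exceptional j -> m i + (a i)%:Z < m j ->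
    QA i \subset A j.
  move=> /exrect + /exrect; rewrite !inE => /and3P[xA _ _] /and3P[yA _ _].
  exact: stepA xA yA.
have -> : \sum_i w (a i) (c i) * vol (exceptional i) =
    \sum_x mass x * \sum_(i | x \in exceptional i) w (a i) (c i).
  under eq_bigr do rewrite /volume big_mkcond mulr_sumr.
  rewrite exchange_big; apply: eq_bigr => x _.
  rewrite mulr_sumr [RHS]big_mkcond; apply: eq_bigr => i _.
  by case: ifP; rewrite ?mulr0 // mulrC.
have m0 := mass_ge0 p1_ge0 p2_ge0 p3_ge0.
apply: (@le_trans _ _ (W * (vol Om + \sum_x mass x * (size (ch x))%:R))).
  rewrite volumeE -big_split mulr_sumr /=; apply: ler_sum => x _.
  by rewrite -mulrDr mulrCA ler_wpM2l //; case: (chP x).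
rewrite -mulrA mulrCA ler_wpM2l // mulr_natl mulr2n lerD2l.
rewrite volumeE !sum_triple1; apply: ler_sum => x2 _; apply: ler_sum => x3 _.
(* Beyond each link there is a further exceptional member, so the link is lifted in the first
   direction; membership in [exceptional] then makes it good and not crowded. *)
pose s := [set i | [&& x2 \in B i, x3 \in T i, lifted1 i x2 x3, good i x2 & ~~ crowded i x2 x3]].
have un i : i \in s -> uncrowded p1 A QA s i.
  rewrite inE => /and5P[_ _ _ _]; rewrite /crowded -leNgt; apply: le_trans.
  rewrite ler_wpM2l // [leLHS]big_mkcond [leRHS]big_mkcond; apply: ler_sum => x1 _.
  case: (x1 \in QA i) => //=; case: ifP => [/exists_inP[j]|_]; last by rewrite mulr_ge0.
  rewrite inE => /and5P[x2j x3j _ gj _] /andP[Qji x1j].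
  rewrite (_ : present _ _) ?mulr1 //; apply/existsP; exists j.
  by rewrite Qji inE /= x1j x2j x3j.
have inex x1 i : i \in ch (x1, x2, x3) -> (x1, x2, x3) \in exceptional i.
  by case: (chP (x1, x2, x3)) => sub _ _ _ _ /sub; rewrite inE.
have chain : \sum_x p1 x * (size (ch (x, x2, x3)))%:R <=
    \sum_(x in \bigcup_(i in s) QA i) p1 x.
  apply: (@sum_chain R X1 I p1 A QA p1_ge0 AQ lamQ s (fun x1 => ch (x1, x2, x3)) #|I| un).
  - by move=> x1; case: (chP (x1, x2, x3)).
  - move=> x1 i ic; have xe := inex _ _ ic.
    have [j xj mij] : exists2 j, (x1, x2, x3) \in exceptional j & m i + (a i)%:Z < m j.
      by case: (chP (x1, x2, x3)) => _ act _ _ _; exact: act.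
    have Qij := step _ _ _ xe xj mij.
    have /[!inE]/= /and3P[_ x2j x3j] := exrect _ _ xj.
    have l1 : lifted1 i x2 x3 by apply/existsP; exists j; rewrite Qij x2j.
    by move: xe; rewrite !inE /= l1 /= => /andP[/and3P[_ -> ->] /and3P[_ -> ->]].
  - by move=> x1 i /inex/exrect; rewrite inE => /and3P[].
  - move=> x1; case: (chP (x1, x2, x3)) => _ _ srt _ _.
    apply: (sub_in_sorted (P := [pred i | (x1, x2, x3) \in exceptional i])) srt.
      by move=> i j /=; exact: step.
    by apply/allP => i /inex.
have c0 : 0 <= p2 x2 * p3 x3 by rewrite mulr_ge0.
move: chain => /(ler_wpM2l c0); rewrite !mulr_sumr => le.
apply: le_trans (le_trans le _).
  by apply: ler_sum => x1 _; rewrite /mass /= le_eqVlt; apply/orP; left; apply/eqP; ring.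
rewrite big_mkcond; apply: ler_sum => x1 _; rewrite /mass /=.
case: ifP => [/bigcupP[i]|_]; last by rewrite !mulr_ge0.
rewrite inE => /and5P[_ _ /existsP[j /and3P[Qij x2j x3j]] _ _] x1i.
rewrite (_ : _ \in Om); last first.
  by apply/bigcupP; exists j => //; rewrite inE /= (subsetP Qij) // x2j.
by rewrite mulr1 -[leRHS]mulrA [leLHS]mulrC.
Qed.

Lemma journe_carleson : \sum_i w (a i) (c i) * vol (rect i) <= 20 * W * vol Om.
Proof.
have := sum_exceptional; have : \sum_i w (a i) (c i) * vol (rect i) <=
    10 * \sum_i w (a i) (c i) * vol (exceptional i).
  rewrite mulr_sumr; apply: ler_sum => i _; rewrite mulrCA ler_wpM2l //.
  exact: exceptional_volume.
lra.
Qed.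

End journe.

(** * Weak type bound for the strong maximal function *)

Section strong_maximal.
Context (R : realFieldType) (X1 X2 X3 I : finType).
Context (p1 : X1 -> R) (p2 : X2 -> R) (p3 : X3 -> R).
Context (p1_ge0 : forall x, 0 <= p1 x) (p2_ge0 : forall x, 0 <= p2 x)
  (p3_ge0 : forall x, 0 <= p3 x).
Context (A : I -> {set X1}) (B : I -> {set X2}) (T : I -> {set X3}).
Context (lamA : forall i j, [|| A i \subset A j, A j \subset A i | [disjoint A i & A j]]).
Context (lamB : forall i j, [|| B i \subset B j, B j \subset B i | [disjoint B i & B j]]).
Context (lamT : forall i j, [|| T i \subset T j, T j \subset T i | [disjoint T i & T j]]).
Local Notation X := (X1 * X2 * X3)%type.
Local Notation mass := (product_mass p1 p2 p3).
Local Notation vol := (volume p1 p2 p3).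
Local Notation rect := (product_rect A B T).
Local Notation union := (rect_union A B T).

(** Weak type bound at level 1/k for the maximal function of a laminar family: [laminar_cover]
    applied to k f. *)
Lemma maximal_line (Y : finType) (p f : Y -> R) (P : I -> {set Y}) (k : R) :
  (forall y, 0 <= p y) -> (forall y, 0 <= f y) -> 0 <= k ->
  (forall i j, [|| P i \subset P j, P j \subset P i | [disjoint P i & P j]]) ->
  \sum_y p y * [exists i, (y \in P i) &&
     (\sum_(z in P i) p z <= k * \sum_(z in P i) p z * f z)]%:R
  <= k * \sum_y p y * f y.
Proof.
move=> p0 f0 k0 lam.
pose s := [set i | \sum_(z in P i) p z <= k * \sum_(z in P i) p z * f z].
have := @laminar_cover R Y I p (fun y => k * f y) P s p0 (fun y => mulr_ge0 k0 (f0 y))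
  (fun i j _ _ => lam i j) _.
have kE (S : {set Y}) : \sum_(y in S) p y * (k * f y) = k * \sum_(y in S) p y * f y.
  by rewrite mulr_sumr; apply: eq_bigr => y _; ring.
have -> : \sum_y p y * (k * f y) = k * \sum_y p y * f y.
  by rewrite mulr_sumr; apply: eq_bigr => y _; ring.
move=> h; apply: le_trans (h _) => [|i]; last by rewrite inE kE.
rewrite [leRHS]big_mkcond; apply: ler_sum => y _.
case: (boolP [exists i, _]) => [/existsP[i /andP[yi le]]|_].
  by rewrite mulr1 ifT //; apply/bigcupP; exists i; rewrite ?inE.
by rewrite mulr0; case: ifP.
Qed.

Context (A_gt0 : forall i, 0 < \sum_(x in A i) p1 x).
Context (B_gt0 : forall i, 0 < \sum_(x in B i) p2 x).

(* Iterated one-parameter weak type bounds at levels 1/4, 1/8, 1/8: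
   256 = 4 * 8 * 8. *)
Lemma strong_maximal (f : X -> R) : (forall x, 0 <= f x <= 1) ->
  (forall i, vol (rect i) <= 2 * \sum_(x in rect i) mass x * f x) ->
  vol (union setT) <= 256 * \sum_x mass x * f x.
Proof.
move=> f01 half.
have f0 x : 0 <= f x by case/andP: (f01 x).
pose f1 (x : X) : R := [exists i, (x.1.1 \in A i) && (\sum_(z in A i) p1 z <=
  4 * \sum_(z in A i) p1 z * f (z, x.1.2, x.2))]%:R.
pose f2 (x : X) : R := [exists i, (x.1.2 \in B i) && (\sum_(z in B i) p2 z <=
  8 * \sum_(z in B i) p2 z * f1 (x.1.1, z, x.2))]%:R.
pose f3 (x : X) : R := [exists i, (x.2 \in T i) && (\sum_(z in T i) p3 z <=
  8 * \sum_(z in T i) p3 z * f2 (x.1.1, x.1.2, z))]%:R.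
have f10 x : 0 <= f1 x by [].
have f20 x : 0 <= f2 x by [].
have le1 : \sum_x mass x * f1 x <= 4 * \sum_x mass x * f x.
  rewrite !sum_triple1 mulr_sumr; apply: ler_sum => x2 _.
  rewrite mulr_sumr; apply: ler_sum => x3 _.
  have c0 : 0 <= p2 x2 * p3 x3 by rewrite mulr_ge0.
  have hm := ler_wpM2l c0 (maximal_line (f := fun z => f (z, x2, x3)) p1_ge0
    (fun z => f0 _) (ler0n R 4) lamA).
  apply: (le_trans _ (le_trans hm _)).
    rewrite mulr_sumr; apply: ler_sum => x1 _; rewrite /mass /=.
    by rewrite le_eqVlt; apply/orP; left; apply/eqP; ring.
  rewrite [leLHS]mulrCA ler_wpM2l // mulr_sumr; apply: ler_sum => x1 _.
  by rewrite /mass le_eqVlt; apply/orP; left; apply/eqP => /=; ring.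
have le2 : \sum_x mass x * f2 x <= 8 * \sum_x mass x * f1 x.
  rewrite !sum_triple2 mulr_sumr; apply: ler_sum => x1 _.
  rewrite mulr_sumr; apply: ler_sum => x3 _.
  have c0 : 0 <= p1 x1 * p3 x3 by rewrite mulr_ge0.
  have hm := ler_wpM2l c0 (maximal_line (f := fun z => f1 (x1, z, x3)) p2_ge0
    (fun z => f10 _) (ler0n R 8) lamB).
  apply: (le_trans _ (le_trans hm _)).
    rewrite mulr_sumr; apply: ler_sum => x2 _; rewrite /mass /=.
    by rewrite le_eqVlt; apply/orP; left; apply/eqP; ring.
  rewrite [leLHS]mulrCA ler_wpM2l // mulr_sumr; apply: ler_sum => x2 _.
  by rewrite /mass le_eqVlt; apply/orP; left; apply/eqP => /=; ring.
have le3 : \sum_x mass x * f3 x <= 8 * \sum_x mass x * f2 x.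
  rewrite !sum_triple mulr_sumr; apply: ler_sum => x1 _.
  rewrite mulr_sumr; apply: ler_sum => x2 _.
  have c0 : 0 <= p1 x1 * p2 x2 by rewrite mulr_ge0.
  have hm := ler_wpM2l c0 (maximal_line (f := fun z => f2 (x1, x2, z)) p3_ge0
    (fun z => f20 _) (ler0n R 8) lamT).
  apply: (le_trans _ (le_trans hm _)).
    rewrite mulr_sumr; apply: ler_sum => x3 _; rewrite /mass /=.
    by rewrite le_eqVlt; apply/orP; left; apply/eqP; ring.
  rewrite [leLHS]mulrCA ler_wpM2l // mulr_sumr; apply: ler_sum => x3 _.
  by rewrite /mass le_eqVlt; apply/orP; left; apply/eqP => /=; ring.
suff cov : vol (union setT) <= \sum_x mass x * f3 x by lra.
rewrite volumeE; apply: ler_sum => x _; rewrite ler_wpM2l ?mass_ge0 //.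
case: (boolP (x \in union setT)) => //= /bigcupP[i _].
case: x => [[x1 x2] x3]; rewrite inE => /and3P[/= x1A x2B x3T].
rewrite /f3 (_ : [exists j, _]) //; apply/existsP; exists i; rewrite x3T /=.
set al := \sum_(x in A i) p1 x; set be := \sum_(x in B i) p2 x.
set ta := \sum_(x in T i) p3 x.
have al0 : 0 < al by exact: A_gt0.
have be0 : 0 < be by exact: B_gt0.
(* As f <= 1 has average at least 1/2, a share of at least 1/2 - 1/4 of the (y2, y3) has line
   average at least 1/4; in the same way a share of at least 1/4 - 1/8 of the y3 reaches level
   1/8. *)
pose e y2 y3 := (al <= 4 * \sum_(z in A i) p1 z * f (z, y2, y3)).
have q1 : be * ta <= 4 * \sum_(y3 in T i) p3 y3 * \sum_(y2 in B i) p2 y2 * (e y2 y3)%:R.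
  rewrite -(ler_pM2l al0) mulrA -volume_rect; apply: le_trans (half i) _.
  have hE : \sum_(x in rect i) mass x * f x =
      \sum_(y3 in T i) p3 y3 * \sum_(y2 in B i) p2 y2 * \sum_(z in A i) p1 z * f (z, y2, y3).
    rewrite sum_in sum_triple1 exchange_big /= sum_in; apply: eq_bigr => y3 _.
    rewrite mulrAC mulr_sumr [in RHS]sum_in; apply: eq_bigr => y2 _.
    rewrite [in RHS]sum_in !mulr_sumr !mulr_suml; apply: eq_bigr => y1 _.
    rewrite inE /mass /=.
    by case: (y1 \in A i); case: (y2 \in B i); case: (y3 \in T i);
      rewrite /= ?mulr0 ?mul0r ?mulr0 ?mulr1 //; ring.
  rewrite hE; have lev y2 y3 : \sum_(z in A i) p1 z * f (z, y2, y3) <= al * (4^-1 + (e y2 y3)%:R).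
    rewrite mulrDr; case: (boolP (e y2 y3)) => [_|]; last first.
      by rewrite /e -ltNge => /ltW le; rewrite mulr0 addr0; lra.
    apply: (@le_trans _ _ al); last by rewrite mulr1 lerDr; lra.
    by apply: ler_sum => z _; rewrite ler_piMr //; case/andP: (f01 (z, y2, y3)).
  have : \sum_(y3 in T i) p3 y3 * (\sum_(y2 in B i) p2 y2 * \sum_(z in A i) p1 z * f (z, y2, y3)) <=
     al * (4^-1 * (be * ta) + \sum_(y3 in T i) p3 y3 * \sum_(y2 in B i) p2 y2 * (e y2 y3)%:R).
    rewrite [be * ta]mulr_sumr mulr_sumr -big_split mulr_sumr /=; apply: ler_sum => y3 _.
    rewrite [leRHS](_ : _ = p3 y3 * (al * (4^-1 * be + \sum_(y2 in B i) p2 y2 * (e y2 y3)%:R)));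
      last by ring.
    rewrite ler_wpM2l // mulr_sumr -big_split mulr_sumr /=; apply: ler_sum => y2 _.
    rewrite [leRHS](_ : _ = p2 y2 * (al * (4^-1 + (e y2 y3)%:R))); last by ring.
    by rewrite ler_wpM2l.
  have := half i; rewrite hE volume_rect -/al -/be -/ta.
  set V := \sum_(y3 in T i) _ * \sum_(y2 in B i) _ * _%:R.
  lra.
pose e2 y3 := be <= 8 * \sum_(z in B i) p2 z * f1 (x1, z, y3).
have q2 : ta <= 8 * \sum_(y3 in T i) p3 y3 * (e2 y3)%:R.
  have : \sum_(y3 in T i) p3 y3 * (\sum_(y2 in B i) p2 y2 * (e y2 y3)%:R) <=
      be * (8^-1 * ta + \sum_(y3 in T i) p3 y3 * (e2 y3)%:R).
    rewrite mulr_sumr -big_split mulr_sumr /=; apply: ler_sum => y3 _.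
    rewrite [leRHS](_ : _ = p3 y3 * (be * (8^-1 + (e2 y3)%:R))); last by ring.
    rewrite ler_wpM2l //.
    apply: (@le_trans _ _ (\sum_(z in B i) p2 z * f1 (x1, z, y3))).
      apply: ler_sum => y2 _; rewrite ler_wpM2l // ler_nat.
      case: (boolP (e y2 y3)) => // ee; rewrite lt0b; apply/existsP; exists i.
      by rewrite x1A.
    rewrite mulrDr; case: (boolP (e2 y3)) => [_|]; last first.
      by rewrite /e2 -ltNge => /ltW le; rewrite mulr0 addr0; lra.
    apply: (@le_trans _ _ be); last by rewrite mulr1 lerDr; lra.
    by apply: ler_sum => z _; rewrite ler_piMr // /f1 lern1 leq_b1.
  by move=> hV; rewrite -(ler_pM2l be0); lra.
apply: (le_trans q2); rewrite ler_wpM2l //; apply: ler_sum => y3 _.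
rewrite ler_wpM2l // ler_nat; case: (boolP (e2 y3)) => // ee; rewrite lt0b.
by apply/existsP; exists i; rewrite x2B.
Qed.

End strong_maximal.

From mathcomp Require Import all_classical all_reals all_analysis measurable_realfun.
Import numFieldNormedType.Exports.

(** * Exponential integrability *)

Section exponential_estimates.
Context (R : realType).
Implicit Types x y t : R.

Lemma expR_ge_quadratic t : 0 <= t -> 1 + t + t ^+ 2 / 2 <= expR t.
Proof.
move=> t0; rewrite /expR.
have nd : nondecreasing_seq (series (exp_coeff t)).
  by apply: nondecreasing_series => k _ _; rewrite /exp_coeff /= divr_ge0 ?exprn_ge0.
have := nondecreasing_cvgn_le nd (is_cvg_series_exp_coeff t) 3.
by rewrite /series /= /exp_coeff /= !big_nat_recr //= big_geq // add0r expr0 expr1 !divr1.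
Qed.

Definition coshr y : R := (expR y + expR (- y)) / 2.

Lemma coshr_ge1 y : 1 <= coshr y.
Proof.
have := expR_gt0 y; have := expRxMexpNx_1 y; rewrite /coshr.
set a := expR y; set b := expR (- y) => ab a0.
suff : 0 <= a * (a + b - 2) by rewrite pmulr_rge0 //; lra.
rewrite [leRHS](_ : _ = (a - 1) ^+ 2); first exact: sqr_ge0.
by rewrite mulrBr mulrDr ab; ring.
Qed.

(** With s = 1 + t + t^2 / 2 <= e^t it suffices that s - 1/s >= 2 t, and s^2 - 1 - 2 t s = t^4 /
    4. *)
Lemma sinhr_ge t : 0 <= t -> 2 * t <= expR t - expR (- t).
Proof.
move=> t0; have := expR_ge_quadratic t0; rewrite expRN.
set s := 1 + t + t ^+ 2 / 2 => sE.
have s1 : 1 <= s by rewrite /s; have := sqr_ge0 t; lra.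
have s0 : 0 < s by lra.
have : (expR t)^-1 <= s^-1 by rewrite lef_pV2 ?posrE // expR_gt0.
suff : 2 * t <= s - s^-1 by lra.
rewrite -(ler_pM2r s0) mulrBl mulVf ?gt_eqF //.
have := exprn_ge0 4 t0; rewrite /s => h; nra.
Qed.

(** Reduces the two quadratic bounds for cosh to linear bounds for sinh at half the argument. *)
Lemma coshr_double t : coshr (t + t) - 1 = (expR t - expR (- t)) ^+ 2 / 2.
Proof.
rewrite /coshr opprD !expRD.
have := expRxMexpNx_1 t; set a := expR t; set b := expR (- t) => ab.
by rewrite sqrrB [a * b]ab; field.
Qed.

Lemma coshr_ge_quadratic y : y ^+ 2 / 2 <= coshr y - 1.
Proof.
wlog y0 : y / 0 <= y.
  move=> h; case: (leP 0 y) => [|/ltW]; first exact: h.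
  by rewrite -oppr_ge0 => /h; rewrite sqrrN /coshr opprK [expR (- y) + _]addrC.
have -> : y = y / 2 + y / 2 by field.
rewrite coshr_double; have h2 : 0 <= y / 2 by lra.
have := sinhr_ge h2; set d := expR _ - _ => hd.
have -> : (y / 2 + y / 2) ^+ 2 = (2 * (y / 2)) ^+ 2 by ring.
by rewrite ler_wpM2r // ler_pXn2r // ?nnegrE; lra.
Qed.

Lemma coshr_le_quadratic y : 0 <= y -> coshr y - 1 <= y ^+ 2 / 2 * expR y.
Proof.
move=> y0; have -> : y = y / 2 + y / 2 by field.
have t0 : 0 <= y / 2 by lra.
rewrite coshr_double expRD; move: (y / 2) t0 => t t0.
have h1 : expR t - expR (- t) <= 2 * t * expR t.
  have := expR_ge1Dx (- (t + t)); rewrite -(ler_pM2r (expR_gt0 t)).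
  rewrite -expRD (_ : - (t + t) + t = - t); last by ring.
  lra.
have h0 : 0 <= expR t - expR (- t) by have := sinhr_ge t0; lra.
have : (expR t - expR (- t)) ^+ 2 <= (2 * t * expR t) ^+ 2.
  by rewrite ler_pXn2r // nnegrE ?mulr_ge0 ?expR_ge0 //; lra.
set d := expR t - expR (- t); nra.
Qed.

Lemma coshr_homo x y : 0 <= x -> x <= y -> coshr x <= coshr y.
Proof.
move=> x0 xy; have y0 := le_trans x0 xy.
have h1 : 0 <= expR y - expR x by rewrite subr_ge0 ler_expR.
have h2 : expR (- x) * expR (- y) <= 1 by rewrite -expRD expR_le1; lra.
have e : expR (- x) - expR (- y) = (expR y - expR x) * (expR (- x) * expR (- y)).
  have := expRxMexpNx_1 x; have := expRxMexpNx_1 y.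
  set a := expR x; set b := expR y; set a' := expR (- x); set b' := expR (- y).
  move=> bb aa; rewrite mulrBl mulrCA bb mulr1 mulrA aa mul1r //.
have : (expR y - expR x) * (expR (- x) * expR (- y)) <= expR y - expR x.
  by rewrite ler_piMr.
rewrite -e /coshr; lra.
Qed.

Lemma le_expR y : y <= expR y.
Proof. by have := expR_ge1Dx y; lra. Qed.

Lemma ln2_bounds : 2^-1 <= ln (2 : R) <= 1.
Proof.
apply/andP; split.
  rewrite -ler_expR lnK ?posrE //.
  have := expR_ge1Dx (- 2^-1 : R); rewrite expRN => h.
  rewrite -[leRHS]invrK -[leLHS]invrK lef_pV2 ?posrE ?invr_gt0 ?expR_gt0 //.
  by lra.
rewrite -[leRHS]expRK ler_ln ?posrE ?expR_gt0 //.
by have := expR_ge1Dx (1 : R); lra.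
Qed.

(* Young's inequality for the pair y |-> y ln y and h |-> 2 ^ h. *)
Lemma young_exp2 (v : R) (h : nat) : 0 <= v ->
  expR v * h%:R <= 2 * (expR v * v) + 2 * (2 ^+ h - 1).
Proof.
move=> v0; have /andP[l0 l1] := ln2_bounds; set l := ln 2 in l0 l1.
have e2 : 2 ^+ h = expR (h%:R * l) :> R by rewrite expRM_natl lnK ?posrE.
have := expR_ge1Dx (h%:R * l - v); rewrite -(ler_pM2l (expR_gt0 v)) -expRD.
rewrite (_ : v + (h%:R * l - v) = h%:R * l) -?e2; last by ring.
have v1 : 1 <= expR v by rewrite -expR0 ler_expR.
have : expR v * h%:R * 2^-1 <= expR v * h%:R * l by rewrite ler_wpM2l ?mulr_ge0 ?expR_ge0.
lra.
Qed.

(** As ln 2 >= 1/2, the condition forces j <= 2 u + 1. *)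
Lemma count_dyadic_le (u : R) N : 0 <= u ->
  \sum_(j < N) ((2 : R) ^+ j < 2 * expR u)%R%:R <= 2 * u + 2.
Proof.
move=> u0; have /andP[l0 l1] := ln2_bounds; set l := ln 2 in l0 l1.
have e2 h : 2 ^+ h = expR (h%:R * l) :> R by rewrite expRM_natl lnK ?posrE.
have lt (j : nat) : (2 : R) ^+ j < 2 * expR u -> j%:R <= 2 * u + 1.
  rewrite -[X in _ < X * _]expr1 !e2 -expRD ltr_expR => h.
  have j0 : 0 <= j%:R :> R by [].
  case: (lerP j%:R (2 * u + 1)) => // gt; exfalso.
  have : 0 <= (j%:R - 1) * (l - 2^-1) by rewrite mulr_ge0; lra.
  lra.
have IH k : \sum_(j < k) ((2 : R) ^+ j < 2 * expR u)%R%:R <= (k%:R : R).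
  rewrite -[X in _ <= X%:R]card_ord -sum1_card natr_sum.
  by apply: ler_sum => i _; rewrite ler_nat leq_b1.
elim: N => [|N IHN]; first by rewrite big_ord0; lra.
case: (boolP ((2 : R) ^+ N < 2 * expR u)) => [/lt h|/negbTE h]; last first.
  by rewrite big_ord_recr /= h addr0.
by apply: le_trans (IH _) _; rewrite -natr1; lra.
Qed.

(** Telescoping: as long as s stays above 2 ^ j v, the j-th term raises the partial sum from 2 ^ j v
    to 2 ^ (j + 1) v. *)
Lemma le_dyadic_sum (v s : R) N : 0 <= v -> s <= 2 ^+ N * v ->
  s <= v + \sum_(j < N) 2 ^+ j * (v * (2 ^+ j * v < s)%R%:R).
Proof.
move=> v0; elim: N s => [|N IH] s sN; first by rewrite big_ord0; lra.
rewrite big_ord_recr /=; case: (ltP (2 ^+ N * v) s) => h; last first.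
  by rewrite !mulr0 addr0; exact: IH.
have := IH _ (lexx (2 ^+ N * v)); move: sN; rewrite exprS mulr1.
have : \sum_(j < N) 2 ^+ j * (v * (2 ^+ j * v < 2 ^+ N * v)%R%:R) <=
    \sum_(j < N) 2 ^+ j * (v * (2 ^+ j * v < s)%R%:R).
  apply: ler_sum => j _; rewrite ler_wpM2l ?exprn_ge0 // ler_wpM2l // ler_nat.
  by case: ltP => // /lt_trans/(_ h) ->.
lra.
Qed.

End exponential_estimates.

Section carleson_exponential.
Context (R : realType) (X1 X2 X3 I : finType).
Context (p1 : X1 -> R) (p2 : X2 -> R) (p3 : X3 -> R).
Context (p1_ge0 : forall x, 0 <= p1 x) (p2_ge0 : forall x, 0 <= p2 x)
  (p3_ge0 : forall x, 0 <= p3 x).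
Context (A : I -> {set X1}) (B : I -> {set X2}) (T : I -> {set X3}).
Context (m n : I -> int).
Context (lamA : forall i j, m i <= m j ->
  (A i \subset A j) || [disjoint A i & A j]).
Context (lamB : forall i j, n i <= n j ->
  (B i \subset B j) || [disjoint B i & B j]).
Context (lamT : forall i j, m i + n i <= m j + n j ->
  (T i \subset T j) || [disjoint T i & T j]).
Local Notation X := (X1 * X2 * X3)%type.
Local Notation mass := (product_mass p1 p2 p3).
Local Notation vol := (volume p1 p2 p3).
Local Notation rect := (product_rect A B T).
Local Notation union := (rect_union A B T).
Local Notation ht := (overlap A B T).
Context (incomp : forall i j x, i != j -> x \in rect i -> x \in rect j ->
  ~~ ((m i <= m j) && (n i <= n j))).
Context (a : I -> R) (a_ge0 : forall i, 0 <= a i).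
Context (carl : forall s : {set I}, \sum_(i in s) a i * vol (rect i) <= vol (union s)).

Definition weighted_sum (x : X) : R := \sum_(i | x \in rect i) a i.
Local Notation f := weighted_sum.
Let u x := 24^-1 * Num.sqrt (f x).
Let phi x := expR (u x).
Let Om := union [set: I]%SET.

Let m0 : forall x, 0 <= mass x := mass_ge0 p1_ge0 p2_ge0 p3_ge0.

Lemma weighted_sum_ge0 x : 0 <= f x.
Proof. by apply: sumr_ge0 => i _. Qed.

Lemma weighted_sum_out x : x \notin Om -> f x = 0.
Proof.
move=> xOm; apply: big_pred0 => i; apply/negbTE; apply: contra xOm => xi.
by apply/finset.bigcupP; exists i.
Qed.

Let u_ge0 x : 0 <= u x.
Proof. by rewrite mulr_ge0 ?sqrtr_ge0. Qed.

Let phi_ge1 x : 1 <= phi x.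
Proof. by rewrite -expR0 ler_expR. Qed.

Let phi_ge0 x : 0 <= phi x.
Proof. exact: expR_ge0. Qed.

Let sum_weighted (g : X -> R) :
  \sum_x mass x * (f x * g x) = \sum_i a i * \sum_(x in rect i) mass x * g x.
Proof.
transitivity (\sum_x \sum_i (if x \in rect i then a i * (mass x * g x) else 0)).
  apply: eq_bigr => x _; rewrite -big_mkcond /= mulrCA mulr_suml.
  by apply: eq_bigr => i _.
rewrite exchange_big; apply: eq_bigr => i _.
by rewrite -big_mkcond mulr_sumr.
Qed.

(** The members kept by [exp_selection] have phi-average above 2 ^ j, so dropping the points with
    phi <= 2 ^ j / 2 loses at most half. The remaining integral of height times phi is split by
    Young's inequality with e ^ v = 32 phi / 2 ^ j; the factor 32 makes the term in 2 ^ height at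
    most half of 2 ^ j S, which is absorbed. This leaves 2 ^ j S <= 8 V, and 72 = 9 * 8. *)
Let level_selection (j : nat) :
  2 ^+ j * vol (union [set i | 2 ^+ j * vol (rect i) < \sum_(x in rect i) mass x * phi x])
  <= 72 * \sum_x mass x * ((phi x * (5 + u x)) * ((x \in Om) && (2 ^+ j < 2 * phi x)%R)%:R).
Proof.
set s := [set i | _].
have [g gs [h2 hs]] := exp_selection p1_ge0 p2_ge0 p3_ge0 lamA lamB lamT incomp s.
set S := \sum_(i in g) vol (rect i) in h2 hs.
have L0 : 0 < (2 : R) ^+ j by rewrite exprn_gt0.
pose hi x := (2 ^+ j < 2 * phi x)%R.
have S0 : 0 <= S by apply: sumr_ge0 => i _; exact: volume_ge0.
have lower : 2 ^+ j * S <= 2 * \sum_x mass x * (ht g x)%:R * (phi x * (hi x)%:R).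
  rewrite sum_overlap !mulr_sumr; apply: ler_sum => i gi.
  have := fintype.subsetP gs _ gi; rewrite inE => lt.
  have : \sum_(x in rect i) mass x * phi x <=
      \sum_(x in rect i) mass x * (phi x * (hi x)%:R) + 2 ^+ j / 2 * vol (rect i).
    rewrite mulr_sumr -big_split; apply: ler_sum => x _ /=.
    rewrite [_ / 2 * _]mulrC -mulrDr ler_wpM2l //.
    case: (boolP (hi x)) => [_|]; first by rewrite mulr1 lerDl; lra.
    by rewrite /hi -leNgt mulr0 add0r; lra.
  lra.
have young x : (ht g x)%:R * (phi x * (hi x)%:R) <=
    2 * (phi x * (5 + u x) * (hi x)%:R * (x \in Om)%:R) + 2 ^+ j / 16 * (2 ^+ ht g x - 1).
  have h1 : 0 <= (2 : R) ^+ ht g x - 1 by rewrite subr_ge0 exprn_ege1 // ler1n.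
  have h16 : 0 <= (2 : R) ^+ j / 16 * (2 ^+ ht g x - 1) by rewrite mulr_ge0 // divr_ge0 // ltW.
  have pu : 0 <= phi x * (5 + u x) by rewrite mulr_ge0 // addr_ge0.
  case: (boolP (hi x)) => [hx|_]; last by rewrite !(mulr0, mul0r) add0r.
  case: (boolP (x \in Om)) => [_|xOm]; last first.
    suff -> : ht g x = 0%N by rewrite mul0r !mulr0 add0r expr0 subrr mulr0.
    apply/eqP; rewrite overlap_eq0; apply: contra xOm => /finset.bigcupP[i _ xi].
    by apply/finset.bigcupP; exists i.
  rewrite !mulr1; have /andP[l0 l1] := @ln2_bounds R; set l := ln 2 in l0 l1.
  have e2 k : 2 ^+ k = expR (k%:R * l) :> R by rewrite expRM_natl lnK ?posrE.
  pose v := 5 * l + u x - j%:R * l.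
  have ev : expR v = 32 * phi x / 2 ^+ j.
    rewrite /v expRB expRD -!e2 (_ : (2 : R) ^+ 5 = 32) //; by rewrite !exprS expr0; ring.
  have v0 : 0 <= v.
    rewrite -(@ler_expR R) expR0 ev ler_pdivlMr // mul1r; move: hx; rewrite /hi.
    by have := phi_ge0 x; lra.
  have v5 : v <= 5 + u x.
    have : 0 <= j%:R * l by rewrite mulr_ge0 //; lra.
    by rewrite /v; lra.
  have := young_exp2 (ht g x) v0; rewrite ev.
  have : 32 * phi x / 2 ^+ j * v <= 32 * phi x / 2 ^+ j * (5 + u x).
    by rewrite ler_wpM2l // divr_ge0 ?mulr_ge0 // ltW.
  move=> le1 le2.
  have {le2} : 32 * phi x / 2 ^+ j * (ht g x)%:R <=
    2 * (32 * phi x / 2 ^+ j * (5 + u x)) + 2 * (2 ^+ ht g x - 1) by lra.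
  have L320 : 0 <= (2 : R) ^+ j / 32 by rewrite divr_ge0 // ltW.
  move=> /(ler_wpM2l L320).
  rewrite (_ : 2 ^+ j / 32 * (32 * phi x / 2 ^+ j * (ht g x)%:R) = (ht g x)%:R * phi x);
    last by field; rewrite gt_eqF.
  rewrite (_ : 2 ^+ j / 32 * _ = 2 * (phi x * (5 + u x)) + 2 ^+ j / 16 * (2 ^+ ht g x - 1)) //.
  by field; rewrite gt_eqF.
set V := \sum_x mass x * (_ * ((x \in Om) && _)%:R).
have main : \sum_x mass x * (ht g x)%:R * (phi x * (hi x)%:R) <= 2 * V + 2 ^+ j / 4 * S.
  apply: (@le_trans _ _ (2 * V + 2 ^+ j / 16 * \sum_x mass x * (2 ^+ ht g x - 1))).
    rewrite !mulr_sumr -big_split; apply: ler_sum => x _ /=.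
    rewrite [leRHS](_ : _ = mass x * (2 * (phi x * (5 + u x) * (hi x)%:R * (x \in Om)%:R)
      + 2 ^+ j / 16 * (2 ^+ ht g x - 1))); last first.
      rewrite -/(hi x) -mulnb natrM; ring.
    by rewrite -mulrA ler_wpM2l.
  have L16 : 0 <= (2 : R) ^+ j / 16 by rewrite divr_ge0 // ltW.
  have := ler_wpM2l L16 h2; lra.
have := ler_wpM2l (ltW L0) hs; lra.
Qed.

(* 45 ^ 2 * expR 4 bounds the integrand where f <= 90 ^ 2; elsewhere 3/4 of the
   left-hand side of carleson_exp is absorbed, whence the factor 4. *)
Definition exp_const : R := 4 * (1 + 45 ^+ 2 * expR 4).

(** The integral is the sum of a_i times the integral of phi over [rect i]. These integrals are cut
    into dyadic levels of the average; on each level the Carleson condition turns the sum into the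
    volume of a union, and [level_selection] returns to an integral involving phi, where a point is
    counted for at most 2 u + 2 levels. *)
Lemma carleson_exp : \sum_x mass x * (f x * phi x) <= exp_const * vol Om.
Proof.
pose s j := [set i | 2 ^+ j * vol (rect i) < \sum_(x in rect i) mass x * phi x].
have [N hN] : exists N, forall x, phi x <= 2 ^+ N.
  exists (Num.bound (\sum_x phi x)) => x.
  have le : phi x <= \sum_x phi x.
    by rewrite (bigD1 x) //= lerDl sumr_ge0.
  apply: (le_trans le); apply: (@le_trans _ _ (Num.bound (\sum_x phi x))%:R).
    by apply/ltW/archi_boundP/sumr_ge0.
  by rewrite -natrX ler_nat ltnW // ltn_expl.
have avg i : \sum_(x in rect i) mass x * phi x <= vol (rect i) +
    \sum_(j < N) 2 ^+ j * (vol (rect i) * (i \in s j)%:R).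
  have := @le_dyadic_sum R (vol (rect i)) (\sum_(x in rect i) mass x * phi x) N.
  move=> h; apply: le_trans (h _ _) _; first exact: volume_ge0.
    rewrite /volume mulr_sumr; apply: ler_sum => x _.
    by rewrite mulrC ler_wpM2r.
  by rewrite lerD2l; apply: ler_sum => j _; rewrite inE.
have step1 : \sum_x mass x * (f x * phi x) <=
    vol Om + \sum_(j < N) 2 ^+ j * vol (union (s j)).
  rewrite sum_weighted.
  apply: (@le_trans _ _ (\sum_i a i * (vol (rect i) +
      \sum_(j < N) 2 ^+ j * (vol (rect i) * (i \in s j)%:R)))).
    by apply: ler_sum => i _; rewrite ler_wpM2l.
  rewrite (eq_bigr (fun i => a i * vol (rect i) +
      \sum_(j < N) a i * (2 ^+ j * (vol (rect i) * (i \in s j)%:R)))); last first.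
    by move=> i _; rewrite mulrDr; congr (_ + _); rewrite mulr_sumr.
  rewrite big_split /= exchange_big /=; apply: lerD.
    apply: (le_trans _ (carl [set: I]%SET)).
    by rewrite le_eqVlt; apply/orP; left; apply/eqP; apply: eq_bigl => i; rewrite inE.
  apply: ler_sum => j _; apply: le_trans _ (ler_wpM2l _ (carl (s j))); last by rewrite exprn_ge0.
  rewrite mulr_sumr [leRHS]big_mkcond; apply: ler_sum => i _.
  by case: ifP => _; rewrite ?mulr0 // mulr1 mulrCA.
pose G x := mass x * ((phi x * (5 + u x)) * (x \in Om)%:R).
have G0 x : 0 <= G x by rewrite !mulr_ge0 // addr_ge0.
have step2 : \sum_(j < N) 2 ^+ j * vol (union (s j)) <=
    72 * \sum_x G x * (2 * u x + 2).
  apply: (@le_trans _ _ (\sum_(j < N) 72 * \sum_x G x * ((2 ^+ j < 2 * phi x)%R)%:R)).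
    apply: ler_sum => j _; apply: le_trans (level_selection j) _.
    rewrite ler_wpM2l //; apply: ler_sum => x _; rewrite /G -mulnb natrM.
    by rewrite le_eqVlt; apply/orP; left; apply/eqP; ring.
  rewrite -mulr_sumr ler_wpM2l // exchange_big; apply: ler_sum => x _ /=.
  by rewrite -mulr_sumr ler_wpM2l //; exact: count_dyadic_le.
(* With u = sqrt f / 24 the polynomial 72 (5 + u) (2 u + 2) equals f / 4 + 36 sqrt f + 720, which is
   below 3/4 f once sqrt f > 90. *)
have step3 : 72 * \sum_x G x * (2 * u x + 2) <=
    3 / 4 * \sum_x mass x * (f x * phi x) + 45 ^+ 2 * expR 4 * vol Om.
  rewrite volumeE !mulr_sumr -big_split; apply: ler_sum => x _ /=.
  rewrite /G; case: (boolP (x \in Om)) => [_|xOm]; last first.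
    by rewrite !mulr0 !mul0r mulr0 addr0 !mulr_ge0 ?weighted_sum_ge0.
  rewrite !mulr1.
  set r := Num.sqrt (f x); have r0 : 0 <= r by exact: sqrtr_ge0.
  have fr : f x = r ^+ 2 by rewrite sqr_sqrtr ?weighted_sum_ge0.
  have ur : u x = 24^-1 * r by [].
  rewrite [leLHS](_ : _ = mass x * (phi x * (144 * (5 + u x) * (u x + 1)))); last by ring.
  rewrite [leRHS](_ : _ = mass x * (phi x * (3 / 4 * f x) + 45 ^+ 2 * expR 4)); last by ring.
  rewrite ler_wpM2l //.
  case: (leP r 90) => hr.
    have p4 : phi x <= expR 4 by rewrite ler_expR ur; lra.
    have key : 144 * (5 + u x) * (u x + 1) <= 3 / 4 * f x + 45 ^+ 2.
      by rewrite fr ur; have := sqr_ge0 (r - 72); nra.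
    apply: le_trans (ler_wpM2l (phi_ge0 x) key) _.
    by rewrite mulrDr lerD2l mulrC ler_wpM2l // exprn_ge0.
  apply: (@le_trans _ _ (phi x * (3 / 4 * f x))); last first.
    by rewrite lerDl mulr_ge0 ?expR_ge0 // exprn_ge0.
  by rewrite ler_wpM2l // fr ur; nra.
rewrite /exp_const; lra.
Qed.

(** The leading term of cosh y - 1 <= (y^2 / 2) e^y gives b^2 f / 2, and [carleson_exp] pays for the
    error: b <= 1/48 uses only half of the rate 1/24, and the other half dominates the extra factor
    sqrt f. *)
Lemma carleson_cosh (b : R) : 0 <= b -> b <= 48^-1 ->
  \sum_x mass x * (coshr (b * Num.sqrt (f x)) - 1) <=
  b ^+ 2 / 2 * (\sum_i a i * vol (rect i) + 48 * b * (exp_const * vol Om)).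
Proof.
move=> b0 b1.
have -> : \sum_i a i * vol (rect i) = \sum_x mass x * (f x * 1).
  rewrite sum_weighted; apply: eq_bigr => i _; congr (_ * _).
  by apply: eq_bigr => x _; rewrite mulr1.
have b48 : 0 <= 48 * b by rewrite mulr_ge0.
apply: (@le_trans _ _ (b ^+ 2 / 2 * (\sum_x mass x * (f x * 1) +
    48 * b * \sum_x mass x * (f x * phi x)))); last first.
  rewrite ler_wpM2l ?divr_ge0 ?exprn_ge0 // lerD2l ler_wpM2l //.
  exact: carleson_exp.
rewrite mulr_sumr -big_split mulr_sumr /=; apply: ler_sum => x _.
rewrite [leRHS](_ : _ = mass x * (b ^+ 2 / 2 * f x * (1 + 48 * b * phi x))); last by ring.
rewrite ler_wpM2l //.
set r := Num.sqrt (f x); have r0 : 0 <= r by exact: sqrtr_ge0.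
have fr : f x = r ^+ 2 by rewrite sqr_sqrtr ?weighted_sum_ge0.
have br : 0 <= b * r by rewrite mulr_ge0.
apply: le_trans (coshr_le_quadratic br) _.
rewrite exprMn fr [b ^+ 2 * r ^+ 2 / 2]mulrAC ler_wpM2l //.
  by rewrite mulr_ge0 ?divr_ge0 ?exprn_ge0.
(* e^v <= 1 + v e^v with v = b r, and r <= 48 e^(r/48). *)
have h1 : expR (b * r) <= 1 + b * r * expR (b * r).
  have := expR_ge1Dx (- (b * r)); rewrite -(ler_pM2l (expR_gt0 (b * r))) expRxMexpNx_1; lra.
have h2 : b * r * expR (b * r) <= 48 * b * phi x.
  have -> : phi x = expR (48^-1 * r) * expR (48^-1 * r).
    by rewrite -expRD /phi /u -/r; congr expR; lra.
  have e1 : expR (b * r) <= expR (48^-1 * r) by rewrite ler_expR ler_wpM2r.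
  have e2 : r <= 48 * expR (48^-1 * r) by have := le_expR (48^-1 * r); lra.
  apply: (@le_trans _ _ (b * (48 * expR (48^-1 * r)) * expR (48^-1 * r))); last by lra.
  by apply: ler_pM; rewrite ?expR_ge0 // ler_wpM2l.
lra.
Qed.

End carleson_exponential.

Lemma measure_fintype_bigcup (d : measure_display) (T : measurableType d) (R : realType)
    (mu : {measure set T -> \bar R}) (S : finType) (P : pred S) (F : S -> set T) :
  (forall s, measurable (F s)) -> trivIset [set: S]%classic F ->
  (mu (\bigcup_(s in [set s | P s]) F s)%classic = \sum_(s | P s) mu (F s))%E.
Proof.
move=> mF tF; pose r := [seq s <- index_enum S | P s].
rewrite -[RHS]big_filter -/r (_ : [set s | P s] = [set` r])%classic; last first.
  by apply/seteqP; split=> s /=; rewrite mem_filter mem_index_enum andbT.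
rewrite measure_fin_bigcup //; last exact: sub_trivIset tF.
by rewrite -fsbig_seq // filter_uniq // index_enum_uniq.
Qed.

(** * Rectangles as products of signatures *)

Section grid_signatures.
Context (R : realType) (d : nat) (J : finType) (C : J -> cube R d).
Local Open Scope classical_set_scope.
Local Notation T := (d.-tuple (measurableTypeR R)).

Lemma side_gt0 (Q : cube R d) : 0 < side Q.
Proof. by rewrite /side exprz_gt0. Qed.

Lemma measurable_cube (Q : cube R d) : measurable (cube_set Q).
Proof.
rewrite (_ : cube_set Q = \bigcap_(j in [set: 'I_d])
    ((fun x : T => tnth x j) @^-1` `[tnth Q.2 j, tnth Q.2 j + side Q[%classic)).
  apply: fin_bigcap_measurable => //.
  move=> j _; by rewrite -[X in measurable X]setTI; apply: measurable_tnth.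
apply/seteqP; split=> x /=.
  by move=> h j _ /=; rewrite in_itv /=; exact: h.
by move=> h j; have := h j Logic.I; rewrite /= in_itv.
Qed.

Lemma cube_measure (Q : cube R d) : lebesgue_tuple (cube_set Q) = (side Q ^+ d)%:E.
Proof. by rewrite -(lebesgue_tuple_box Q.2 (ltW (side_gt0 Q))). Qed.

Lemma cube_nonempty (Q : cube R d) : cube_set Q Q.2.
Proof. by move=> j; rewrite lexx ltrDl side_gt0. Qed.

Definition signature (x : T) : {set J} := [set j | `[< cube_set (C j) x >]]%SET.

Definition atom (s : {set J}) : set T := [set x | signature x = s].

(* The atom of the empty signature has infinite measure; it gets weight 0 *)
Definition weight (s : {set J}) : R :=
  if s == finset.set0 then 0 else fine (lebesgue_tuple (atom s)).

(* Only realized signatures are kept, so that inclusion and disjointness of cubes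
   pass to cells. *)
Definition cell (j : J) : {set {set J}} :=
  [set s : {set J} | (j \in s) && `[< exists x, signature x = s >]]%SET.

Lemma in_signature x j : (j \in signature x) = `[< cube_set (C j) x >].
Proof. by rewrite inE. Qed.

Lemma signature_cell x j : (signature x \in cell j) = `[< cube_set (C j) x >].
Proof.
rewrite inE in_signature; apply/andP/idP => [[]//|h]; split=> //.
by apply/asboolP; exists x.
Qed.

Lemma measurable_atom s : measurable (atom s).
Proof.
rewrite (_ : atom s = \bigcap_(j in [set: J])
    (if j \in s then cube_set (C j) else ~` cube_set (C j))).
  apply: fin_bigcap_measurable => //.
  move=> j _; case: ifP => _; first exact: measurable_cube.
  by apply: measurableC; exact: measurable_cube.
apply/seteqP; split=> x /=.
  move=> <- j _; rewrite in_signature.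
  by case: asboolP.
move=> h; apply/setP => j; have := h j Logic.I; rewrite in_signature.
by case: (j \in s) => /= hj; [exact/asboolP|exact/asboolPn].
Qed.

Lemma weight_ge0 s : 0 <= weight s.
Proof. by rewrite /weight; case: ifP => // _; rewrite fine_ge0. Qed.

Lemma weightE s : s != finset.set0 -> (weight s)%:E = lebesgue_tuple (atom s).
Proof.
move=> s0; rewrite /weight (negbTE s0) fineK //.
have [j js] := finset.set0Pn _ s0.
rewrite ge0_fin_numE ?measure_ge0 //.
apply: (@le_lt_trans _ _ (lebesgue_tuple (cube_set (C j)))).
  apply: le_measure; rewrite ?inE; [exact: measurable_atom|exact: measurable_cube|].
  by move=> x /= xs; move: js; rewrite -xs in_signature => /asboolP.
by rewrite cube_measure ltry.
Qed.

Lemma cell_sub i j : cube_set (C i) `<=` cube_set (C j) -> cell i \subset cell j.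
Proof.
move=> ij; apply/fintype.subsetP => s; rewrite !inE => /andP[+ /asboolP[x xs]].
rewrite -xs !in_signature => /asboolP/ij h; apply/andP; split; first exact/asboolP.
by apply/asboolP; exists x.
Qed.

Lemma cell_disjoint i j : cube_set (C i) `&` cube_set (C j) = set0 ->
  [disjoint cell i & cell j]%B.
Proof.
move=> ij; apply/pred0P => s /=; apply/negbTE/negP; rewrite !inE.
move=> /andP[/andP[+ /asboolP[x xs]] /andP[+ _]]; rewrite -xs !in_signature.
move=> /asboolP xi /asboolP xj; have : set0 x by rewrite -ij.
by [].
Qed.

Lemma cell_laminar (D : set (cube R d)) i j : dyadic_grid D -> D (C i) -> D (C j) ->
  (C i).1 <= (C j).1 -> (cell i \subset cell j) || [disjoint cell i & cell j]%B.
Proof.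
move=> [_ h] Di Dj /(h _ _ Di Dj)[/cell_sub ->//|/cell_disjoint ->].
by rewrite orbT.
Qed.

Lemma sum_cell j : \sum_(s in cell j) weight s = side (C j) ^+ d.
Proof.
apply: EFin_inj; rewrite -cube_measure -sumEFin.
rewrite (eq_bigr (fun s => lebesgue_tuple (atom s))); last first.
  move=> s; rewrite inE => /andP[js _]; apply: weightE.
  by apply/finset.set0Pn; exists j.
rewrite -(@measure_fintype_bigcup _ _ _ (@lebesgue_tuple R d) _ (mem (cell j))); last 2 first.
- by move=> s; exact: measurable_atom.
- by move=> s t _ _ [x [/= <- <-]].
congr lebesgue_tuple; apply/seteqP; split=> x /=.
  by move=> [s /= + xs]; rewrite -xs signature_cell => /asboolP.
move=> xj; exists (signature x) => //=.
by rewrite signature_cell; exact/asboolP.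
Qed.

End grid_signatures.

Section scene.
Context (R : realType) (d1 d2 d3 : nat) (J1 J2 J3 : finType).
Context (C1 : J1 -> cube R d1) (C2 : J2 -> cube R d2) (C3 : J3 -> cube R d3).
Local Open Scope classical_set_scope.
Local Open Scope ereal_scope.
Local Notation Z := (zspace R d1 d2 d3).
Local Notation mu := (@zlebesgue R d1 d2 d3).
Local Notation X := ({set J1} * {set J2} * {set J3})%type.
Local Notation mass := (product_mass (weight C1) (weight C2) (weight C3)).

Lemma box_measure A B C : measurable A -> measurable B -> measurable C ->
  measurable (A `*` B `*` C : set Z) /\
  mu (A `*` B `*` C) = @lebesgue_tuple R d1 A * @lebesgue_tuple R d2 B * @lebesgue_tuple R d3 C.
Proof.
move=> mA mB mC.
have mABC : measurable (A `*` B `*` C) by apply: measurableX => //; apply: measurableX.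
split; first by apply: sub_caratheodory; apply: sub_sigma_algebra; exact: mABC.
rewrite /zlebesgue /completed_measure_extension /= measurable_mu_extE //=.
rewrite /borel_lebesgue product_measure1E //; last by apply: measurableX.
by congr (_ * _); exact: product_measure1E.
Qed.

Lemma rect_measure (I : zrect R d1 d2 d3) : measurable (rect_set I) /\
  mu (rect_set I) = (side I.1.1 ^+ d1 * side I.1.2 ^+ d2 * side I.2 ^+ d3)%:E.
Proof.
have [m e] := box_measure (measurable_cube I.1.1) (measurable_cube I.1.2) (measurable_cube I.2).
by split=> //; rewrite e !cube_measure.
Qed.

Definition scene_signature (x : Z) : X :=
  (signature C1 x.1.1, signature C2 x.1.2, signature C3 x.2).

(** An empty signature in some factor gets weight 0 although its box may have infinite measure.
    Masses are measures only on full signatures, so integrands and sets are required to vanish on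
    the others. *)
Definition full (s : X) :=
  [&& s.1.1 != finset.set0, s.1.2 != finset.set0 & s.2 != finset.set0].

Definition box (s : X) : set Z := [set x | scene_signature x = s].

Lemma boxE s : box s = atom C1 s.1.1 `*` atom C2 s.1.2 `*` atom C3 s.2.
Proof.
apply/seteqP; split=> x /=; rewrite /box /= /scene_signature; first by move=> <-.
by case: s => [[s1 s2] s3] /= [[-> ->] ->].
Qed.

Lemma measurable_box s : measurable (box s).
Proof.
by rewrite boxE; have [] := box_measure (measurable_atom C1 s.1.1)
  (measurable_atom C2 s.1.2) (measurable_atom C3 s.2).
Qed.

Lemma mass_full s : full s -> (mass s)%:E = mu (box s).
Proof.
move=> /and3P[s1 s2 s3]; rewrite boxE.
have [_ ->] := box_measure (measurable_atom C1 s.1.1)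
  (measurable_atom C2 s.1.2) (measurable_atom C3 s.2).
by rewrite /product_mass !EFinM !weightE.
Qed.

Lemma mass_not_full s : ~~ full s -> mass s = 0%R.
Proof.
rewrite /full !negb_and !negbK /product_mass /weight => /or3P[]/eqP ->;
  by rewrite eqxx ?mul0r ?mulr0 ?mul0r.
Qed.

Lemma trivIset_box : trivIset [set: X] box.
Proof. by move=> s t _ _ [x [/= <- <-]]. Qed.

Lemma scene_integral (g : X -> R) : (forall s, 0 <= g s)%R ->
  (forall s, ~~ full s -> g s = 0%R) ->
  \int[mu]_x (g (scene_signature x))%:E = (\sum_s mass s * g s)%R%:E.
Proof.
move=> g0 gfull.
transitivity (\int[mu]_x \sum_(s : X) (g s * \1_(box s) x)%:E).
  apply: eq_integral => x _; rewrite (bigD1 (scene_signature x)) //= big1 ?adde0.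
    by rewrite indicE mem_set // mulr1.
  move=> s sx; rewrite indicE memNset ?mulr0 // => /= e.
  by rewrite -e eqxx in sx.
have mg s : measurable_fun setT (fun x : Z => \1_(box s) x : R).
  by apply: measurable_indic; exact: measurable_box.
rewrite ge0_integral_sum; first last.
- by move=> s x _; rewrite lee_fin mulr_ge0.
- by move=> s; apply/measurable_EFinP; apply: measurable_funM; [exact: measurable_cst|exact: mg].
- exact: measurableT.
rewrite -sumEFin; apply: eq_bigr => s _.
under eq_integral do rewrite EFinM.
rewrite ge0_integralZl_EFin; first last.
- exact: g0.
- by apply/measurable_EFinP; exact: mg.
- by move=> x _; rewrite lee_fin.
- exact: measurableT.
rewrite integral_indic ?setIT //; last exact: measurable_box.
case: (boolP (full s)) => fs; first by rewrite EFinM mass_full // muleC.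
by rewrite gfull // mul0e mulr0.
Qed.

Lemma scene_measure (P : pred X) : (forall s, ~~ full s -> ~~ P s) ->
  measurable [set x : Z | P (scene_signature x)] /\
  mu [set x | P (scene_signature x)] = (\sum_(s | P s) mass s)%:E.
Proof.
move=> Pfull.
have E : [set x : Z | P (scene_signature x)] = \bigcup_(s in [set s | P s]) box s.
  apply/seteqP; split=> x /=; first by move=> Px; exists (scene_signature x).
  by move=> [s /= Ps ->].
split; first by rewrite E; apply: fin_bigcup_measurable => // s _; exact: measurable_box.
rewrite E measure_fintype_bigcup; [|exact: measurable_box|exact: trivIset_box].
rewrite -sumEFin; apply: eq_bigr => s Ps; rewrite mass_full //.
by apply: contraT => /Pfull; rewrite Ps.
Qed.

End scene.

Section grids.
Context (R : realType) (d : nat) (D : set (cube R d)).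
Local Open Scope classical_set_scope.

Lemma grid_nested (P Q : cube R d) x : dyadic_grid D -> D P -> D Q -> P.1 <= Q.1 ->
  cube_set P x -> cube_set Q x -> cube_set P `<=` cube_set Q.
Proof.
move=> [_ h] DP DQ PQ xP xQ; have [//|e] := h P Q DP DQ PQ.
by have : set0 x by rewrite -e.
Qed.

Lemma le_side (P Q : cube R d) : (side P <= side Q) = (P.1 <= Q.1).
Proof. by rewrite /side ler_eXz2l // ltr1n. Qed.

End grids.

(** * Transfer to finite families of Zygmund rectangles *)

Section families.
Context (R : realType) (d1 d2 d3 : nat).
Context (D1 : set (cube R d1)) (D2 : set (cube R d2)) (D3 : set (cube R d3)).
Context (gD1 : dyadic_grid D1) (gD2 : dyadic_grid D2) (gD3 : dyadic_grid D3).
Local Open Scope classical_set_scope.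
Local Open Scope ereal_scope.
Local Notation Z := (zspace R d1 d2 d3).
Local Notation mu := (@zlebesgue R d1 d2 d3).

Lemma zygmund_level I : zygmund_rects D1 D2 D3 I -> I.2.1 = (I.1.1.1 + I.1.2.1)%R.
Proof.
move=> [_ _ _]; rewrite /side -expfzDr ?pnatr_eq0 // => e.
apply/eqP; have : ((2 : R) ^ I.2.1 == 2 ^ (I.1.1.1 + I.1.2.1))%R by rewrite e.
by rewrite eq_le !ler_eXz2l ?ltr1n // -eq_le.
Qed.

(** If the first two levels were ordered in the same way, so would be their sum, the third level;
    sides through a common point would then all be nested, against incomparability. *)
Lemma zygmund_antichain (U : set (zrect R d1 d2 d3)) (I J : zrect R d1 d2 d3) x :
  U `<=` zygmund_rects D1 D2 D3 ->
  (forall I J, U I -> U J -> rect_set I `<=` rect_set J -> I = J) ->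
  U I -> U J -> I != J -> rect_set I x -> rect_set J x ->
  ~~ ((I.1.1.1 <= J.1.1.1)%R && (I.1.2.1 <= J.1.2.1)%R).
Proof.
move=> Uz anti UI UJ IJ [[x1 x2] x3] [[y1 y2] y3].
apply: contra IJ => /andP[l1 l2]; apply/eqP; apply: anti => //.
have [a1 a2 a3 _] := Uz _ UI; have [b1 b2 b3 _] := Uz _ UJ.
have l3 : (I.2.1 <= J.2.1)%R.
  by rewrite (zygmund_level (Uz _ UI)) (zygmund_level (Uz _ UJ)) lerD.
have s1 := grid_nested gD1 a1 b1 l1 x1 y1.
have s2 := grid_nested gD2 a2 b2 l2 x2 y2.
have s3 := grid_nested gD3 a3 b3 l3 x3 y3.
by move=> z [[z1 z2] z3]; split; [split|]; [exact: s1|exact: s2|exact: s3].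
Qed.

Section scene_of_family.
Context (I J1 J2 J3 : finType) (r : I -> zrect R d1 d2 d3).
Context (C1 : J1 -> cube R d1) (C2 : J2 -> cube R d2) (C3 : J3 -> cube R d3).
Context (k1 : I -> J1) (k2 : I -> J2) (k3 : I -> J3).
Context (k1E : forall i, C1 (k1 i) = (r i).1.1) (k2E : forall i, C2 (k2 i) = (r i).1.2)
  (k3E : forall i, C3 (k3 i) = (r i).2).
Local Notation A := (fun i => cell C1 (k1 i)).
Local Notation B := (fun i => cell C2 (k2 i)).
Local Notation T := (fun i => cell C3 (k3 i)).
Local Notation rect := (product_rect A B T).
Local Notation union := (rect_union A B T).
Local Notation vol := (volume (weight C1) (weight C2) (weight C3)).
Local Notation sg := (scene_signature C1 C2 C3).

(** Cubes are indexed by J1, J2, J3 and reached through k1, k2, k3 rather than indexed by I itself,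
    so that the ancestors of the sides can join the same scene. *)
Lemma signature_rect x i : (sg x \in rect i) = `[< rect_set (r i) x >].
Proof.
rewrite inE !signature_cell k1E k2E k3E; apply/idP/asboolP.
  by move=> /and3P[/asboolP a /asboolP b /asboolP c].
by move=> [[a b] c]; apply/and3P; split; exact/asboolP.
Qed.

Lemma cell_neq0 (d : nat) (J : finType) (C : J -> cube R d) j s :
  s \in cell C j -> s != finset.set0.
Proof. by rewrite inE => /andP[js _]; apply/finset.set0Pn; exists j. Qed.

Lemma rect_full i s : s \in rect i -> full s.
Proof.
by rewrite inE => /and3P[a b c]; apply/and3P; split; [exact: cell_neq0 a|exact: cell_neq0 b|exact: cell_neq0 c].
Qed.

Lemma union_full (s : {set I}) x : x \in union s -> full x.
Proof. by move=> /finset.bigcupP[i _ /rect_full]. Qed.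

Lemma signature_union (s : {set I}) x :
  (sg x \in union s) = `[< (\bigcup_(i in [set` s]) rect_set (r i)) x >].
Proof.
apply/finset.bigcupP/asboolP => -[i si].
  by rewrite signature_rect => /asboolP xi; exists i.
by move=> xi; exists i => //; rewrite signature_rect; exact/asboolP.
Qed.

Lemma volume_unionE (s : {set I}) :
  (vol (union s))%:E = mu (\bigcup_(i in [set` s]) rect_set (r i)).
Proof.
have [] := @scene_measure R d1 d2 d3 J1 J2 J3 C1 C2 C3 (mem (union s)).
  by move=> x; apply: contra => /union_full.
move=> _ <-; congr (zlebesgue _); apply/seteqP; split=> x /=.
  by rewrite signature_union => /asboolP.
by move=> h; rewrite signature_union; exact/asboolP.
Qed.

Lemma volume_rectE i : (vol (rect i))%:E = mu (rect_set (r i)).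
Proof.
have [] := @scene_measure R d1 d2 d3 J1 J2 J3 C1 C2 C3 (mem (rect i)).
  by move=> x; apply: contra => /rect_full.
move=> _ <-; congr (zlebesgue _); apply/seteqP; split=> x /=.
  by rewrite signature_rect => /asboolP.
by move=> h; rewrite signature_rect; exact/asboolP.
Qed.

(** Cells keep only realized signatures, so a common cell comes from a common point; this carries
    incomparability over to the finite model. *)
Lemma rect_signature i j s : s \in rect i -> s \in rect j ->
  exists x, rect_set (r i) x /\ rect_set (r j) x.
Proof.
case: s => [[s1 s2] s3]; rewrite !inE /=.
move=> /and3P[/andP[a1 /asboolP[x1 e1]] /andP[a2 /asboolP[x2 e2]] /andP[a3 /asboolP[x3 e3]]].
move=> /and3P[/andP[b1 _] /andP[b2 _] /andP[b3 _]].
exists (x1, x2, x3); move: a1 a2 a3 b1 b2 b3; rewrite -e1 -e2 -e3 !in_signature.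
rewrite !k1E !k2E !k3E => /asboolP ? /asboolP ? /asboolP ? /asboolP ? /asboolP ? /asboolP ?.
by [].
Qed.

End scene_of_family.

Context (U : set (zrect R d1 d2 d3)) (Uz : U `<=` zygmund_rects D1 D2 D3).
Context (antiU : forall I J, U I -> U J -> rect_set I `<=` rect_set J -> I = J).

Section finite_subfamily.
Context (I : finType) (r : I -> zrect R d1 d2 d3) (r_inj : injective r).
Context (rU : forall i, U (r i)).

Let C1 i := (r i).1.1.
Let C2 i := (r i).1.2.
Let C3 i := (r i).2.
Let m i := (r i).1.1.1.
Let n i := (r i).1.2.1.
Let W1 := weight C1.
Let W2 := weight C2.
Let W3 := weight C3.
Let sg := scene_signature C1 C2 C3.

Let lamA i j : (m i <= m j)%R ->
  (cell C1 i \subset cell C1 j) || [disjoint cell C1 i & cell C1 j]%B.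
Proof. by have [? _ _ _] := Uz (rU i); have [? _ _ _] := Uz (rU j); exact: (cell_laminar gD1). Qed.

Let lamB i j : (n i <= n j)%R ->
  (cell C2 i \subset cell C2 j) || [disjoint cell C2 i & cell C2 j]%B.
Proof. by have [_ ? _ _] := Uz (rU i); have [_ ? _ _] := Uz (rU j); exact: (cell_laminar gD2). Qed.

Let lamT i j : (m i + n i <= m j + n j)%R ->
  (cell C3 i \subset cell C3 j) || [disjoint cell C3 i & cell C3 j]%B.
Proof.
move=> h; have [_ _ ri _] := Uz (rU i); have [_ _ rj _] := Uz (rU j).
apply: (cell_laminar gD3) => //.
by rewrite /C3 (zygmund_level (Uz (rU i))) (zygmund_level (Uz (rU j))).
Qed.

Let incomp i j x : i != j -> x \in product_rect (cell C1) (cell C2) (cell C3) i ->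
  x \in product_rect (cell C1) (cell C2) (cell C3) j -> ~~ ((m i <= m j) && (n i <= n j))%R.
Proof.
move=> ij xi xj.
have [z [zi zj]] := @rect_signature I I I I r C1 C2 C3 id id id (fun=> erefl) (fun=> erefl)
  (fun=> erefl) i j x xi xj.
by apply: (zygmund_antichain Uz antiU (rU i) (rU j) _ zi zj); rewrite (inj_eq r_inj).
Qed.

Let volE s : (volume W1 W2 W3 (rect_union (cell C1) (cell C2) (cell C3) s))%:E =
  mu (\bigcup_(i in [set` s]) rect_set (r i)).
Proof. exact: (@volume_unionE I I I I r C1 C2 C3 id id id). Qed.

Let vrE i : (volume W1 W2 W3 (product_rect (cell C1) (cell C2) (cell C3) i))%:E =
  mu (rect_set (r i)).
Proof. exact: (@volume_rectE I I I I r C1 C2 C3 id id id). Qed.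

Lemma family_cosh_le (a : I -> R) (b : R) : (forall i, 0 <= a i)%R ->
  (forall s : {set I}, \sum_(i in s) (a i)%:E * mu (rect_set (r i)) <=
     mu (\bigcup_(i in [set` s]) rect_set (r i))) ->
  (0 <= b)%R -> (b <= 48^-1)%R ->
  \int[mu]_x (coshr (b * Num.sqrt (\sum_i a i * \1_(rect_set (r i)) x)) - 1)%:E <=
  (b ^+ 2 / 2)%:E * (\sum_i (a i)%:E * mu (rect_set (r i)) +
    (48 * b * exp_const R)%:E * mu (\bigcup_i rect_set (r i))).
Proof.
move=> a0 carl b0 b1.
pose f := weighted_sum (cell C1) (cell C2) (cell C3) a.
have carl' (s : {set I}) : (\sum_(i in s) a i * volume W1 W2 W3 (product_rect (cell C1) (cell C2) (cell C3) i) <=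
    volume W1 W2 W3 (rect_union (cell C1) (cell C2) (cell C3) s))%R.
  rewrite -lee_fin volE -sumEFin; apply: le_trans (carl s).
  by rewrite le_eqVlt; apply/orP; left; apply/eqP; apply: eq_bigr => i _; rewrite EFinM vrE.
have := @carleson_cosh R _ _ _ I W1 W2 W3 (@weight_ge0 _ _ _ _) (@weight_ge0 _ _ _ _)
  (@weight_ge0 _ _ _ _) _ _ _ m n lamA lamB lamT incomp a a0 carl' b b0 b1.
rewrite -lee_fin; congr (_ <= _).
  rewrite -(@scene_integral R d1 d2 d3 I I I C1 C2 C3 (fun s => coshr (b * Num.sqrt (f s)) - 1)%R).
  - apply: eq_integral => x _; congr (coshr (b * Num.sqrt _) - 1)%:E.
    rewrite /f /weighted_sum big_mkcond; apply: eq_bigr => i _.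
    rewrite (@signature_rect I I I I r C1 C2 C3 id id id) // indicE.
    case: asboolP => xi; first by rewrite mem_set // mulr1.
    by rewrite memNset // mulr0.
  - by move=> s; rewrite subr_ge0 coshr_ge1.
  - move=> s fs; rewrite /f weighted_sum_out; last first.
      by apply: contra fs => /union_full.
    by rewrite sqrtr0 mulr0 /coshr oppr0 expR0 (_ : 1 + 1 = 2)%R // divff ?subrr.
rewrite EFinM EFinD -sumEFin; congr (_ * (_ + _)).
  by apply: eq_bigr => i _; rewrite EFinM vrE.
rewrite mulrA EFinM volE; congr (_ * zlebesgue _).
by apply/seteqP; split=> x [i _ xi]; exists i => //=; rewrite inE.
Qed.

Lemma family_sparse : exists (g : {set I}) (E : I -> set Z),
  [/\ forall i, i \in g -> [/\ measurable (E i), E i `<=` rect_set (r i) &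
        (8^-1)%:E * mu (rect_set (r i)) <= mu (E i)],
      trivIset [set` g] E
    & 5%:E * mu (\bigcup_i rect_set (r i)) <=
      21%:E * mu (\bigcup_(i in [set` g]) rect_set (r i))].
Proof.
have [g [E [Esub Edis vg]]] := sparse_selection (@weight_ge0 _ _ _ C1) (@weight_ge0 _ _ _ C2)
  (@weight_ge0 _ _ _ C3) lamA lamB lamT incomp.
(* The conjunct [i \in g] empties [F i] where nothing is known about [E i], so that only full
   signatures occur. *)
pose F i : set Z := [set x | (sg x \in E i) && (i \in g)].
have mF i : measurable (F i) /\ mu (F i) = (\sum_(s | (s \in E i) && (i \in g)) product_mass W1 W2 W3 s)%:E.
  apply: (@scene_measure R d1 d2 d3 I I I C1 C2 C3 (fun s => (s \in E i) && (i \in g))).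
  move=> s; apply: contra => /andP[sE ig].
  by have [/fintype.subsetP/(_ s sE)/rect_full] := Esub i ig.
exists g, F; split.
- move=> i ig; have [sub le8] := Esub i ig; split; first by case: (mF i).
    move=> x /= /andP[xE _]; have := fintype.subsetP sub _ xE.
    by rewrite (@signature_rect I I I I r C1 C2 C3 id id id) // => /asboolP.
  have -> : mu (F i) = (volume W1 W2 W3 (E i))%:E.
    have [_ ->] := mF i; rewrite /volume; congr (_%:E); apply: eq_bigl => s.
    by rewrite ig andbT.
  rewrite -vrE -EFinM lee_fin; move: le8.
  set v := volume _ _ _ (product_rect _ _ _ i); set e := volume _ _ _ (E i); lra.
- move=> i j /= ig jg [x [/= /andP[xi _] /andP[xj _]]].
  apply/eqP; apply: contraT => ij; have /pred0P/(_ (sg x)) := Edis i j ig jg ij.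
  by rewrite /= xi xj.
- move: vg; rewrite -lee_fin !EFinM !volE; congr (_ * zlebesgue _ <= _).
  by apply/seteqP; split=> x [i _ xi]; exists i => //=; rewrite inE.
Qed.

End finite_subfamily.
End families.

(** * The enlargement *)

Section countability.
Local Open Scope classical_set_scope.

(** A partial enumeration, defined on [B], is available for finite and empty sets as well and stays
    injective, so that sums over S become series. *)
Lemma countable_enumeration (T : choiceType) (x0 : T) (S : set T) : countable S ->
  exists (f : nat -> T) (B : pred nat), [/\ forall n, B n -> S (f n),
    forall t, S t -> exists2 n, B n & f n = t & {in B &, injective f}].
Proof.
move=> /countable_injP[g ginj].
pose P n : set T := [set t | S t /\ g t = n].
pose f n := xget x0 (P n).
have fP n t : P n t -> P n (f n) by exact: xgetI.
exists f, (fun n => `[< exists t, P n t >]); split.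
- by move=> n /asboolP[t /fP[]].
- move=> t St; have Pt : P (g t) t by [].
  exists (g t); first by apply/asboolP; exists t.
  by have [Sf gf] := fP _ _ Pt; apply: ginj; rewrite ?inE.
- move=> k l; rewrite !unfold_in => /asboolP[t /fP[_ gk]] /asboolP[u /fP[_ gl]] e.
  by rewrite -gk -gl e.
Qed.

(** A cube is determined by its level and the integer parts of its corner divided by its side: two
    cubes with the same data have corners less than a side apart in each coordinate, so they meet,
    and meeting cubes of equal level in a grid coincide. *)
Lemma countable_grid (R : realType) (d : nat) (D : set (cube R d)) :
  dyadic_grid D -> countable D.
Proof.
move=> gD; apply/countable_injP.
pose code (Q : cube R d) : int * d.-tuple int :=
  (Q.1, [tuple Num.floor (tnth Q.2 j / side Q) | j < d]).
exists (pickle \o code) => P Q; rewrite !inE => DP DQ /= /(pcan_inj pickleK) e.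
have e1 : P.1 = Q.1 by have := congr1 fst e.
have sd : side P = side Q by rewrite /side e1.
have close j : `|tnth P.2 j - tnth Q.2 j| < side P.
  have s0 := side_gt0 P.
  have : Num.floor (tnth P.2 j / side P) = Num.floor (tnth Q.2 j / side P).
    by have := congr1 (fun c => tnth c.2 j) e; rewrite /= !tnth_mktuple -sd.
  have /andP[] := floor_itv (tnth P.2 j / side P).
  have /andP[] := floor_itv (tnth Q.2 j / side P).
  move=> a1 a2 b1 b2 ef; rewrite ef in b1 b2.
  have : `|tnth P.2 j / side P - tnth Q.2 j / side P| < 1.
    by rewrite ltr_norml; move: a1 a2 b1 b2; rewrite !rmorphD /= => a1 a2 b1 b2; lra.
  by rewrite -mulrBl normrM (gtr0_norm (x := (side P)^-1)) ?invr_gt0 // ltr_pdivrMr // mul1r.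
pose x : d.-tuple (measurableTypeR R) :=
  [tuple Num.max (tnth P.2 j) (tnth Q.2 j) | j < d].
have xP : cube_set P x.
  move=> j; rewrite tnth_mktuple; have := close j; rewrite ltr_norml => /andP[h1 h2].
  by rewrite le_max lexx /= gt_max; apply/andP; split; lra.
have xQ : cube_set Q x.
  move=> j; rewrite tnth_mktuple; have := close j; rewrite ltr_norml => /andP[h1 h2].
  by rewrite le_max lexx orbT /= gt_max -sd; apply/andP; split; lra.
have PQ : cube_set P `<=` cube_set Q by apply: (grid_nested gD DP DQ _ xP xQ); rewrite e1.
have QP : cube_set Q `<=` cube_set P by apply: (grid_nested gD DQ DP _ xQ xP); rewrite e1.
have : P.2 = Q.2.
  apply: eq_from_tnth => j; apply/eqP; rewrite eq_le.
  have /(_ j)/andP[-> _] := QP _ (cube_nonempty Q).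
  by have /(_ j)/andP[-> _] := PQ _ (cube_nonempty P).
by case: (P) (Q) e1 => [p1 p2] [q1 q2] /= -> ->.
Qed.

Lemma max_nat_ge (K : set nat) k : K k -> (exists M, forall j, K j -> (j <= M)%N) ->
  (k <= max_nat K)%N.
Proof.
move=> Kk [M hM]; rewrite /max_nat.
have ex : exists j, `[< K j >] by exists k; exact/asboolP.
have ub j : `[< K j >] -> (j <= M)%N by move=> /asboolP/hM.
case: (ex_maxnP ex ub) => i /asboolP Ki imax.
pose P := [set k | K k /\ forall j, K j -> (j <= k)%N].
have /(xgetPex 0%N)[_ h] : exists y, P y; last exact: h.
by exists i; split=> // j Kj; apply/imax/asboolP.
Qed.

End countability.

Section enlargement.
Context (R : realType) (d1 d2 d3 : nat).
Context (D1 : set (cube R d1)) (D2 : set (cube R d2)) (D3 : set (cube R d3)).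
Context (gD1 : dyadic_grid D1) (gD2 : dyadic_grid D2) (gD3 : dyadic_grid D3).
Local Open Scope classical_set_scope.
Local Open Scope ereal_scope.
Local Notation Z := (zspace R d1 d2 d3).
Local Notation mu := (@zlebesgue R d1 d2 d3).
Context (Om : set Z) (mOm : measurable Om) (Omfin : mu Om < +oo).

(** [Om] need not be a union of boxes, so it is replaced by its relative density f on each box;
    [strong_maximal] sees only sums over boxes. A null box causes no error, since there both o and
    the mass vanish. *)
Lemma family_maximal (I : finType) (r : I -> zrect R d1 d2 d3) :
  (forall i, [/\ D1 (r i).1.1, D2 (r i).1.2 & D3 (r i).2]) ->
  (forall i, mu (rect_set (r i)) <= 2%:E * mu (Om `&` rect_set (r i))) ->
  mu (\bigcup_i rect_set (r i)) <= 256%:E * mu Om.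
Proof.
move=> rD half.
pose C1 i := (r i).1.1; pose C2 i := (r i).1.2; pose C3 i := (r i).2.
pose mass := product_mass (weight C1) (weight C2) (weight C3).
have w0 (d : nat) (C : I -> cube R d) s : (0 <= weight C s)%R by exact: weight_ge0.
have mb s : measurable (Om `&` box C1 C2 C3 s) by apply: measurableI => //; exact: measurable_box.
pose o s := fine (mu (Om `&` box C1 C2 C3 s)).
have oE s : (o s)%:E = mu (Om `&` box C1 C2 C3 s).
  rewrite fineK // ge0_fin_numE ?measure_ge0 //; apply: le_lt_trans Omfin.
  by apply: le_measure; rewrite ?inE //; exact: subIsetl.
have o0 s : (0 <= o s)%R by rewrite fine_ge0.
pose f s := (o s / mass s)%R.
have m0 s : (0 <= mass s)%R by rewrite /mass; exact: mass_ge0.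
have om s : full s -> (o s <= mass s)%R.
  move=> fs; rewrite -lee_fin oE mass_full //; apply: le_measure; rewrite ?inE //.
  exact: measurable_box.
have mf s : full s -> (mass s * f s = o s)%R.
  move=> fs; have [e|ne] := eqVneq (mass s) 0%R; last by rewrite /f mulrC divfK.
  by have := om s fs; rewrite e => le; apply/eqP; rewrite mul0r eq_le o0 le.
have f01 s : (0 <= f s <= 1)%R.
  rewrite divr_ge0 //=; case: (boolP (full s)) => fs; last first.
    by rewrite /f /mass mass_not_full // invr0 mulr0.
  have [e|ne] := eqVneq (mass s) 0%R; first by rewrite /f e invr0 mulr0.
  by rewrite ler_pdivrMr ?mul1r ?om // lt0r ne m0.
have osum (P : pred _) : (\sum_(s | P s) o s)%R%:E =
    mu (\bigcup_(s in [set s | P s]) (Om `&` box C1 C2 C3 s)).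
  rewrite measure_fintype_bigcup //.
    by rewrite -sumEFin; apply: eq_bigr => s _; rewrite oE.
  by apply: trivIset_setIl; exact: trivIset_box.
have tri (d : nat) (D : set (cube R d)) (C : I -> cube R d) : dyadic_grid D -> (forall i, D (C i)) ->
    forall i j, [|| cell C i \subset cell C j, cell C j \subset cell C i
      | [disjoint cell C i & cell C j]%B].
  by move=> gD DC; apply: (@laminar_tri _ _ _ (fun i => (C i).1)) => i j; exact: (cell_laminar gD).
have pos (d : nat) (C : I -> cube R d) i : (0 < \sum_(s in cell C i) weight C s)%R.
  by rewrite sum_cell exprn_gt0 // side_gt0.
have t1 := tri _ _ C1 gD1 (fun i => let: And3 a _ _ := rD i in a).
have t2 := tri _ _ C2 gD2 (fun i => let: And3 _ a _ := rD i in a).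
have t3 := tri _ _ C3 gD3 (fun i => let: And3 _ _ a := rD i in a).
have key := @strong_maximal R _ _ _ I _ _ _ (w0 _ C1) (w0 _ C2) (w0 _ C3) _ _ _ t1 t2 t3
  (pos _ C1) (pos _ C2) f f01.
have vU := @volume_unionE R d1 d2 d3 I I I I r C1 C2 C3 id id id (fun=> erefl) (fun=> erefl)
  (fun=> erefl) [set: I]%SET.
have vR := @volume_rectE R d1 d2 d3 I I I I r C1 C2 C3 id id id (fun=> erefl) (fun=> erefl)
  (fun=> erefl).
have sR := @signature_rect R d1 d2 d3 I I I I r C1 C2 C3 id id id (fun=> erefl) (fun=> erefl)
  (fun=> erefl).
have -> : \bigcup_i rect_set (r i) = \bigcup_(i in [set` [set: I]%SET]) rect_set (r i).
  by apply/seteqP; split=> x [i _ xi]; exists i => //=; rewrite inE.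
rewrite -vU.
apply: (@le_trans _ _ (256 * \sum_s mass s * f s)%R%:E); last first.
  rewrite EFinM; apply: lee_pmul => //; first by rewrite lee_fin sumr_ge0 // => s _; rewrite mulr_ge0 //; case/andP: (f01 s).
  apply: (@le_trans _ _ (\sum_(s | full s) o s)%R%:E).
    rewrite lee_fin [leRHS]big_mkcond; apply: ler_sum => s _.
    case: ifP => fs; first by rewrite mf.
    by rewrite /mass mass_not_full ?fs // mul0r.
  rewrite osum; apply: le_measure; rewrite ?inE //.
    by apply: fin_bigcup_measurable.
  by move=> x [s _ []].
rewrite lee_fin; apply: key => i.
rewrite -lee_fin vR; apply: (le_trans (half i)).
rewrite EFinM; apply: lee_pmul => //.
rewrite (eq_bigr (fun s => o s)); last by move=> s /rect_full; exact: mf.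
rewrite osum le_eqVlt; apply/orP; left; apply/eqP; congr (zlebesgue _).
apply/seteqP; split=> x /=.
  move=> [xO xi]; exists (scene_signature C1 C2 C3 x) => //=.
  by rewrite sR; exact/asboolP.
move=> [s /= si [xO /= xs]]; split=> //; move: si; rewrite -xs sR.
by move=> /asboolP.
Qed.

Lemma rect_fin (P : zrect R d1 d2 d3) : exists v u : R, [/\ (0 < v)%R,
  mu (rect_set P) = v%:E & mu (Om `&` rect_set P) = u%:E].
Proof.
have [mP vP] := rect_measure P.
exists (fine (mu (rect_set P))), (fine (mu (Om `&` rect_set P))); split.
- by rewrite vP /= !mulr_gt0 ?exprn_gt0 ?side_gt0.
- by rewrite vP.
rewrite fineK // ge0_fin_numE ?measure_ge0 //; apply: le_lt_trans Omfin.
by apply: le_measure; rewrite ?inE //; apply: measurableI.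
Qed.

Lemma average_indic (P : zrect R d1 d2 d3) :
  (mu (rect_set P))^-1 * \int[mu]_(y in rect_set P) `|(\1_Om y : R)%:E| =
  (fine (mu (Om `&` rect_set P)) / fine (mu (rect_set P)))%:E.
Proof.
have [mP _] := rect_measure P.
have -> : \int[mu]_(y in rect_set P) `|(\1_Om y : R)%:E| = mu (Om `&` rect_set P).
  rewrite -integral_indic //; apply: eq_integral => x _.
  by rewrite gee0_abs // lee_fin.
have [v [u [v0 vE uE]]] := rect_fin P; rewrite vE uE.
by rewrite inver gt_eqF // -EFinM mulrC.
Qed.

Definition dense : set (zrect R d1 d2 d3) :=
  [set P | sub_zygmund_rects D1 D2 D3 P /\
     mu (rect_set P) < 2%:E * mu (Om `&` rect_set P)].

Lemma dense_average (P : zrect R d1 d2 d3) :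
  (mu (rect_set P) < 2%:E * mu (Om `&` rect_set P)) =
  (2^-1 < fine (mu (Om `&` rect_set P)) / fine (mu (rect_set P)))%R.
Proof.
have [v [u [v0 vE uE]]] := rect_fin P; rewrite vE uE.
rewrite -EFinM lte_fin ltr_pdivlMr //=.
by apply/idP/idP; lra.
Qed.

Lemma dense_sub_enlargement P : dense P -> rect_set P `<=` enlargement D1 D2 D3 Om.
Proof.
move=> [zP]; rewrite dense_average => lt x xP; rewrite /enlargement /=.
apply: (@lt_le_trans _ _ (fine (mu (Om `&` rect_set P)) / fine (mu (rect_set P)))%:E).
  by rewrite lte_fin.
by apply: ereal_sup_ubound; exists P => //; rewrite average_indic.
Qed.

Lemma enlargement_dense x : enlargement D1 D2 D3 Om x -> exists2 P, dense P & rect_set P x.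
Proof.
move=> /ereal_sup_gt[y [P [zP xP]]]; rewrite average_indic => <- lt.
by exists P => //; split=> //; rewrite dense_average -lte_fin.
Qed.

(** The enlargement is a countable union of dense rectangles, and [family_maximal] bounds its finite
    subunions. Applied to expanded rectangles, this bounds the admissible k, so that the
    embeddedness is a true maximum and not a default value. *)
Lemma measure_sub_enlargement E : measurable E -> E `<=` enlargement D1 D2 D3 Om ->
  mu E <= 256%:E * mu Om.
Proof.
move=> mE EOm.
have cd : countable dense.
  apply: sub_countable (countableX (countableX (countable_grid gD1) (countable_grid gD2))
    (countable_grid gD3)).
  by apply: subset_card_le => P [[]].
pose x0 : zrect R d1 d2 d3 := ((0, [tuple of nseq d1 0])%R, (0, [tuple of nseq d2 0])%R, (0, [tuple of nseq d3 0])%R).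
have [f [B [fd df _]]] := countable_enumeration x0 cd.
pose F n := \bigcup_(k in [set k | (k < n)%N && B k]) rect_set (f k).
have mF n : measurable (F n).
  apply: bigcup_measurable => k _; exact: (rect_measure _).1.
have ndF : nondecreasing_seq F.
  move=> k l kl; apply/subsetPset => x [i /= /andP[ik Bi] xi]; exists i => //=.
  by rewrite (leq_trans ik kl).
have mU : measurable (\bigcup_n F n) by apply: bigcup_measurable.
have EF : E `<=` \bigcup_n F n.
  move=> x /EOm/enlargement_dense[P dP xP]; have [k Bk fk] := df _ dP.
  by exists k.+1 => //; exists k => //=; rewrite ?ltnSn // fk.
apply: (@le_trans _ _ (mu (\bigcup_n F n))).
  by apply: le_measure; rewrite ?inE.
have cv : mu \o F @ \oo --> mu (\bigcup_n F n) by exact: nondecreasing_cvg_mu.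
rewrite -(cvg_lim _ cv) //; apply: lime_le; first by apply/cvg_ex; exists (mu (\bigcup_n F n)).
apply: nearW => n /=.
pose I := {k : 'I_n | B k}.
have := @family_maximal I (fun k => f (val k)).
have -> : \bigcup_(k : I) rect_set (f (val k)) = F n.
  apply/seteqP; split=> x [k]; first by move=> _ xk; exists (val k) => //=; rewrite ltn_ord (valP k).
  move=> /= /andP[kn Bk] xk; have Bk' : B (Ordinal kn) by [].
  by exists (exist _ (Ordinal kn) Bk').
apply=> k; have := fd _ (valP k); first by move=> [[]].
by move=> [_ /ltW].
Qed.

End enlargement.

Section ancestors.
Context (R : realType) (d : nat) (D : set (cube R d)) (gD : dyadic_grid D).
Local Open Scope classical_set_scope.

Lemma ancestorP (k : nat) (Q : cube R d) : D Q ->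
  [/\ D (ancestor D k Q), cube_set Q `<=` cube_set (ancestor D k Q)
    & (ancestor D k Q).1 = Q.1 + k%:Z].
Proof.
move=> DQ; have [ex _] := gD; have [P [DP Pl PQ]] := ex (Q.1 + k%:Z) Q.2.
have QP : cube_set Q `<=` cube_set P.
  by apply: (grid_nested gD DQ DP _ (cube_nonempty Q) PQ); rewrite Pl lerDl.
have sideP : side P = 2 ^+ k * side Q.
  by rewrite /side Pl addrC expfzDr ?pnatr_eq0.
pose S := [set P | [/\ D P, cube_set Q `<=` cube_set P & side P = 2 ^+ k * side Q]].
have : S (ancestor D k Q) by apply: (@xgetPex _ Q S); exists P.
move=> [DA QA sA]; split=> //; apply/eqP.
have : side (ancestor D k Q) == side P by rewrite sA sideP.
by rewrite eq_le !le_side -eq_le -Pl.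
Qed.

Lemma side_ancestor k Q : D Q -> side (ancestor D k Q) = 2 ^+ k * side Q.
Proof.
by move=> /(ancestorP k)[_ _ e]; rewrite /side e addrC expfzDr ?pnatr_eq0.
Qed.

End ancestors.

Lemma ft_norm_ge (R : realType) (w : nat -> nat -> R) N : admissible_weight w ->
  \sum_(k < N.+1) w k (N - k)%N <= fine (ft_norm w).
Proof.
move=> [w0 _ _ wfin].
have ub : ((\sum_(k < N.+1) w k (N - k)%N)%:E <= ft_norm w)%E.
  by apply: ereal_sup_ubound; exists N.
rewrite -lee_fin fineK // fin_real // wfin andbT.
apply: lt_le_trans ub; rewrite ltNyr //.
Qed.

(** * The Carleson embedding for Zygmund rectangles *)

Section family_carleson.
Context (R : realType) (d1 d2 d3 : nat).
Context (d1_gt0 : (0 < d1)%N) (d2_gt0 : (0 < d2)%N).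
Context (D1 : set (cube R d1)) (D2 : set (cube R d2)) (D3 : set (cube R d3)).
Context (gD1 : dyadic_grid D1) (gD2 : dyadic_grid D2) (gD3 : dyadic_grid D3).
Local Open Scope classical_set_scope.
Local Open Scope ereal_scope.
Local Notation Z := (zspace R d1 d2 d3).
Local Notation mu := (@zlebesgue R d1 d2 d3).
Context (Om : set Z) (U : set (zrect R d1 d2 d3)).
Context (adm : admissible_pair D1 D2 D3 Om U).

Let mOm : measurable Om. Proof. by have [] := adm. Qed.
Let Omfin : mu Om < +oo. Proof. by have [] := adm. Qed.
Let Uz : U `<=` zygmund_rects D1 D2 D3. Proof. by have [] := adm. Qed.
Let UOm I : U I -> rect_set I `<=` Om. Proof. by have [_ _ _ h _] := adm; exact: h. Qed.
Let antiU I J : U I -> U J -> rect_set I `<=` rect_set J -> I = J.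
Proof. by have [_ _ _ _ h] := adm; exact: h. Qed.

Lemma rect_measure_gt0 (I : zrect R d1 d2 d3) : 0 < mu (rect_set I).
Proof.
by have [_ ->] := rect_measure I; rewrite lte_fin !mulr_gt0 ?exprn_gt0 ?side_gt0.
Qed.

Local Notation expand1 := (Defs.expand1 D1).
Local Notation expand2 := (Defs.expand2 D2).

Let pow_ge k d : (0 < d)%N -> (k%:R <= (2 ^+ k) ^+ d :> R)%R.
Proof.
move=> d0; rewrite -exprM -natrX ler_nat.
apply: (@leq_trans (2 ^ k)); first by rewrite ltnW // ltn_expl.
by rewrite leq_pexp2l // leq_pmulr.
Qed.

(** Linear growth in k is crude but enough: it only has to ensure that boundedly many k give a
    rectangle below a prescribed measure. *)
Lemma expand1_measure k (I : zrect R d1 d2 d3) : D1 I.1.1 ->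
  k%:R%:E * mu (rect_set I) <= mu (rect_set (expand1 k I)).
Proof.
move=> DI; have [_ ->] := rect_measure I; have [_ ->] := rect_measure (expand1 k I).
rewrite -EFinM lee_fin /= (side_ancestor gD1) // exprMn.
have v0 : (0 <= side I.1.1 ^+ d1 * side I.1.2 ^+ d2 * side I.2 ^+ d3)%R.
  by rewrite !mulr_ge0 ?exprn_ge0 ?ltW ?side_gt0.
by have := ler_wpM2r v0 (pow_ge k d1_gt0); rewrite !mulrA.
Qed.

Lemma expand2_measure k (I : zrect R d1 d2 d3) : D2 I.1.2 ->
  k%:R%:E * mu (rect_set I) <= mu (rect_set (expand2 k I)).
Proof.
move=> DI; have [_ ->] := rect_measure I; have [_ ->] := rect_measure (expand2 k I).
rewrite -EFinM lee_fin /= (side_ancestor gD2) // exprMn.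
have v0 : (0 <= side I.1.1 ^+ d1 * side I.1.2 ^+ d2 * side I.2 ^+ d3)%R.
  by rewrite !mulr_ge0 ?exprn_ge0 ?ltW ?side_gt0.
by have := ler_wpM2r v0 (pow_ge k d2_gt0); lra.
Qed.

Section family.
Context (I : finType) (r : I -> zrect R d1 d2 d3) (r_inj : injective r).
Context (rU : forall i, U (r i)).

Let S : set Z := \bigcup_i rect_set (r i).
Let mS : measurable S.
Proof. by apply: fin_bigcup_measurable => // i _; have [] := rect_measure (r i). Qed.
Let SOm : S `<=` Om. Proof. by move=> x [i _]; exact: UOm. Qed.
Let Sfin : mu S < +oo.
Proof. by apply: le_lt_trans Omfin; apply: le_measure; rewrite ?inE. Qed.

Let dense_sub (P : zrect R d1 d2 d3) : sub_zygmund_rects D1 D2 D3 P ->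
  mu (rect_set P) < 2%:E * mu (S `&` rect_set P) ->
  rect_set P `<=` enlargement D1 D2 D3 Om.
Proof.
move=> zP lt; apply: dense_sub_enlargement => //; split=> //.
apply: (lt_le_trans lt); apply: lee_pmul => //; apply: le_measure; rewrite ?inE.
- by apply: measurableI => //; have [] := rect_measure P.
- by apply: measurableI => //; have [] := rect_measure P.
- exact: setSI.
Qed.

(* The embeddedness with respect to the shadow alone, at density 1/2, bounds
   the embeddedness in Om from below. *)
Let embed_ge (e : nat -> zrect R d1 d2 d3) i :
  (forall k, sub_zygmund_rects D1 D2 D3 (e k)) ->
  (forall k, k%:R%:E * mu (rect_set (r i)) <= mu (rect_set (e k))) ->
  exists a : nat, 2%:E * mu (S `&` rect_set (e a.+1)) <= mu (rect_set (e a.+1)) /\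
    (a <= max_nat [set k | rect_set (e k) `<=` enlargement D1 D2 D3 Om])%N.
Proof.
move=> ze ek.
have mr := rect_measure_gt0 (r i).
have rfin : mu (rect_set (r i)) \is a fin_num by have [_ ->] := rect_measure (r i).
have large (M : \bar R) : M < +oo -> exists N, forall k, mu (rect_set (e k)) <= M -> (k <= N)%N.
  move=> Moo; have [M0|M0] := leP 0 M; last first.
    exists 0%N => k /le_lt_trans/(_ M0); rewrite ltNge.
    by have := rect_measure_gt0 (e k) => /ltW ->.
  have Mf : M \is a fin_num by rewrite ge0_fin_numE.
  exists (Num.bound (fine M / fine (mu (rect_set (r i))))) => k /(le_trans (ek k)).
  rewrite -(fineK Mf) -(fineK rfin) -EFinM lee_fin => le.
  have v0 : (0 < fine (mu (rect_set (r i))))%R by rewrite fine_gt0 // mr -ge0_fin_numE.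
  have {le} : (k%:R <= fine M / fine (mu (rect_set (r i))))%R by rewrite ler_pdivlMr.
  move=> le; rewrite -(ler_nat R); apply: (le_trans le); apply/ltW/archi_boundP.
  by apply: divr_ge0; [exact: fine_ge0|exact: ltW].
(* The shift by one matters: for the least such a, the shadow fills at most half of [e a.+1], while
   for a > 0 it still fills more than half of [e a], which therefore lies in the enlargement. *)
pose Q k := `[< 2%:E * mu (S `&` rect_set (e k.+1)) <= mu (rect_set (e k.+1)) >].
have exQ : exists k, Q k.
  have [|N hN] := large (2%:E * mu S).
    by rewrite lte_mul_pinfty.
  exists N; apply/asboolP; rewrite leNgt; apply/negP => lt.
  have := hN N.+1; rewrite ltnn => h; suff : false by []; apply: h.
  apply/ltW/(lt_le_trans lt); apply: lee_pmul => //; apply: le_measure; rewrite ?inE //.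
  by apply: measurableI => //; have [] := rect_measure (e N.+1).
case: (ex_minnP exQ) => a /asboolP Qa amin; exists a; split=> //.
case: a => // a in Qa amin *.
apply: max_nat_ge.
  apply: dense_sub => //; rewrite ltNge; apply/negP => h.
  by have := amin a; rewrite ltnn => h'; suff : false by []; apply: h'; exact/asboolP.
have [|N hN] := large (256%:E * mu Om); first by rewrite lte_mul_pinfty.
exists N => k hk; apply: hN; apply: measure_sub_enlargement hk => //.
by have [] := rect_measure (e k).
Qed.

Context (w : nat -> nat -> R) (adm_w : admissible_weight w).

Let sub_expand1 k i : sub_zygmund_rects D1 D2 D3 (expand1 k (r i)).
Proof.
have [a1 a2 a3 e] := Uz (rU i); have [b1 _ _] := ancestorP gD1 k a1.
split=> //=; rewrite (side_ancestor gD1) // e -mulrA ler_peMl //.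
  by apply: mulr_ge0; exact/ltW/side_gt0.
by rewrite exprn_ege1 // ler1n.
Qed.

Let sub_expand2 k i : sub_zygmund_rects D1 D2 D3 (expand2 k (r i)).
Proof.
have [a1 a2 a3 e] := Uz (rU i); have [b1 _ _] := ancestorP gD2 k a2.
split=> //=; rewrite (side_ancestor gD2) // e mulrCA ler_peMl //.
  by apply: mulr_ge0; exact/ltW/side_gt0.
by rewrite exprn_ege1 // ler1n.
Qed.

Lemma family_carleson :
  \sum_i (embed_weight D1 D2 D3 w (r i) Om)%:E * mu (rect_set (r i)) <=
  (20 * fine (ft_norm w))%:E * mu S.
Proof.
have [w0 wn1 wn2 _] := adm_w.
have rD i : [/\ D1 (r i).1.1, D2 (r i).1.2 & D3 (r i).2] by have [] := Uz (rU i).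
have /fin_all_exists[a aP] : forall i, exists a : nat,
    2%:E * mu (S `&` rect_set (expand1 a.+1 (r i))) <= mu (rect_set (expand1 a.+1 (r i))) /\
    (a <= embed1 D1 D2 D3 (r i) Om)%N.
  move=> i; apply: (embed_ge (e := fun k => expand1 k (r i))) => k; first exact: sub_expand1.
  by apply: expand1_measure; have [] := rD i.
have /fin_all_exists[c cP] : forall i, exists c : nat,
    2%:E * mu (S `&` rect_set (expand2 c.+1 (r i))) <= mu (rect_set (expand2 c.+1 (r i))) /\
    (c <= embed2 D1 D2 D3 (r i) Om)%N.
  move=> i; apply: (embed_ge (e := fun k => expand2 k (r i))) => k; first exact: sub_expand2.
  by apply: expand2_measure; have [] := rD i.
(* One scene holds the sides ([inl]) and their expansions ([inr]). The expansion goes one step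
   beyond [a i], where the shadow is no longer dense. *)
pose C1 (j : I + I) := match j with inl i => (r i).1.1
  | inr i => ancestor D1 (a i).+1 (r i).1.1 end.
pose C2 (j : I + I) := match j with inl i => (r i).1.2
  | inr i => ancestor D2 (c i).+1 (r i).1.2 end.
pose C3 i := (r i).2.
pose m i := (r i).1.1.1; pose n i := (r i).1.2.1.
pose A i := cell C1 (inl i); pose QA i := cell C1 (inr i).
pose B i := cell C2 (inl i); pose QB i := cell C2 (inr i).
pose T i := cell C3 i.
have DC1 j : D1 (C1 j).
  by case: j => i /=; have [a1 _ _] := rD i => //; have [] := ancestorP gD1 (a i).+1 a1.
have DC2 j : D2 (C2 j).
  by case: j => i /=; have [_ a2 _] := rD i => //; have [] := ancestorP gD2 (c i).+1 a2.
have lamT i j : (m i + n i <= m j + n j)%R -> (T i \subset T j) || [disjoint T i & T j]%B.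
  move=> h; have [_ _ ri] := rD i; have [_ _ rj] := rD j.
  apply: (cell_laminar gD3) => //.
  by rewrite /C3 (zygmund_level (Uz (rU i))) (zygmund_level (Uz (rU j))).
have AQ i : A i \subset QA i.
  by apply: cell_sub => /=; have [a1 _ _] := rD i; have [] := ancestorP gD1 (a i).+1 a1.
have BQ i : B i \subset QB i.
  by apply: cell_sub => /=; have [_ a2 _] := rD i; have [] := ancestorP gD2 (c i).+1 a2.
have lamQ i j : [|| QA i \subset QA j, QA j \subset QA i | [disjoint QA i & QA j]%B].
  apply: (@laminar_tri _ _ (fun j => cell C1 j) (fun j => (C1 j).1)).
  by move=> k l; apply: (cell_laminar gD1).
have incomp i j x : i != j -> x \in product_rect A B T i -> x \in product_rect A B T j ->
    ~~ ((m i <= m j) && (n i <= n j))%R.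
  move=> ij xi xj.
  have [z [zi zj]] := @rect_signature R d1 d2 d3 I _ _ I r C1 C2 C3 inl inl id (fun=> erefl)
    (fun=> erefl) (fun=> erefl) i j x xi xj.
  apply: (zygmund_antichain gD1 gD2 gD3 Uz _ (rU i) (rU j) _ zi zj).
    by move=> *; exact: antiU.
  by rewrite (inj_eq r_inj).
have shared (d : nat) (J : finType) (C : J -> cube R d) j k x : x \in cell C j -> x \in cell C k ->
    exists y, cube_set (C j) y /\ cube_set (C k) y.
  rewrite !inE => /andP[+ /asboolP[y yx]] /andP[+ _]; rewrite -yx !in_signature.
  by move=> /asboolP yj /asboolP yk; exists y.
(* The expanded side has level m i + a i + 1, so the strict inequality is what lets it fit into
   [A j]. *)
have stepA i j x : x \in A i -> x \in A j -> (m i + (a i)%:Z < m j)%R -> QA i \subset A j.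
  move=> xi xj lt; apply: cell_sub; have [y [yi yj]] := shared _ _ _ _ _ _ xi xj.
  have [a1 _ _] := rD i; have [b1 _ _] := rD j.
  have [q1 q2 q3] := ancestorP gD1 (a i).+1 a1.
  apply: (grid_nested gD1 q1 b1 _ (q2 _ yi) yj); rewrite q3.
  by move: lt; rewrite /m; lia.
have stepB i j x : x \in B i -> x \in B j -> (n i + (c i)%:Z < n j)%R -> QB i \subset B j.
  move=> xi xj lt; apply: cell_sub; have [y [yi yj]] := shared _ _ _ _ _ _ xi xj.
  have [_ a1 _] := rD i; have [_ b1 _] := rD j.
  have [q1 q2 q3] := ancestorP gD2 (c i).+1 a1.
  apply: (grid_nested gD2 q1 b1 _ (q2 _ yi) yj); rewrite q3.
  by move: lt; rewrite /n; lia.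
pose vol := volume (weight C1) (weight C2) (weight C3).
have vU : (vol (rect_union A B T [set: I]%SET))%:E = mu S.
  rewrite /vol (@volume_unionE R d1 d2 d3 I _ _ I r C1 C2 C3 inl inl id) //.
  by congr (zlebesgue _); apply/seteqP; split=> x [i _ xi]; exists i => //=; rewrite inE.
have vR i : (vol (product_rect A B T i))%:E = mu (rect_set (r i)).
  by rewrite /vol (@volume_rectE R d1 d2 d3 I _ _ I r C1 C2 C3 inl inl id).
have vI (k1 k2 : I -> I + I) (r' : I -> zrect R d1 d2 d3) i :
    (forall i, C1 (k1 i) = (r' i).1.1) -> (forall i, C2 (k2 i) = (r' i).1.2) ->
    (forall i, C3 i = (r' i).2) ->
    (vol (rect_union A B T [set: I]%SET :&: product_rect (fun i => cell C1 (k1 i)) (fun i => cell C2 (k2 i)) T i))%:E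
      = mu (S `&` rect_set (r' i)) /\
    (vol (product_rect (fun i => cell C1 (k1 i)) (fun i => cell C2 (k2 i)) T i))%:E = mu (rect_set (r' i)).
  move=> e1 e2 e3; split; last first.
    by rewrite /vol (@volume_rectE R d1 d2 d3 I _ _ I r' C1 C2 C3 k1 k2 id).
  set P := (_ :&: _)%SET.
  have [] := @scene_measure R d1 d2 d3 _ _ _ C1 C2 C3 (mem P).
    move=> x; apply: contra; rewrite !inE => /andP[xU _].
    exact: (union_full (k1 := inl) (k2 := inl) (k3 := id) xU).
  move=> _ <-; congr (zlebesgue _); apply/seteqP; split=> x /=.
    rewrite /P finset.in_setI (@signature_union R d1 d2 d3 I _ _ I r C1 C2 C3 inl inl id) //.
    rewrite (@signature_rect R d1 d2 d3 I _ _ I r' C1 C2 C3 k1 k2 id) //.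
    by move=> /andP[/asboolP[j _ xj] /asboolP xi]; split=> //; exists j.
  move=> [[j _ xj] xi].
  rewrite /P finset.in_setI (@signature_union R d1 d2 d3 I _ _ I r C1 C2 C3 inl inl id) //.
  rewrite (@signature_rect R d1 d2 d3 I _ _ I r' C1 C2 C3 k1 k2 id) //.
  by apply/andP; split; apply/asboolP => //; exists j => //=; rewrite inE.
have sparseA i : (2 * vol (rect_union A B T [set: I]%SET :&: product_rect QA B T i)
    <= vol (product_rect QA B T i))%R.
  have [v1 v2] := vI inr inl (fun i => expand1 (a i).+1 (r i)) i (fun=> erefl) (fun=> erefl) (fun=> erefl).
  by rewrite -lee_fin EFinM v1 v2; have [] := aP i.
have sparseB i : (2 * vol (rect_union A B T [set: I]%SET :&: product_rect A QB T i)
    <= vol (product_rect A QB T i))%R.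
  have [v1 v2] := vI inl inr (fun i => expand2 (c i).+1 (r i)) i (fun=> erefl) (fun=> erefl) (fun=> erefl).
  by rewrite -lee_fin EFinM v1 v2; have [] := cP i.
have := @journe_carleson R _ _ _ I _ _ _ (@weight_ge0 _ _ _ C1) (@weight_ge0 _ _ _ C2)
  (@weight_ge0 _ _ _ C3) A QA B QB T m n a c lamT AQ BQ lamQ incomp stepA stepB sparseA sparseB
  w (fine (ft_norm w)) w0 (fun k k' l => @wn1 k k' l) (fun k l l' => @wn2 k l l')
  (fun N => ft_norm_ge N adm_w).
rewrite -lee_fin EFinM vU => le; apply: le_trans le.
rewrite -sumEFin; apply: lee_sum => i _; rewrite EFinM vR.
apply: lee_pmul => //; rewrite lee_fin /embed_weight; first exact: w0.
have [_ ea] := aP i; have [_ ec] := cP i.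
exact: le_trans (wn1 _ _ _ ea) (wn2 _ _ _ ec).
Qed.

End family.
End family_carleson.

(** * Limits of integrals and scalar inequalities *)

Section limits.
Local Open Scope classical_set_scope.
Local Open Scope ereal_scope.

Lemma integral_limit_le d (T : measurableType d) (R : realType)
    (mu : {measure set T -> \bar R}) (D : set T) (u : nat -> T -> R) (F : T -> \bar R)
    (M : \bar R) :
  measurable D -> (forall n, measurable_fun [set: T] (u n)) ->
  (forall n x, (0 <= u n x)%R) -> (forall x, nondecreasing_seq (u ^~ x)) ->
  (forall x, (u n x)%:E @[n --> \oo] --> F x) ->
  (forall n, \int[mu]_(x in D) (u n x)%:E <= M) ->
  measurable_fun [set: T] F /\ \int[mu]_(x in D) F x <= M.
Proof.
move=> mD mu_n u0 ndu uF le.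
have mE n : measurable_fun [set: T] (EFin \o u n) by exact/measurable_EFinP.
split.
  apply: (@emeasurable_fun_cvg _ _ _ _ (fun n => EFin \o u n)) => // x _.
  exact: uF.
have -> : \int[mu]_(x in D) F x = \int[mu]_(x in D) limn (fun n => (u n x)%:E).
  by apply: eq_integral => x _; apply/esym/cvg_lim => //; exact: uF.
rewrite (@monotone_convergence _ _ _ mu D mD (fun n x => (u n x)%:E)).
- apply: lime_le; last by apply: nearW => n; exact: le.
  apply: ereal_nondecreasing_is_cvgn => k l kl.
  apply: ge0_le_integral => // [x _|||x _].
  + by rewrite lee_fin.
  + exact: (measurable_funTS (mE k)).
  + exact: (measurable_funTS (mE l)).
  + by rewrite lee_fin; exact: ndu.
- by move=> n; exact: (measurable_funTS (mE n)).
- by move=> n x _; rewrite lee_fin.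
- by move=> x _ k l kl; rewrite lee_fin; exact: ndu.
Qed.

(* A continuous function of at least linear growth extends continuously by
   +oo at +oo. *)
Lemma cvg_extended (R : realType) (theta : R -> R) (Theta : \bar R -> \bar R) (c c' : R)
    (v : nat -> R) (h : \bar R) :
  (0 < c)%R -> continuous theta ->
  (forall t, 0 <= t -> c * t - c' <= theta t)%R ->
  (forall t, 0 <= t -> Theta t%:E = (theta t)%:E)%R -> Theta +oo = +oo ->
  (forall n, 0 <= v n)%R -> (v n)%:E @[n --> \oo] --> h ->
  (theta (v n))%:E @[n --> \oo] --> Theta h.
Proof.
move=> c0 ct growth Tfin Ty v0 vh.
have h0 : 0 <= h by apply: (cvge_ge _ vh); apply: nearW => n; rewrite lee_fin.
case: h h0 vh => [r r0 /fine_cvgP[_ vr]|_ /cvgeryP/cvgryPge vy|//].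
  rewrite Tfin //; apply/fine_cvgP; split; first exact: nearW.
  have vr' : v n @[n --> \oo] --> r by exact: vr.
  exact: (@continuous_cvg _ _ _ _ _ v theta r (ct r) vr').
rewrite Ty; apply/cvgeryP/cvgryPge => M.
apply: filterS (vy ((M + c') / c)%R) => n; rewrite ler_pdivrMr // => le.
by apply: le_trans (growth _ (v0 n)); rewrite lerBrDr mulrC.
Qed.

End limits.

Section elementary_bounds.
Context (R : realType).
Implicit Types y q : R.

Lemma coshr_continuous : continuous (@coshr R).
Proof.
move=> y; rewrite /coshr; apply: cvgMl; apply: cvgD; first exact: continuous_expR.
apply: (@continuous_comp _ _ _ -%R (@expR R)); last exact: continuous_expR.
exact: opp_continuous.
Qed.

Lemma expR_le_coshr y : 2 <= y -> expR y <= 4 * (coshr y - 1).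
Proof.
move=> y2; rewrite /coshr; have := expR_ge0 (- y).
have : 4 <= expR y; last by lra.
have e1 : 2 <= expR 1 :> R by have := expR_ge1Dx (1 : R); lra.
apply: (@le_trans _ _ (expR 2)); last by rewrite ler_expR.
have -> : (2 : R) = 1 + 1 by ring.
rewrite expRD; apply: (@le_trans _ _ (2 * 2)); first by lra.
by apply: ler_pM.
Qed.

(** For y <= 2 the q-th power of y^2 / 4 is at most y^2 / 4, hence at most half of cosh y - 1, and
    4^q <= 8 (2 q^2)^q. For y >= 2 the bound y^2 <= 2 q^2 e^(y/q) is raised to the power q, and e^y
    <= 4 (cosh y - 1). *)
Lemma powR_le_coshr y q : 0 <= y -> 1 <= q ->
  (y ^+ 2) `^ q <= 4 * (2 * q ^+ 2) `^ q * (coshr y - 1).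
Proof.
move=> y0 q1; have q0 : 0 <= q by lra.
have Q0 : 0 <= (2 * q ^+ 2) `^ q by exact: powR_ge0.
case: (leP y 2) => [y2|/ltW y2].
  have y24 : 0 <= y ^+ 2 / 4 <= 1 by nra.
  have -> : y ^+ 2 = 4 * (y ^+ 2 / 4) by field.
  have [e|ne] := eqVneq (y ^+ 2 / 4) 0.
    rewrite e mulr0 powR0 ?gt_eqF //; last by lra.
    by rewrite !mulr_ge0 // subr_ge0 coshr_ge1.
  rewrite powRM //; last by case/andP: y24.
  have h1 : (y ^+ 2 / 4) `^ q <= y ^+ 2 / 4.
    by apply: ge1r_powR => //; rewrite lt0r ne; case/andP: y24 => -> ->.
  have h2 := coshr_ge_quadratic y.
  have h3 : 4 `^ q <= 8 * (2 * q ^+ 2) `^ q.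
    have -> : (4 : R) = 2 * 2 by ring.
    rewrite [(2 * 2) `^ q]powRM // [(2 * q ^+ 2) `^ q]powRM ?exprn_ge0 //.
    rewrite mulrCA ler_wpM2l ?powR_ge0 //.
    have qq1 : 1 <= (q ^+ 2) `^ q.
      by apply: le_trans (le1r_powR _ q1) => //; nra.
    case: (leP 2 (q ^+ 2)) => hq.
      have : 2 `^ q <= (q ^+ 2) `^ q by apply: ge0_ler_powR; rewrite ?nnegrE //; nra.
      lra.
    have : 2 `^ q <= 4 :> R; last by lra.
    have -> : (4 : R) = 2 `^ 2 by rewrite powR_mulrn //; ring.
    by apply: ler_powR; nra.
  apply: (@le_trans _ _ (8 * (2 * q ^+ 2) `^ q * (y ^+ 2 / 4))).
    by apply: ler_pM => //; exact: powR_ge0.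
  have := ler_wpM2l Q0 h2; lra.
have h := expR_le_coshr y2.
apply: (@le_trans _ _ ((2 * q ^+ 2) `^ q * expR y)); last first.
  have := ler_wpM2l Q0 h; lra.
have q2 : 0 < 2 * q by lra.
(* y / 2q <= e^(y/2q - 1), raised to the power 2q. *)
have k1 : y / (2 * q) <= expR (y / (2 * q) - 1).
  by have := expR_ge1Dx (y / (2 * q) - 1); lra.
have yq0 : 0 <= y / (2 * q) by rewrite divr_ge0 // ltW.
have k2 : (y / (2 * q)) ^+ 2 <= expR (y / q - 2).
  have -> : y / q - 2 = (y / (2 * q) - 1) + (y / (2 * q) - 1) by field; rewrite gt_eqF //; lra.
  by rewrite expRD expr2; apply: ler_pM.
have k3 : y ^+ 2 <= 2 * q ^+ 2 * expR (y / q).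
  have e2 : 2 * expR (- 2) <= 1 :> R.
    rewrite expRN; have := expR_ge1Dx (2 : R) => e3.
    by rewrite ler_pdivrMr ?expR_gt0 // mul1r; lra.
  have -> : y ^+ 2 = 4 * q ^+ 2 * (y / (2 * q)) ^+ 2 by field; rewrite gt_eqF //; lra.
  apply: (@le_trans _ _ (4 * q ^+ 2 * expR (y / q - 2))).
    by rewrite ler_wpM2l // mulr_ge0 // exprn_ge0.
  rewrite expRD.
  have : 0 <= 2 * q ^+ 2 * expR (y / q) * (1 - 2 * expR (- 2)).
    by rewrite !mulr_ge0 ?exprn_ge0 ?expR_ge0 // subr_ge0.
  lra.
have -> : expR y = expR (y / q) `^ q.
  by rewrite -expRM divfK // gt_eqF //; lra.
rewrite -powRM ?expR_ge0 ?mulr_ge0 ?exprn_ge0 //.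
by apply: ge0_ler_powR => //; rewrite nnegrE ?exprn_ge0 // !mulr_ge0 ?expR_ge0 ?exprn_ge0.
Qed.

End elementary_bounds.

(** * The two integrals *)

Lemma esum_fintype (R : realType) (K : finType) (a : K -> \bar R) :
  (forall i, 0 <= a i)%E -> (\esum_(i in [set: K]) a i = \sum_i a i)%E.
Proof.
move=> a0; rewrite esum_fset; [|exact: finite_finset|by move=> i _; exact: a0].
rewrite (_ : [set: K] = [set` index_enum K])%classic.
  by rewrite -fsbig_seq // index_enum_uniq.
by apply/seteqP; split=> i //= _; rewrite mem_index_enum.
Qed.

Lemma measurable_coshr_sqrt d (T : measurableType d) (R : realType) (b : R) (h : T -> R) :
  measurable_fun [set: T]%classic h ->
  measurable_fun [set: T]%classic (fun x => coshr (b * Num.sqrt (h x)) - 1).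
Proof.
move=> mh; pose F (t : R) := coshr (b * Num.sqrt t) - 1.
have mF : measurable_fun [set: R]%classic F.
  apply: continuous_measurable_fun => t; apply: cvgB; last exact: cvg_cst.
  apply: (@continuous_comp _ _ _ (fun t => b * Num.sqrt t) (@coshr R)).
    by apply: cvgMr; exact: sqrt_continuous.
  exact: coshr_continuous.
exact: (measurableT_comp mF mh).
Qed.

Section main_estimates.
Context (R : realType).

(* Small enough for the error terms 48 * b * exp_const of carleson_cosh, even
   after the rescaling of b by sqrt 8 in sparse_cosh_le. *)
Definition cosh_const : R := (50 ^+ 2 * (exp_const R + 1))^-1.
Local Notation b := cosh_const.
Local Notation C := (exp_const R).

Lemma exp_const_ge0 : 0 <= C.
Proof. by rewrite /exp_const mulr_ge0 // addr_ge0 // mulr_ge0 ?exprn_ge0 ?expR_ge0. Qed.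

Lemma cosh_const_gt0 : 0 < b.
Proof. by rewrite invr_gt0 mulr_gt0 ?exprn_gt0 //; have := exp_const_ge0; lra. Qed.

Lemma cosh_constE : 50 ^+ 2 * (b * C) + 50 ^+ 2 * b = 1.
Proof.
have C0 := exp_const_ge0.
have ne : 50 ^+ 2 * (C + 1) != 0 by rewrite mulf_neq0 ?expf_neq0 // gt_eqF //; lra.
have e : b * (50 ^+ 2 * (C + 1)) = 1 by exact: mulVf.
by rewrite -[RHS]e; ring.
Qed.

Lemma cosh_const_bounds : 50 ^+ 2 * b <= 1 /\ 50 ^+ 2 * (b * C) <= 1.
Proof.
have := cosh_constE; have b0 := cosh_const_gt0; have C0 := exp_const_ge0.
have : 0 <= b * C by rewrite mulr_ge0 // ltW.
by split; lra.
Qed.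

Context (d1 d2 d3 : nat) (d1_gt0 : (0 < d1)%N) (d2_gt0 : (0 < d2)%N).
Context (D1 : set (cube R d1)) (D2 : set (cube R d2)) (D3 : set (cube R d3)).
Context (gD1 : dyadic_grid D1) (gD2 : dyadic_grid D2) (gD3 : dyadic_grid D3).
Local Open Scope classical_set_scope.
Local Open Scope ereal_scope.
Local Notation Z := (zspace R d1 d2 d3).
Local Notation mu := (@zlebesgue R d1 d2 d3).
Context (Om : set Z) (U : set (zrect R d1 d2 d3)).
Context (adm : admissible_pair D1 D2 D3 Om U).

Let mOm : measurable Om. Proof. by have [] := adm. Qed.
Let Omfin : mu Om < +oo. Proof. by have [] := adm. Qed.
Let Uz : U `<=` zygmund_rects D1 D2 D3. Proof. by have [] := adm. Qed.
Let UOm I : U I -> rect_set I `<=` Om. Proof. by have [_ _ _ h _] := adm; exact: h. Qed.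
Let antiU : forall I J, U I -> U J -> rect_set I `<=` rect_set J -> I = J.
Proof. by have [_ _ _ _ h] := adm; exact: h. Qed.

Let mrect (I : zrect R d1 d2 d3) : measurable (rect_set I).
Proof. by have [] := rect_measure I. Qed.

Section sparse_family.
Context (K : finType) (r : K -> zrect R d1 d2 d3) (r_inj : injective r).
Context (rU : forall i, U (r i)).
Context (E : K -> set Z) (E_sub : forall i, [/\ measurable (E i), E i `<=` rect_set (r i) &
  (8^-1)%:E * mu (rect_set (r i)) <= mu (E i)]) (E_triv : trivIset [set: K] E).

Let h x : R := (\sum_i \1_(rect_set (r i)) x)%R.

Lemma height_range x : height (range r) x = (h x)%:E.
Proof.
rewrite /height (@reindex_esum _ _ _ [set: K] (range r) r); last first.
  by split=> [i _|i j _ _ /r_inj //|_ [i _ <-]]; exists i.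
by rewrite esum_fintype // sumEFin.
Qed.

Lemma shadow_range : shadow (range r) = \bigcup_i rect_set (r i).
Proof. by rewrite /shadow bigcup_image. Qed.

Let G := range r.

Lemma measurable_shadow_range : measurable (shadow G).
Proof. by rewrite shadow_range; apply: fin_bigcup_measurable. Qed.

Lemma sparse_range : sparse (8^-1)%R G.
Proof.
exists (fun J => \bigcup_(i in [set i | r i = J]) E i); split.
- move=> _ [i _ <-]; have -> : \bigcup_(j in [set j | r j = r i]) E j = E i.
    apply/seteqP; split=> x; last by move=> xi; exists i.
    by move=> [j /= /r_inj ->].
  exact: E_sub.
- move=> _ _ [i _ <-] [j _ <-] [x [[k /= /r_inj -> xi] [l /= /r_inj -> xj]]].
  by congr r; apply: E_triv => //; exists x.
Qed.

Let coshe_height x : coshe (b%:E * sqrte (height G x)) - 1 =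
  (coshr (b * Num.sqrt (h x)) - 1)%:E.
Proof. by rewrite height_range /coshr mulrC. Qed.

(** Sparseness is the Carleson condition for coefficients 1/8, so the height is 8 times a Carleson
    sum and the 8 goes into b' = b sqrt 8. The resulting factor is at most 8 b^2, far below 1/4. *)
Lemma sparse_cosh_le : \int[mu]_x (coshe (b%:E * sqrte (height G x)) - 1) <=
  (4^-1)%:E * mu (shadow G).
Proof.
have [b1 bC1] := cosh_const_bounds; have b0 := cosh_const_gt0; have C0 := exp_const_ge0.
pose s8 := Num.sqrt (8 : R); pose b' := (b * s8)%R.
have s80 : (0 <= s8)%R by rewrite sqrtr_ge0.
have s82 : (s8 ^+ 2 = 8)%R by rewrite sqr_sqrtr.
have s83 : (s8 <= 3)%R.
  by rewrite -(@ler_pXn2r _ 2) ?nnegrE // s82; lra.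
have carl (s : {set K}) : \sum_(i in s) (8^-1)%:E * mu (rect_set (r i)) <=
     mu (\bigcup_(i in [set` s]) rect_set (r i)).
  apply: (@le_trans _ _ (mu (\bigcup_(i in [set` s]) E i))).
    rewrite measure_fintype_bigcup //; last by move=> i; have [] := E_sub i.
    by apply: lee_sum => i _; have [] := E_sub i.
  apply: le_measure; rewrite ?inE.
  + by apply: fin_bigcup_measurable => // i _; have [] := E_sub i.
  + by apply: fin_bigcup_measurable.
  + by move=> x [i si xi]; exists i => //; have [_ sub _] := E_sub i; exact: sub.
have bb' : (b' <= 3 * b)%R by rewrite /b' mulrC ler_wpM2r // ltW.
have b'0 : (0 <= b')%R by rewrite mulr_ge0 // ltW.
have b'48 : (b' <= 48^-1)%R by lra.
have := family_cosh_le gD1 gD2 gD3 Uz antiU r_inj rU (a := fun=> 8^-1%R) (fun _ => ltac:(by rewrite invr_ge0)) carl b'0 b'48.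
under eq_integral => x _.
  have -> : (b' * Num.sqrt (\sum_i 8^-1 * \1_(rect_set (r i)) x) = b * Num.sqrt (h x))%R.
    rewrite -mulr_sumr -/(h x) /b' -mulrA; congr (_ * _)%R.
    by rewrite -sqrtrM // mulrA divff ?mul1r.
  rewrite -coshe_height; over.
move=> le; apply: (le_trans le); rewrite shadow_range.
have sE : \sum_i (8^-1)%:E * mu (rect_set (r i)) <= mu (\bigcup_i rect_set (r i)).
  have := carl [set: K]%SET; under eq_bigl do rewrite finset.inE.
  have -> : [set` [set: K]%SET] = [set: K] by apply/seteqP; split=> i //= _; rewrite finset.inE.
  by [].
set M := mu (\bigcup_i rect_set (r i)) in sE *.
have M0 : 0 <= M by exact: measure_ge0.
apply: (@le_trans _ _ ((b' ^+ 2 / 2)%:E * (M + (48 * b' * C)%:E * M))).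
  by apply: lee_wpmul2l; [rewrite lee_fin divr_ge0 ?exprn_ge0|exact: leeD2r].
have Mf : M \is a fin_num.
  rewrite ge0_fin_numE //; apply: le_lt_trans Omfin; apply: le_measure; rewrite ?inE //.
    by rewrite -shadow_range; exact: measurable_shadow_range.
  by move=> x [i _]; exact: UOm.
have [v v0 vE] : exists2 v : R, (0 <= v)%R & M = v%:E.
  by exists (fine M); [rewrite fine_ge0|rewrite fineK].
rewrite vE lee_fin.
rewrite [leLHS](_ : _ = b' ^+ 2 / 2 * (1 + 48 * b' * C) * v)%R; last by ring.
rewrite ler_wpM2r // /b' exprMn s82.
have bC0 : (0 <= b * C)%R by rewrite mulr_ge0 // ltW.
have h1 : (b * s8 * C <= 3 * (b * C))%R.
  by have : (0 <= b * C * (3 - s8))%R; [rewrite mulr_ge0 // subr_ge0|lra].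
have h2 : (48 * (b * s8) * C <= 1)%R by lra.
have h3 : (b ^+ 2 <= 50^-1 ^+ 2)%R by rewrite ler_pXn2r ?nnegrE //; lra.
have h4 : (0 <= 48 * (b * s8) * C)%R by rewrite !mulr_ge0 // ltW.
have : (b ^+ 2 * 8 / 2 * (1 + 48 * (b * s8) * C) <= b ^+ 2 * 8 / 2 * 2)%R.
  by rewrite ler_wpM2l ?mulr_ge0 ?exprn_ge0 ?ltW //; lra.
lra.
Qed.

(** The height is at least 1 on the shadow, so the quadratic lower bound for cosh is at least b^2 /
    2 there. *)
Lemma sparse_cosh_ge : (b ^+ 2 / 2)%:E * mu (shadow G) <=
  \int[mu]_x (coshe (b%:E * sqrte (height G x)) - 1).
Proof.
rewrite -integral_cst //=; last exact: measurable_shadow_range.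
rewrite integral_mkcond.
have mh : measurable_fun [set: Z] h.
  apply: measurable_sum => i; exact: measurable_indic.
apply: ge0_le_integral.
- exact: measurableT.
- move=> x _; rewrite /patch; case: ifP => // _; rewrite lee_fin divr_ge0 ?exprn_ge0 //.
  by rewrite ltW // cosh_const_gt0.
- by apply/measurable_restrict => //; exact: measurable_shadow_range.
- rewrite (_ : (fun x => _) = EFin \o (fun x => coshr (b * Num.sqrt (h x)) - 1)%R); last first.
    by apply/funext => x; exact: coshe_height.
  apply/measurable_EFinP; exact: measurable_coshr_sqrt.
move=> x _; rewrite coshe_height /patch.
case: ifPn => xG; last by rewrite lee_fin subr_ge0 coshr_ge1.
rewrite lee_fin; apply: le_trans (coshr_ge_quadratic _).
rewrite ler_wpM2r // exprMn sqr_sqrtr; last by apply: sumr_ge0 => i _.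
rewrite -[leLHS]mulr1 ler_wpM2l ?sqr_ge0 //.
move: xG; rewrite inE shadow_range => -[i _ xi].
by rewrite /h (bigD1 i) //= indicE mem_set // mulr1n lerDl sumr_ge0.
Qed.

End sparse_family.
Context (w : nat -> nat -> R) (adm_w : admissible_weight w).
Context (w_neq0 : exists m n, w m n <> 0%R).
Local Notation k := (kappa w).
Local Notation W := (fun I => embed_weight D1 D2 D3 w I Om).

Let w_ge0 m n : (0 <= w m n)%R. Proof. by have [h _ _ _] := adm_w; exact: h. Qed.

Let W_ge0 I : (0 <= W I)%R. Proof. exact: w_ge0. Qed.

Lemma ft_norm_gt0 : (0 < fine (ft_norm w))%R.
Proof.
have [m [n wmn]] := w_neq0.
apply: (lt_le_trans _ (ft_norm_ge (m + n) adm_w)).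
have mn : (m < (m + n).+1)%N by rewrite ltnS leq_addr.
rewrite (bigD1 (Ordinal mn)) //= addKn ltr_wpDr ?sumr_ge0 //.
by rewrite lt0r w_ge0 andbT; apply/eqP.
Qed.

Lemma kappa_gt0 : (0 < k)%R.
Proof. by rewrite invr_gt0 mulr_gt0 // ft_norm_gt0. Qed.

Section weighted_family.
Context (K : finType) (r : K -> zrect R d1 d2 d3) (r_inj : injective r).
Context (rU : forall i, U (r i)).

(** The constant is 20 / 160 = 1/8. The subset is re-indexed by an ordinal because [family_carleson]
    compares a whole family with its own shadow. *)
Lemma weighted_carleson (s : {set K}) :
  \sum_(i in s) (k * W (r i))%:E * mu (rect_set (r i)) <=
  (8^-1)%:E * mu (\bigcup_(i in [set` s]) rect_set (r i)).
Proof.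
have k0 := kappa_gt0; have ft0 := ft_norm_gt0.
pose r' (i : 'I_#|s|) := r (enum_val i).
have r'_inj : injective r' by move=> i j /r_inj/enum_val_inj.
have le := family_carleson d1_gt0 d2_gt0 gD1 gD2 gD3 adm r'_inj (fun i => rU _) adm_w.
have shE : \bigcup_(i in [set` s]) rect_set (r i) = \bigcup_i rect_set (r' i).
  apply/seteqP; split=> x [i si xi]; last first.
    by exists (enum_val i) => //; exact: enum_valP.
  by exists (enum_rank_in si i) => //; rewrite /r' enum_rankK_in.
have sumE : \sum_(i in s) (k * W (r i))%:E * mu (rect_set (r i)) =
    k%:E * \sum_(i : 'I_#|s|) (W (r' i))%:E * mu (rect_set (r' i)).
  rewrite ge0_sume_distrr; last by move=> i _; rewrite mule_ge0 // lee_fin.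
  by rewrite big_enum_val; apply: eq_bigr => i _; rewrite EFinM muleA.
rewrite sumE shE; apply: (@le_trans _ _ (k%:E * ((20 * fine (ft_norm w))%:E * mu (\bigcup_i rect_set (r' i))))).
  by apply: lee_wpmul2l => //; rewrite lee_fin ltW.
rewrite muleA -EFinM (_ : k * (20 * fine (ft_norm w)) = 8^-1)%R //.
by rewrite /kappa; field; rewrite gt_eqF.
Qed.

(** The leading constant 1/8 and an error 48 b C <= 1/24 add up to at most 1/6, whence b^2 / 12. *)
Lemma weighted_cosh_le :
  \int[mu]_x (coshr (b * Num.sqrt (k * \sum_i W (r i) * \1_(rect_set (r i)) x)) - 1)%:E <=
  (b ^+ 2 / 12)%:E * mu (\bigcup_i rect_set (r i)).
Proof.
have [b1 bC1] := cosh_const_bounds; have b0 := cosh_const_gt0; have C0 := exp_const_ge0.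
have k0 := kappa_gt0.
have a0 i : (0 <= k * W (r i))%R by rewrite mulr_ge0 // ltW.
have carl (s : {set K}) : \sum_(i in s) (k * W (r i))%:E * mu (rect_set (r i)) <=
    mu (\bigcup_(i in [set` s]) rect_set (r i)).
  apply: (le_trans (weighted_carleson s)); rewrite -[leRHS]mul1e.
  by apply: lee_wpmul2r => //; rewrite lee_fin; lra.
have b48 : (b <= 48^-1)%R by lra.
have := family_cosh_le gD1 gD2 gD3 Uz antiU r_inj rU a0 carl (ltW b0) b48.
under eq_integral => x _.
  rewrite (_ : (\sum_i k * W (r i) * \1_(rect_set (r i)) x =
      k * \sum_i W (r i) * \1_(rect_set (r i)) x)%R); last first.
    by rewrite mulr_sumr; apply: eq_bigr => i _; rewrite mulrA.
  over.
move=> le; apply: (le_trans le).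
have sE : \sum_i (k * W (r i))%:E * mu (rect_set (r i)) <= (8^-1)%:E * mu (\bigcup_i rect_set (r i)).
  have := weighted_carleson [set: K]%SET; under eq_bigl do rewrite finset.inE.
  have -> : [set` [set: K]%SET] = [set: K] by apply/seteqP; split=> i //= _; rewrite finset.inE.
  by [].
set M := mu (\bigcup_i rect_set (r i)) in sE *.
apply: (@le_trans _ _ ((b ^+ 2 / 2)%:E * ((8^-1)%:E * M + (48 * b * C)%:E * M))).
  by apply: lee_wpmul2l; [rewrite lee_fin divr_ge0 ?sqr_ge0|exact: leeD2r].
have Mf : M \is a fin_num.
  rewrite ge0_fin_numE ?measure_ge0 //; apply: le_lt_trans Omfin; apply: le_measure; rewrite ?inE //.
    exact: fin_bigcup_measurable.
  by move=> x [i _]; exact: UOm.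
have [v v0 vE] : exists2 v : R, (0 <= v)%R & M = v%:E.
  by exists (fine M); [rewrite fine_ge0 ?measure_ge0|rewrite fineK].
rewrite vE lee_fin.
rewrite [leLHS](_ : _ = b ^+ 2 / 2 * (8^-1 + 48 * (b * C)) * v)%R; last by ring.
rewrite ler_wpM2r //.
have : (b ^+ 2 / 2 * (8^-1 + 48 * (b * C)) <= b ^+ 2 / 2 * (6^-1))%R.
  by rewrite ler_wpM2l ?divr_ge0 ?sqr_ge0 //; lra.
lra.
Qed.

End weighted_family.
End main_estimates.

(** * Exhaustion of the family *)

Section exhaustion.
Context (R : realType) (d1 d2 d3 : nat) (d1_gt0 : (0 < d1)%N) (d2_gt0 : (0 < d2)%N).
Context (D1 : set (cube R d1)) (D2 : set (cube R d2)) (D3 : set (cube R d3)).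
Context (gD1 : dyadic_grid D1) (gD2 : dyadic_grid D2) (gD3 : dyadic_grid D3).
Local Open Scope classical_set_scope.
Local Open Scope ereal_scope.
Local Notation Z := (zspace R d1 d2 d3).
Local Notation mu := (@zlebesgue R d1 d2 d3).
Context (Om : set Z) (U : set (zrect R d1 d2 d3)).
Context (adm : admissible_pair D1 D2 D3 Om U).
Context (w : nat -> nat -> R) (adm_w : admissible_weight w).
Context (w_neq0 : exists m n, w m n <> 0%R).
Local Notation b := (cosh_const R).
Local Notation k := (kappa w).
Local Notation W := (fun I => embed_weight D1 D2 D3 w I Om).
Local Notation H := (weighted_height D1 D2 D3 Om U w).

Let mOm : measurable Om. Proof. by have [] := adm. Qed.
Let Omfin : mu Om < +oo. Proof. by have [] := adm. Qed.
Let Uz : U `<=` zygmund_rects D1 D2 D3. Proof. by have [] := adm. Qed.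
Let UOm I : U I -> rect_set I `<=` Om. Proof. by have [_ _ _ h _] := adm; exact: h. Qed.
Let antiU : forall I J, U I -> U J -> rect_set I `<=` rect_set J -> I = J.
Proof. by have [_ _ _ _ h] := adm; exact: h. Qed.
Let k0 : (0 < k)%R. Proof. exact: kappa_gt0 adm_w w_neq0. Qed.
Let b0 : (0 < b)%R. Proof. exact: cosh_const_gt0. Qed.
Let W_ge0 I : (0 <= W I)%R. Proof. by have [h _ _ _] := adm_w; exact: h. Qed.
Let mrect (I : zrect R d1 d2 d3) : measurable (rect_set I).
Proof. by have [] := rect_measure I. Qed.

Context (f : nat -> zrect R d1 d2 d3) (B : pred nat).
Context (fU : forall n, B n -> U (f n)) (f_onto : forall I, U I -> exists2 n, B n & f n = I)
  (f_inj : {in B &, injective f}).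

Let s n := [set i : 'I_n | B i]%SET.
Let K n := 'I_#|s n|.
Let r n (i : K n) := f (enum_val i).

Let Bi n (i : K n) : B (enum_val i).
Proof. by have := enum_valP i; rewrite inE. Qed.

Let r_inj n : injective (@r n).
Proof. by move=> i j /f_inj e; apply/enum_val_inj/val_inj/e; rewrite unfold_in; exact: Bi. Qed.

Let rU n (i : K n) : U (r i). Proof. exact/fU/Bi. Qed.

Let g n x : R := (\sum_(i : K n) W (r i) * \1_(rect_set (r i)) x)%R.
Let sh n : set Z := \bigcup_(i : K n) rect_set (r i).

Let gE n x : g n x = (\sum_(0 <= i < n | B i) W (f i) * \1_(rect_set (f i)) x)%R.
Proof.
rewrite /g -(big_enum_val (fun i : 'I_n => W (f i) * \1_(rect_set (f i)) x)%R) big_mkord.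
by apply: eq_bigl => i; rewrite inE.
Qed.

Let g_ge0 n x : (0 <= g n x)%R.
Proof. by apply: sumr_ge0 => i _; rewrite mulr_ge0. Qed.

Let g_nd x : nondecreasing_seq (g ^~ x).
Proof.
move=> m n mn; rewrite !gE (big_cat_nat _ mn) //= lerDl.
by apply: sumr_ge0 => i _; rewrite mulr_ge0.
Qed.

Let mg n : measurable_fun [set: Z] (g n).
Proof.
apply: measurable_sum => i; apply: measurable_funM; first exact: measurable_cst.
by apply: measurable_indic; exact: mrect.
Qed.

Let g_cvg x : (g n x)%:E @[n --> \oo] --> H x.
Proof.
pose a i := (W (f i) * \1_(rect_set (f i)) x)%:E.
have a0 i : 0 <= a i by rewrite lee_fin mulr_ge0.
have -> : H x = \sum_(i <oo | B i) a i.
  rewrite nneseries_esum // /weighted_height.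
  rewrite (@reindex_esum _ _ _ [set i | B i] U f) //; split.
  - by move=> i /= /fU.
  - by move=> i j /set_mem Bi' /set_mem Bj; apply: f_inj.
  - by move=> I /f_onto[i Bi' <-]; exists i.
rewrite (_ : (fun n => (g n x)%:E) = (fun n => \sum_(0 <= i < n | B i) a i)); last first.
  by apply/funext => n; rewrite gE sumEFin.
by apply: is_cvg_nneseries_cond => i _ _.
Qed.

Let shE n : sh n = \bigcup_(i in [set i | (i < n)%N && B i]) rect_set (f i).
Proof.
apply/seteqP; split=> x [i].
  by move=> _ xi; exists (enum_val i) => //=; rewrite ltn_ord Bi.
move=> /= /andP[ni Bi'] xi; have si : Ordinal ni \in s n by rewrite inE.
by exists (enum_rank_in si (Ordinal ni)) => //; rewrite /r enum_rankK_in.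
Qed.

Let msh n : measurable (sh n).
Proof.
by apply: fin_bigcup_measurable => [|i _]; [exact: (@finite_finset (K n))|exact: mrect].
Qed.

Let shU n : sh n `<=` shadow U.
Proof. by move=> x [i _ xi]; exists (r i) => //; exact: rU. Qed.

Let shadowE : shadow U = \bigcup_n sh n.
Proof.
apply/seteqP; split; last by move=> x [n _ /shU].
move=> x [I UI xI]; have [i Bi' fi] := f_onto UI.
by exists i.+1 => //; rewrite shE; exists i => //=; rewrite ?ltnSn // fi.
Qed.

Lemma measurable_shadow : measurable (shadow U).
Proof. by rewrite shadowE; exact: bigcup_measurable. Qed.

Let shadowOm : shadow U `<=` Om.
Proof. by move=> x [I /UOm]; exact. Qed.

Lemma shadow_fin_num : mu (shadow U) \is a fin_num.
Proof.
rewrite ge0_fin_numE ?measure_ge0 //; apply: le_lt_trans Omfin.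
by apply: le_measure; rewrite ?inE //; exact: measurable_shadow.
Qed.

Lemma exhausting_family : exists n, (7 / 10)%:E * mu (shadow U) <= mu (sh n).
Proof.
have nd : nondecreasing_seq sh.
  move=> i j ij; rewrite !shE; apply/subsetPset => x [l /= /andP[li Bl] xl].
  by exists l => //=; rewrite (leq_trans li ij).
have cv : mu \o sh @ \oo --> mu (\bigcup_n sh n).
  by apply: nondecreasing_cvg_mu => //; rewrite -shadowE; exact: measurable_shadow.
rewrite -shadowE in cv.
(* If no stage reached 7/10, the limit would give a shadow of measure at most 7/10 of itself, hence
   null, and stage 0 would do after all. *)
have [//|none] := pselect (exists n, (7 / 10)%:E * mu (shadow U) <= mu (sh n)).
have lt n : mu (sh n) <= (7 / 10)%:E * mu (shadow U).
  by rewrite leNgt; apply/negP => h; apply: none; exists n; exact: ltW.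
have le : mu (shadow U) <= (7 / 10)%:E * mu (shadow U).
  by apply: (cvge_le _ cv); exact: nearW.
exists 0%N; apply: le_trans (measure_ge0 _ _).
move: le; rewrite -(fineK shadow_fin_num) -!EFinM !lee_fin.
by have : (0 <= fine (mu (shadow U)))%R by [rewrite fine_ge0 // measure_ge0]; lra.
Qed.

Let Phi n x : R := (coshr (b * Num.sqrt (k * g n x)) - 1)%R.

Let Phi_le n : \int[mu]_x (Phi n x)%:E <= (b ^+ 2 / 12)%:E * mu (shadow U).
Proof.
apply: le_trans (weighted_cosh_le d1_gt0 d2_gt0 gD1 gD2 gD3 adm adm_w w_neq0 (@r_inj n) (@rU n)) _.
apply: lee_wpmul2l; first by rewrite lee_fin divr_ge0 ?sqr_ge0.
by apply: le_measure; rewrite ?inE; [exact: msh|exact: measurable_shadow|exact: shU].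
Qed.

Let arg_nd x m n : (m <= n)%N -> (b * Num.sqrt (k * g m x) <= b * Num.sqrt (k * g n x))%R.
Proof.
move=> mn; rewrite ler_pM2l //; apply: ler_wsqrtr.
by rewrite ler_pM2l //; exact: g_nd.
Qed.

Let arg_ge0 x n : (0 <= b * Num.sqrt (k * g n x))%R.
Proof. by rewrite mulr_ge0 ?sqrtr_ge0 // ltW. Qed.

Let coshe_H_fin t : (0 <= t)%R -> coshe (b%:E * sqrte (k%:E * t%:E)) - 1 =
  (coshr (b * Num.sqrt (k * t)) - 1)%:E.
Proof. by move=> t0; rewrite /coshr mulrC. Qed.

Let arg_y : b%:E * sqrte (k%:E * +oo) = +oo.
Proof. by rewrite gt0_muley ?lte_fin //= gt0_muley ?lte_fin. Qed.

Let coshe_H_y : coshe (b%:E * sqrte (k%:E * +oo)) - 1 = +oo.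
Proof. by rewrite arg_y /coshe /= gt0_muley // lte_fin invr_gt0. Qed.

Let sqrt_arg_cont : continuous (fun t : R => b * Num.sqrt (k * t))%R.
Proof.
move=> t; apply: cvgMr.
apply: (@continuous_comp _ _ _ (fun t => k * t)%R (@Num.sqrt R)).
  by apply: cvgMr; exact: cvg_id.
exact: sqrt_continuous.
Qed.

Let growth t : (0 <= t -> b ^+ 2 * k / 2 * t - 0 <= coshr (b * Num.sqrt (k * t)) - 1)%R.
Proof.
move=> t0; apply: le_trans (coshr_ge_quadratic _).
by rewrite exprMn sqr_sqrtr ?mulr_ge0 ?(ltW k0) //; lra.
Qed.

Let bk_gt0 : (0 < b ^+ 2 * k / 2)%R.
Proof. by rewrite divr_gt0 ?mulr_gt0 ?exprn_gt0. Qed.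

Lemma cosh_height_le : measurable_fun [set: Z] (fun x => coshe (b%:E * sqrte (k%:E * H x)) - 1) /\
  \int[mu]_x (coshe (b%:E * sqrte (k%:E * H x)) - 1) <= (b ^+ 2 / 12)%:E * mu (shadow U).
Proof.
apply: (@integral_limit_le _ Z R mu setT Phi).
- exact: measurableT.
- by move=> n; apply: measurable_coshr_sqrt; apply: measurable_funM => //; exact: measurable_cst.
- by move=> n x; rewrite subr_ge0 coshr_ge1.
- by move=> x m n mn; rewrite lerD2r coshr_homo ?arg_nd.
- move=> x.
  apply: (@cvg_extended R (fun t => coshr (b * Num.sqrt (k * t)) - 1)%R
    (fun h => coshe (b%:E * sqrte (k%:E * h)) - 1) _ 0%R (g ^~ x) (H x) bk_gt0) => //.
  + move=> t; apply: cvgB; last exact: cvg_cst.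
    apply: (@continuous_comp _ _ _ (fun t => b * Num.sqrt (k * t))%R (@coshr R)).
      exact: sqrt_arg_cont.
    exact: coshr_continuous.
- exact: Phi_le.
Qed.

(** From e^y <= 2 cosh y = 2 + 2 (cosh y - 1). With M a quarter of the measure of [Om] the
    right-hand side becomes 5/2 of that measure. *)
Lemma exp_height_le (M : \bar R) : (b ^+ 2 / 12)%:E * mu (shadow U) <= M ->
  \int[mu]_(x in Om) expeR (b%:E * sqrte (k%:E * H x)) <= 2%:E * mu Om + 2%:E * M.
Proof.
move=> leM; pose u n x : R := expR (b * Num.sqrt (k * g n x)).
have mPhi n : measurable_fun [set: Z] (Phi n).
  by apply: measurable_coshr_sqrt; apply: measurable_funM => //; exact: measurable_cst.
have mu_n n : measurable_fun [set: Z] (u n).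
  have c : measurable_fun [set: R] (fun t : R => expR (b * Num.sqrt (k * t)))%R.
    apply: continuous_measurable_fun => t.
    apply: (@continuous_comp _ _ _ (fun t => b * Num.sqrt (k * t))%R (@expR R)).
      exact: sqrt_arg_cont.
    exact: continuous_expR.
  exact: (measurableT_comp c (mg n)).
have Phi0 n x : (0 <= Phi n x)%R by rewrite subr_ge0 coshr_ge1.
suff [] : measurable_fun [set: Z] (fun x => expeR (b%:E * sqrte (k%:E * H x))) /\
  \int[mu]_(x in Om) expeR (b%:E * sqrte (k%:E * H x)) <= 2%:E * mu Om + 2%:E * M by [].
apply: (@integral_limit_le _ Z R mu Om u).
- exact: mOm.
- exact: mu_n.
- by move=> n x; exact: expR_ge0.
- by move=> x m n mn; rewrite ler_expR arg_nd.
- move=> x.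
  apply: (@cvg_extended R (fun t => expR (b * Num.sqrt (k * t)))%R
    (fun h => expeR (b%:E * sqrte (k%:E * h))) _ 0%R (g ^~ x) (H x) bk_gt0) => //.
  + move=> t; apply: (@continuous_comp _ _ _ (fun t => b * Num.sqrt (k * t))%R (@expR R)).
      exact: sqrt_arg_cont.
    exact: continuous_expR.
  + move=> t t0; apply: (le_trans (growth t0)).
    have y0 : (0 <= b * Num.sqrt (k * t))%R by rewrite mulr_ge0 ?sqrtr_ge0 // ltW.
    have : (expR (- (b * Num.sqrt (k * t))) <= expR (b * Num.sqrt (k * t)))%R.
      by rewrite ler_expR; lra.
    by rewrite /coshr; lra.
  + by rewrite arg_y.
move=> n; apply: (@le_trans _ _ (\int[mu]_(x in Om) (2%:E + 2%:E * (Phi n x)%:E))).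
  apply: ge0_le_integral.
  - exact: mOm.
  - by move=> x _; rewrite lee_fin expR_ge0.
  - by apply/measurable_EFinP; exact: (measurable_funTS (mu_n n)).
  - apply: emeasurable_funD; first exact: measurable_cst.
    apply: emeasurable_funM; first exact: measurable_cst.
    by apply/measurable_EFinP; exact: (measurable_funTS (mPhi n)).
  - move=> x _; rewrite lee_fin /Phi /coshr; have := expR_ge0 (- (b * Num.sqrt (k * g n x)))%R.
    by rewrite /u; lra.
have mP : measurable_fun Om (fun x => (Phi n x)%:E).
  by apply/measurable_EFinP; exact: (measurable_funTS (mPhi n)).
rewrite ge0_integralD; first last.
- by apply: emeasurable_funM; [exact: measurable_cst|exact: mP].
- by move=> x _; rewrite -EFinM lee_fin mulr_ge0.
- exact: measurable_cst.
- by move=> x _; rewrite lee_fin.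
- exact: mOm.
rewrite integral_cst; last exact: mOm.
rewrite ge0_integralZl_EFin; first last.
- by [].
- exact: mP.
- by move=> x _; rewrite lee_fin.
- exact: mOm.
apply: leeD2l; apply: lee_wpmul2l; first by rewrite lee_fin.
apply: le_trans leM; apply: le_trans (Phi_le n).
apply: ge0_subset_integral.
- exact: mOm.
- exact: measurableT.
- by apply/measurable_EFinP; exact: mPhi.
- by move=> x _; rewrite lee_fin.
- by [].
Qed.

Let H_ge0 x : 0 <= H x.
Proof. by apply: esum_ge0 => I _; rewrite lee_fin mulr_ge0. Qed.

(** Taking y = b sqrt (k H) in [powR_le_coshr] bounds H^q by 4 c^q (cosh y - 1), and the 4 cancels
    the 1/4 of the hypothesis. *)
Lemma Lnorm_height_le (q : R) (M : \bar R) : (1 <= q)%R ->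
  \int[mu]_x (coshe (b%:E * sqrte (k%:E * H x)) - 1) <= (4^-1)%:E * M -> 0 <= M ->
  'N[mu]_(q%:E)[H \_ Om] <= (2 * q ^+ 2 / (b ^+ 2 * k))%:E * M `^ q^-1.
Proof.
move=> q1 leM M0; have q0 : (0 < q)%R by lra.
have bk0 : (0 < b ^+ 2 * k)%R by rewrite mulr_gt0 ?exprn_gt0.
have c0 : (0 <= 2 * q ^+ 2 / (b ^+ 2 * k))%R by rewrite divr_ge0 ?mulr_ge0 ?sqr_ge0 // ltW.
set c := (2 * q ^+ 2 / (b ^+ 2 * k))%R in c0 *.
have HOm : H \_ Om = H.
  apply/funext => x; rewrite /patch; case: ifPn => // xOm.
  apply/esym; apply: esum1 => I UI; rewrite indicE memNset ?mulr0 // => xI.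
  by move/negP: xOm; apply; rewrite inE; exact: UOm UI _ xI.
have mH : measurable_fun [set: Z] H.
  apply: (@emeasurable_fun_cvg _ _ _ _ (fun n => EFin \o g n)) => [n|x _].
    exact/measurable_EFinP.
  exact: g_cvg.
rewrite HOm unlock.
have cq0 : (0 <= 4 * c `^ q)%R by rewrite mulr_ge0 // powR_ge0.
have [mF _] := cosh_height_le.
have F0 x : 0 <= coshe (b%:E * sqrte (k%:E * H x)) - 1.
  move: (H_ge0 x); case: (H x) => [t t0|_|//]; last by rewrite coshe_H_y leey.
  by rewrite coshe_H_fin // lee_fin subr_ge0 coshr_ge1.
have key x : `|H x| `^ q <= (4 * c `^ q)%:E * (coshe (b%:E * sqrte (k%:E * H x)) - 1).
  move: (H_ge0 x); case: (H x) => [t t0|_|//].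
    rewrite coshe_H_fin // gee0_abs // poweR_EFin -EFinM lee_fin.
    have y0 : (0 <= b * Num.sqrt (k * t))%R by rewrite mulr_ge0 ?sqrtr_ge0 // ltW.
    have := powR_le_coshr y0 q1.
    rewrite exprMn sqr_sqrtr ?mulr_ge0 ?(ltW k0) // mulrA
      [((b ^+ 2 * k * t) `^ q)%R]powRM ?(ltW bk0) // => le.
    have p0 : (0 < (b ^+ 2 * k) `^ q)%R by exact: powR_gt0.
    rewrite -(ler_pM2l p0); apply: (le_trans le).
    rewrite (_ : (2 * q ^+ 2) = (b ^+ 2 * k) * c)%R; last first.
      by rewrite /c [RHS]mulrC divfK // gt_eqF.
    rewrite powRM ?(ltW bk0) //.
    by rewrite le_eqVlt; apply/orP; left; apply/eqP; ring.
  rewrite coshe_H_y gt0_muley ?leey // lte_fin mulr_gt0 // powR_gt0 //.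
  by rewrite divr_gt0 // mulr_gt0 // exprn_gt0.
have int_le : \int[mu]_x (`|H x| `^ q) <= (c `^ q)%:E * M.
  apply: (@le_trans _ _ (\int[mu]_x ((4 * c `^ q)%:E * (coshe (b%:E * sqrte (k%:E * H x)) - 1)))).
    apply: ge0_le_integral.
    - exact: measurableT.
    - by move=> x _; exact: poweR_ge0.
    - apply: (measurableT_comp (measurable_poweR _)).
      exact: measurableT_comp.
    - by apply: emeasurable_funM; [exact: measurable_cst|exact: mF].
    - by move=> x _; exact: key.
  rewrite ge0_integralZl_EFin; first last.
  - exact: cq0.
  - exact: mF.
  - by move=> x _; exact: F0.
  - exact: measurableT.
  apply: (@le_trans _ _ ((4 * c `^ q)%:E * ((4^-1)%:E * M))).
    by apply: lee_wpmul2l.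
  by rewrite muleA -EFinM (_ : 4 * c `^ q * 4^-1 = c `^ q)%R //; field.
have qi0 : (0 <= q^-1)%R by rewrite invr_ge0 ltW.
apply: (@le_trans _ _ (((c `^ q)%:E * M) `^ q^-1)).
  apply: gt0_ler_poweR => //; rewrite in_itv /= leey andbT.
    by apply: integral_ge0 => x _; exact: poweR_ge0.
  by rewrite mule_ge0 // lee_fin powR_ge0.
rewrite poweRM ?lee_fin ?powR_ge0 // poweR_EFin -powRrM divff ?gt_eqF // powRr1 //.
Qed.

End exhaustion.

Local Open Scope classical_set_scope.
Local Open Scope ring_scope.
Local Open Scope ereal_scope.

Theorem theorem5p7 (R : realType) :
  exists2 b : R, (0 < b)%R &
  forall (d1 d2 d3 : nat), (0 < d1)%N -> (0 < d2)%N -> (0 < d3)%N ->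
  forall (D1 : set (cube R d1)) (D2 : set (cube R d2)) (D3 : set (cube R d3)),
  dyadic_grid D1 -> dyadic_grid D2 -> dyadic_grid D3 ->
  forall (Om : set (zspace R d1 d2 d3)) (U : set (zrect R d1 d2 d3)),
  admissible_pair D1 D2 D3 Om U ->
  forall w : nat -> nat -> R,
  admissible_weight w -> (exists m n, w m n <> 0%R) ->
  let mu := @zlebesgue R d1 d2 d3 in
  let Hw := weighted_height D1 D2 D3 Om U w in
  let k := kappa w in
  exists G0 : set (zrect R d1 d2 d3),
  [/\ G0 `<=` U,
      sparse (8^-1)%R G0,
      \int[mu]_x (coshe (b%:E * sqrte (k%:E * Hw x)) - 1) <=
        \int[mu]_x (coshe (b%:E * sqrte (height G0 x)) - 1) /\
      \int[mu]_x (coshe (b%:E * sqrte (height G0 x)) - 1) <=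
        (4^-1)%:E * mu (shadow G0),
      \int[mu]_(x in Om) expeR (b%:E * sqrte (k%:E * Hw x)) <=
        (5 / 2)%:E * mu Om
    & forall q : R, (1 <= q)%R ->
      'N[mu]_(q%:E)[Hw \_ Om] <=
        (2 * q ^+ 2 / (b ^+ 2 * k))%:E * mu (shadow G0) `^ q^-1].
Proof.
exists (cosh_const R); first exact: cosh_const_gt0.
move=> d1 d2 d3 d1_gt0 d2_gt0 _ D1 D2 D3 gD1 gD2 gD3 Om U adm w adm_w w_neq0 mu Hw k.
have [mOm Omfin Uz UOm antiU] := adm.
have cU : countable U.
  apply: sub_countable (countableX (countableX (countable_grid gD1) (countable_grid gD2))
    (countable_grid gD3)).
  by apply: subset_card_le => I /Uz[].
pose x0 : zrect R d1 d2 d3 := ((0, [tuple of nseq d1 0])%R, (0, [tuple of nseq d2 0])%R,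
  (0, [tuple of nseq d3 0])%R).
have [f [B [fU f_onto f_inj]]] := countable_enumeration x0 cU.
have [n large] := exhausting_family adm fU f_onto.
pose s := [set i : 'I_n | B i]%SET.
pose r (i : 'I_#|s|) := f (enum_val i).
have Bi (i : 'I_#|s|) : B (enum_val i) by have := enum_valP i; rewrite inE.
have r_inj : injective r.
  by move=> i j /f_inj e; apply/enum_val_inj/val_inj/e; rewrite unfold_in; exact: Bi.
have rU i : U (r i) by exact/fU/Bi.
have [g [E [E_sub E_triv vol]]] := family_sparse gD1 gD2 gD3 Uz antiU r_inj rU.
pose r' (i : 'I_#|g|) := r (enum_val i).
have r'_inj : injective r' by move=> i j /r_inj/enum_val_inj.
have r'U i : U (r' i) by exact: rU.
pose E' (i : 'I_#|g|) := E (enum_val i).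
have E'_sub i : [/\ measurable (E' i), E' i `<=` rect_set (r' i) &
    (8^-1)%:E * mu (rect_set (r' i)) <= mu (E' i)].
  by apply: E_sub; exact: enum_valP.
have E'_triv : trivIset [set: 'I_#|g|] E'.
  by move=> i j _ _ /(E_triv _ _ (enum_valP i) (enum_valP j))/enum_val_inj.
pose G := range r'.
have GU : G `<=` U by move=> _ [i _ <-].
have mG : measurable (shadow G) by exact: measurable_shadow_range.
have shG : shadow G = \bigcup_(i in [set` g]) rect_set (r i).
  rewrite shadow_range; apply/seteqP; split=> x [i gi xi].
    by exists (enum_val i) => //; exact: enum_valP.
  by exists (enum_rank_in gi i) => //; rewrite /r' enum_rankK_in.
have Ufin : mu (shadow U) \is a fin_num.
  by have := shadow_fin_num adm fU f_onto.
have sGU : mu (shadow G) <= mu (shadow U).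
  apply: le_measure; rewrite ?inE; [exact: mG|exact: measurable_shadow fU f_onto|].
  by move=> x [I /GU UI xI]; exists I.
(* 5 / 21 * (7 / 10) = 1 / 6 *)
have sG : mu (shadow U) <= 6%:E * mu (shadow G).
  have G0 : 0 <= mu (shadow G) by exact: measure_ge0.
  have Gfin : mu (shadow G) \is a fin_num.
    by rewrite ge0_fin_numE // (le_lt_trans sGU) // -ge0_fin_numE // measure_ge0.
  have : 5%:E * ((7 / 10)%:E * mu (shadow U)) <= 21%:E * mu (shadow G).
    by rewrite shG; apply: le_trans vol; apply: lee_wpmul2l => //; rewrite lee_fin.
  by rewrite -(fineK Ufin) -(fineK Gfin) -!EFinM !lee_fin; lra.
have GOm : mu (shadow G) <= mu Om.
  apply: le_measure; rewrite ?inE //.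
  by move=> x [I /GU/UOm]; exact.
have [_ cH] := cosh_height_le d1_gt0 d2_gt0 gD1 gD2 gD3 adm adm_w w_neq0 fU f_onto f_inj.
have ge := sparse_cosh_ge r'_inj.
have le := sparse_cosh_le gD1 gD2 gD3 adm r'_inj r'U E'_sub E'_triv.
have chain : (cosh_const R ^+ 2 / 12)%:E * mu (shadow U) <=
    (cosh_const R ^+ 2 / 2)%:E * mu (shadow G).
  rewrite (_ : (_ ^+ 2 / 2)%:E = (cosh_const R ^+ 2 / 12)%:E * 6%:E); last first.
    by rewrite -EFinM; congr EFin; field.
  by rewrite -muleA; apply: lee_wpmul2l => //; rewrite lee_fin divr_ge0 ?sqr_ge0.
have first : \int[mu]_x (coshe ((cosh_const R)%:E * sqrte (k%:E * Hw x)) - 1) <=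
    \int[mu]_x (coshe ((cosh_const R)%:E * sqrte (height G x)) - 1).
  exact: le_trans (le_trans cH chain) ge.
exists G; split=> //.
- by have := sparse_range r'_inj E'_sub E'_triv.
- have bound : (cosh_const R ^+ 2 / 12)%:E * mu (shadow U) <= (4^-1)%:E * mu Om.
    apply: (le_trans chain); apply: (le_trans ge); apply: (le_trans le).
    by apply: lee_wpmul2l => //; rewrite lee_fin.
  apply: (le_trans (exp_height_le d1_gt0 d2_gt0 gD1 gD2 gD3 adm adm_w w_neq0 fU f_onto f_inj bound)).
  rewrite muleA -EFinM -ge0_muleDl ?lee_fin //.
  by rewrite -EFinD (_ : 2 + 2 * 4^-1 = 5 / 2)%R //; field.
- move=> q q1; apply: (Lnorm_height_le d1_gt0 d2_gt0 gD1 gD2 gD3 adm adm_w w_neq0 fU f_onto f_inj q1).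
    exact: le_trans first le.
  exact: measure_ge0.
Qed.
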